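(* Let $0<|q|<1$, let $r\ge 1$, and let $a$, $b$, $c_1,\dots,c_r$, $x_1,\dots,x_r$ be indeterminates (generic complex parameters, so that no denominator below vanishes). Put $C:=c_1\cdots c_r$ and, for $\mathbf n=(n_1,\dots,n_r)\in\mathbb Z^r$, $|\mathbf n|:=n_1+\dots+n_r$. For $\mathbf n,\mathbf k,\mathbf l\in\mathbb Z^r$ define \begin{multline*} f_{\mathbf n\mathbf k}= \frac{(bq,q/b)_{\infty}}{(bq/C,Cq/b)_{\infty}} \prod_{i,j=1}^r\frac{(qc_jx_i/x_j,qx_i/c_ix_j)_{\infty}} {(qc_jx_i/c_ix_j,qx_i/x_j)_{\infty}} \prod_{i=1}^r\frac{(ax_iq/b,bq/ax_i,ax_iq/c_i,c_iq/ax_i)_{\infty}} {(ax_iq/bc_i,bc_iq/ax_i,ax_iq,q/ax_i)_{\infty}}\\\times \prod_{1\le i<j\le r}\frac {c_iq^{n_i}/x_i-c_jq^{n_j}/x_j}{c_i/x_i-c_j/x_j} \prod_{i=1}^r\frac{1-bc_iq^{n_i+|\mathbf n|}/ax_i}{1-bc_i/ax_i}\, (b)_{|\mathbf n|+|\mathbf k|} \prod_{i,j=1}^r\frac 1{(qc_jx_i/x_j)_{n_j+k_i}} \prod_{i=1}^r\frac{(ax_i/c_i)_{|\mathbf k|-n_i}} {(ax_iq/b)_{k_i-|\mathbf n|}} \end{multline*} and \begin{multline*} g_{\mathbf k \mathbf l}= \prod_{1\le i<j\le r}\frac {x_iq^{k_i}-x_jq^{k_j}}{x_i-x_j} \prod_{i=1}^r\frac{1-ax_iq^{k_i+|\mathbf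 k|}}{1-ax_i}\, \frac 1{(bq)_{|\mathbf k|+|\mathbf l|}} \prod_{i,j=1}^r(c_jx_i/x_j)_{k_i+l_j} \prod_{i=1}^r\frac{(ax_i/b)_{k_i-|\mathbf l|}} {(ax_iq/c_i)_{|\mathbf k|-l_i}} \, q^{|\mathbf k|-r|\mathbf l|}. \end{multline*} Then the infinite $r$-dimensional matrices $(f_{\mathbf n\mathbf k})_{\mathbf n,\mathbf k\in\mathbb Z^r}$ and $(g_{\mathbf k\mathbf l})_{\mathbf k,\mathbf l\in\mathbb Z^r}$ are inverses of each other, i.e. for all $\mathbf n,\mathbf l\in\mathbb Z^r$, \[ \sum_{\mathbf k\in\mathbb Z^r}f_{\mathbf n\mathbf k}g_{\mathbf k\mathbf l}=\delta_{\mathbf n\mathbf l} \qquad\text{and}\qquad \sum_{\mathbf k\in\mathbb Z^r}g_{\mathbf n\mathbf k}f_{\mathbf k\mathbf l}=\delta_{\mathbf n\mathbf l}. \]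
   Context: For $0<|q|<1$ the $q$-shifted factorial is $(a)_\infty:=\prod_{j\ge0}(1-aq^j)$ and, for every integer $k$ (positive, zero or negative), $(a)_k:=(a)_\infty/(aq^k)_\infty$; also $(a_1,\dots,a_m)_k:=(a_1)_k\cdots(a_m)_k$ for $k$ an integer or $\infty$. $\delta_{\mathbf n\mathbf l}$ is the Kronecker delta on $\mathbb Z^r$. *)

(* Defs.v *)
From HB Require Import structures.
From mathcomp Require Import all_boot all_order all_algebra.
From mathcomp Require Import all_classical all_reals all_analysis.
From mathcomp Require Export complex.
Import Order.TTheory GRing.Theory Num.Theory.
Import numFieldTopology.Exports numFieldNormedType.Exports.

Set Implicit Arguments.
Unset Strict Implicit.
Unset Printing Implicit Defensive.

Local Open Scope ring_scope.
Local Open Scope classical_set_scope.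

Definition qinf (R : realType) (q a : R[i]) : R[i] :=
  limn (fun N : nat => (\prod_(j < N) (1 - a * q ^+ j) : (R[i] : numFieldType))).

Definition qpoch (R : realType) (q a : R[i]) (k : int) : R[i] :=
  qinf q a / qinf q (a * q ^ k).

Definition vabs (r : nat) (n : 'I_r -> int) : int := \sum_(i < r) n i.

Definition kdelta (R : realType) (r : nat) (n l : 'I_r -> int) : R[i] :=
  if [forall i, n i == l i] then 1 else 0.

Definition boxsum (R : realType) (r : nat) (N : nat)
  (F : ('I_r -> int) -> R[i]) : R[i] :=
  \sum_(t : {ffun 'I_r -> 'I_(N.*2.+1)})
     F (fun i => (nat_of_ord (t i))%:Z - N%:Z).

(* \sum_{k in Z^r} F k = s, the sum being absolutely convergent
   (absolute convergence makes the value independent of the exhaustion;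
    we use the exhaustion by the boxes [-N,N]^r). *)
Definition zsum_is (R : realType) (r : nat) (F : ('I_r -> int) -> R[i])
  (s : R[i]) : Prop :=
  cvgn (fun N => (boxsum N (fun k => `|F k|) : (R[i] : numFieldType))) /\
  (fun N => (boxsum N F : (R[i] : numFieldType))) @ \oo --> (s : (R[i] : numFieldType)).

Definition fpre (R : realType) (r : nat) (q a b : R[i]) (c x : 'I_r -> R[i])
  : R[i] :=
  let C := \prod_(i < r) c i in
  (qinf q (b * q) * qinf q (q / b)) / (qinf q (b * q / C) * qinf q (C * q / b))
  * \prod_(i < r) \prod_(j < r)
      ((qinf q (q * c j * x i / x j) * qinf q (q * x i / (c i * x j)))
       / (qinf q (q * c j * x i / (c i * x j)) * qinf q (q * x i / x j)))
  * \prod_(i < r)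
      ((qinf q (a * x i * q / b) * qinf q (b * q / (a * x i))
        * qinf q (a * x i * q / c i) * qinf q (c i * q / (a * x i)))
       / (qinf q (a * x i * q / (b * c i)) * qinf q (b * c i * q / (a * x i))
          * qinf q (a * x i * q) * qinf q (q / (a * x i)))).

Definition fmat (R : realType) (r : nat) (q a b : R[i]) (c x : 'I_r -> R[i])
  (n k : 'I_r -> int) : R[i] :=
  fpre q a b c x
  * \prod_(i < r) \prod_(j < r | (i < j)%N)
      ((c i * q ^ (n i) / x i - c j * q ^ (n j) / x j) / (c i / x i - c j / x j))
  * \prod_(i < r)
      ((1 - b * c i * q ^ (n i + vabs n) / (a * x i)) / (1 - b * c i / (a * x i)))
  * qpoch q b (vabs n + vabs k)
  * \prod_(i < r) \prod_(j < r) (qpoch q (q * c j * x i / x j) (n j + k i))^-1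
  * \prod_(i < r)
      (qpoch q (a * x i / c i) (vabs k - n i) / qpoch q (a * x i * q / b) (k i - vabs n)).

Definition gmat (R : realType) (r : nat) (q a b : R[i]) (c x : 'I_r -> R[i])
  (k l : 'I_r -> int) : R[i] :=
  \prod_(i < r) \prod_(j < r | (i < j)%N)
      ((x i * q ^ (k i) - x j * q ^ (k j)) / (x i - x j))
  * \prod_(i < r) ((1 - a * x i * q ^ (k i + vabs k)) / (1 - a * x i))
  * (qpoch q (b * q) (vabs k + vabs l))^-1
  * \prod_(i < r) \prod_(j < r) qpoch q (c j * x i / x j) (k i + l j)
  * \prod_(i < r)
      (qpoch q (a * x i / b) (k i - vabs l) / qpoch q (a * x i * q / c i) (vabs k - l i))
  * q ^ (vabs k - r%:Z * vabs l).

(* Genericity: every denominator occurring in f and g (after unfolding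
   (y)_k = (y)_oo/(y q^k)_oo) is nonzero, and all parameters are nonzero. *)
Definition generic (R : realType) (r : nat) (q a b : R[i]) (c x : 'I_r -> R[i])
  : Prop :=
  let C := \prod_(i < r) c i in
  (a != 0 /\ b != 0 /\ (forall i, c i != 0) /\ (forall i, x i != 0)) /\
  (qinf q (b * q / C) != 0 /\ qinf q (C * q / b) != 0 /\
   (forall i j, qinf q (q * c j * x i / (c i * x j)) != 0
                /\ qinf q (q * x i / x j) != 0) /\
   (forall i, qinf q (a * x i * q / (b * c i)) != 0 /\
              qinf q (b * c i * q / (a * x i)) != 0 /\
              qinf q (a * x i * q) != 0 /\ qinf q (q / (a * x i)) != 0)) /\
  (forall i j : 'I_r, (i < j)%N -> c i / x i - c j / x j != 0 /\ x i - x j != 0) /\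
  (forall i, 1 - b * c i / (a * x i) != 0 /\ 1 - a * x i != 0) /\
  (* denominators coming from q-shifted factorials with integer index *)
  ((forall m : int, qinf q (b * q ^ m) != 0) /\
   qinf q (b * q) != 0 /\
   (forall i j, qinf q (q * c j * x i / x j) != 0
                /\ forall m : int, qinf q (c j * x i / x j * q ^ m) != 0) /\
   (forall i, (forall m : int, qinf q (a * x i / c i * q ^ m) != 0) /\
              qinf q (a * x i * q / b) != 0 /\
              (forall m : int, qinf q (a * x i / b * q ^ m) != 0) /\
              qinf q (a * x i * q / c i) != 0)).

(* Main.v *)
(* Adjoin an (r+1)-st coordinate -|k| to k, and put X = (1/a; x_1, .., x_r) and
   Y = (a/b; c_1/x_1, .., c_r/x_r). Up to a factor independent of k, both f_nk g_kl and
   g_nk f_kl are values, at the points Z_i q^(k_i), of the Vandermonde product times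
   prod_(i,j) (A_j Z_i q^(m_j))_oo / (A_j Z_i)_oo, where {A, Z} are X and Y up to powers of
   q and the integers m_j have sum r+1; moreover all m_j are 1 exactly if n = l.

   If some m_j is at most 0, then partial fractions in each variable involve only poles
   A_j q^t for the other r values of j, so that two of the r+1 variables always meet poles
   with the same j. The sum over the lattice |k| = 0 is insensitive to moving powers of q
   between these two poles, while the coefficient is antisymmetric: the sum vanishes.

   If all m_j are 1, the summand is a Cauchy kernel. Its sum over |k| = M is a product of
   theta functions, by induction on r: one expands in the first variable and recognizes the
   partial fraction expansion of a quotient of theta products, itself a limit of finite
   partial fractions. The factor theta(U)/(1 - U q^M), where U is the product of all A_j
   and Z_i, is kept in a form that makes sense when U is a power of q. *)
From mathcomp Require Import all_boot all_order all_algebra perm.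
From mathcomp Require Import all_classical all_reals all_analysis.
From mathcomp Require Import complex.
From mathcomp Require Import ring lra zify.
Require Import Defs.
Import Order.TTheory GRing.Theory Num.Theory.
Import numFieldTopology.Exports numFieldNormedType.Exports.
Set Implicit Arguments.
Unset Strict Implicit.
Unset Printing Implicit Defensive.
Local Open Scope ring_scope.

(** * Unordered sums *)

(** The count [r+1] is an exact degree balance. In each variable the Vandermonde product has degree
    [r], while the ratios have [r+1] more linear factors below than above, so partial fractions
    leave no polynomial part. The simple fractions [1 / (1 - u * q ^ k)] tend to 1 as [k] grows and
    are not summable over the whole lattice; it is the restriction to one level that makes the sums
    converge absolutely.

    The diagonal case [n = l] still carries the shifts [q ^ l_j] in the [A_j]. The determinant form
    of the Cauchy kernel reduces it to the unshifted nodes up to a quotient of Vandermonde products,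
    so that a single constant has to be evaluated for all [n].

    In the application [U] is [C / b]. Genericity allows [C = b], where [theta U] vanishes although
    the required value does not; in the induction other subproducts take the place of [U].

    Sums are unordered because translations, permutations and iterated sums are used throughout. The
    exhaustion by boxes enters only at the end. *)

Definition has_sum (C : numFieldType) (K : eqType) (F : K -> C) (l : C) :=
  forall e : C, 0 < e -> exists A : seq K, forall B : seq K,
    uniq B -> {subset A <= B} -> `|\sum_(k <- B) F k - l| < e.

Definition summable (C : numFieldType) (K : eqType) (F : K -> C) :=
  exists M : C, forall B : seq K, uniq B -> \sum_(k <- B) `|F k| <= M.

Section HasSum.
Variable C : numFieldType.
Implicit Types K : eqType.

Lemma has_sum_unique K (F : K -> C) a b : has_sum F a -> has_sum F b -> a = b.
Proof.
move=> Fa Fb; apply/eqP; rewrite -subr_eq0 -normr_le0; apply/ler_addgt0Pr => e e0.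
have e2 : 0 < e / 2 by rewrite divr_gt0.
have [A HA] := Fa _ e2; have [B HB] := Fb _ e2.
have uU := undup_uniq (A ++ B).
rewrite add0r (le_trans (ler_distD (\sum_(k <- undup (A ++ B)) F k) _ _))//.
rewrite [leRHS](splitr e) lerD// ltW//.
  by rewrite distrC; apply: HA => // x xA; rewrite mem_undup mem_cat xA.
by apply: HB => // x xB; rewrite mem_undup mem_cat xB orbT.
Qed.

Lemma eq_has_sum K (F G : K -> C) a : F =1 G -> has_sum F a -> has_sum G a.
Proof. by move=> /funext->. Qed.

Lemma has_sum0 K : has_sum (fun _ : K => 0 : C) 0.
Proof. by move=> e e0; exists [::] => B _ _; rewrite big1// subrr normr0. Qed.

Lemma has_sumD K (F G : K -> C) a b :
  has_sum F a -> has_sum G b -> has_sum (fun k => F k + G k) (a + b).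
Proof.
move=> Fa Gb e e0; have e2 : 0 < e / 2 by rewrite divr_gt0.
have [A HA] := Fa _ e2; have [B HB] := Gb _ e2.
exists (A ++ B) => D uD sD; rewrite big_split/= opprD addrACA.
rewrite (le_lt_trans (ler_normD _ _))// [ltRHS](splitr e) ltrD//.
  by apply: HA => // x xA; apply: sD; rewrite mem_cat xA.
by apply: HB => // x xB; apply: sD; rewrite mem_cat xB orbT.
Qed.

Lemma has_sumZ K (F : K -> C) c a : has_sum F a -> has_sum (fun k => c * F k) (c * a).
Proof.
move=> Fa; have [->|c0] := eqVneq c 0.
  by rewrite mul0r; apply: eq_has_sum (has_sum0 K) => k; rewrite mul0r.
move=> e e0; have ec : 0 < e / `|c| by rewrite divr_gt0// normr_gt0.
have [A HA] := Fa _ ec; exists A => B uB sB.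
by rewrite -mulr_sumr -mulrBr normrM mulrC -ltr_pdivlMr ?normr_gt0// HA.
Qed.

Lemma has_sum_sum K (I : Type) (r : seq I) (F : I -> K -> C) (a : I -> C) :
  (forall i, has_sum (F i) (a i)) ->
  has_sum (fun k => \sum_(i <- r) F i k) (\sum_(i <- r) a i).
Proof.
move=> Fa; elim: r => [|i r IH].
  by rewrite big_nil; apply: eq_has_sum (has_sum0 K) => k; rewrite big_nil.
rewrite big_cons; apply: eq_has_sum (has_sumD (Fa i) IH) => k.
by rewrite big_cons.
Qed.

Lemma has_sum1 K (F : K -> C) k0 : (forall k, k != k0 -> F k = 0) -> has_sum F (F k0).
Proof.
move=> F0 e e0; exists [:: k0] => B uB sB.
have k0B : k0 \in B by apply: sB; rewrite mem_seq1.
rewrite (big_rem k0)//= big_seq big1 ?addr0 ?subrr ?normr0// => k.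
by rewrite mem_rem_uniq// inE => /andP[/F0].
Qed.

(** The finite set chosen for [F] is pulled back through the partial inverse [g]; its elements
    outside the image of [e] carry the value 0 and may be added to any test set. *)
Lemma has_sum_reindex K K' (e : K' -> K) (g : K -> option K') (F : K -> C) a :
  pcancel e g -> ocancel g e -> (forall k, g k = None -> F k = 0) ->
  has_sum F a -> has_sum (F \o e) a.
Proof.
move=> eK gK F0 Fa d d0; have [A HA] := Fa _ d0.
exists (pmap g A) => B uB sB.
have := HA (map e B ++ undup [seq k <- A | ~~ g k]).
have -> : \sum_(k <- map e B ++ undup [seq k <- A | ~~ g k]) F k = \sum_(k <- B) F (e k).
  rewrite big_cat/= big_map [X in _ + X]big1_seq ?addr0// => k.
  by rewrite mem_undup mem_filter => /andP[_ /andP[+ _]]; case: (g k) (F0 k) => //= ->.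
apply.
  rewrite cat_uniq map_inj_uniq ?uB ?undup_uniq ?andbT/=; last exact: pcan_inj eK.
  apply/hasPn => k; rewrite mem_undup mem_filter => /andP[gk _].
  by apply/mapP => -[k' _ kE]; rewrite kE eK in gk.
move=> k kA; rewrite mem_cat mem_undup mem_filter kA andbT.
case E: (g k) => [k'|]; last by rewrite orbT.
rewrite orbF; have := gK k; rewrite E/= => <-; apply/map_f/sB.
by rewrite mem_pmap; apply/mapP; exists k.
Qed.

(** Fubini with the total sum and the row sums both given, so that no absolute convergence is
    needed. *)
Lemma has_sum_pair K1 K2 (F : K1 * K2 -> C) (G : K1 -> C) a :
  has_sum F a -> (forall k, has_sum (fun k' => F (k, k')) (G k)) -> has_sum G a.
Proof.
move=> Fa FG e e0; have e2 : 0 < e / 2 by rewrite divr_gt0.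
have [A HA] := Fa _ e2; exists (map fst A) => B uB sB.
pose d := e / 2 / (size B).+1%:R.
have d0 : 0 < d by rewrite divr_gt0.
have /choice[A2 HA2] k := FG k _ d0.
(* Each row also receives all second coordinates of [A], so that the rows over [B] together contain
   [A]. *)
pose T k := undup (A2 k ++ map snd A).
have hT k : `|\sum_(k' <- T k) F (k, k') - G k| < d.
  by apply: HA2 => [|x]; rewrite ?undup_uniq// mem_undup mem_cat => ->.
pose D := [seq (k, k') | k <- B, k' <- T k].
have hD : `|\sum_(k <- D) F k - a| < e / 2.
  apply: HA.
    apply: allpairs_uniq_dep => // [k _|[k1 k2] [k3 k4] _ _ /= [-> ->]//].
    exact: undup_uniq.
  move=> [k1 k2] kA; apply: allpairs_f_dep; first by apply: sB; apply: map_f kA.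
  by rewrite mem_undup mem_cat (map_f snd kA) orbT.
rewrite big_allpairs_dep/= in hD.
rewrite (le_lt_trans (ler_distD (\sum_(k <- B) \sum_(k' <- T k) F (k, k')) _ _))//.
rewrite [ltRHS](splitr e) ler_ltD// distrC -sumrB.
rewrite (le_trans (ler_norm_sum _ _ _))//.
apply: (@le_trans _ _ (\sum_(k <- B) d)); first by apply: ler_sum => k _; apply: ltW.
rewrite big_const_seq count_predT iter_addr_0 /d -[leLHS]mulr_natr
mulrAC ler_pdivrMr//.
by rewrite ler_wpM2l ?(ltW e2)// ler_nat leqnSn.
Qed.

Lemma summable_le K (F G : K -> C) :
  (forall k, `|F k| <= `|G k|) -> summable G -> summable F.
Proof.
move=> FG [M HM]; exists M => B uB; apply: le_trans (HM B uB).
exact: ler_sum.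
Qed.

Lemma summableZ K (F : K -> C) c : summable F -> summable (fun k => c * F k).
Proof.
move=> [M HM]; exists (`|c| * M) => B uB.
under eq_bigr do rewrite normrM.
by rewrite -mulr_sumr ler_wpM2l// HM.
Qed.

Lemma summable0 K : summable (fun _ : K => 0 : C).
Proof. by exists 0 => B uB; rewrite big1// => *; rewrite normr0. Qed.

Lemma summableD K (F G : K -> C) :
  summable F -> summable G -> summable (fun k => F k + G k).
Proof.
move=> [M HM] [N HN]; exists (M + N) => B uB.
apply: le_trans (lerD (HM B uB) (HN B uB)); rewrite -big_split/=.
by apply: ler_sum => k _; apply: ler_normD.
Qed.

Lemma summable_sum K (I : Type) (r : seq I) (F : I -> K -> C) :
  (forall i, summable (F i)) -> summable (fun k => \sum_(i <- r) F i k).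
Proof.
move=> Fs; elim: r => [|i r IH].
  by under eq_fun do rewrite big_nil; apply: summable0.
by under eq_fun do rewrite big_cons; apply: summableD.
Qed.

Lemma summable_norm K (F : K -> C) : summable F -> summable (fun k => `|F k|).
Proof. by apply: summable_le => k; rewrite normr_id. Qed.

Lemma summable_comp K K' (e : K' -> K) (F : K -> C) :
  injective e -> summable F -> summable (F \o e).
Proof.
move=> ei [M HM]; exists M => B uB.
by have := HM (map e B); rewrite big_map map_inj_uniq//; apply.
Qed.

Lemma summable_pair K1 K2 (F : K1 -> C) (G : K2 -> C) :
  summable F -> summable G -> summable (fun k : K1 * K2 => F k.1 * G k.2).
Proof.
move=> [M HM] [N HN]; exists (M * N) => B uB.
pose B1 := undup (map fst B); pose B2 := undup (map snd B).
apply: (@le_trans _ _ (\sum_(k <- [seq (k1, k2) | k1 <- B1, k2 <- B2]) `|F k.1 * G k.2|)).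
  rewrite [leRHS](bigID (fun k => k \in B))/= ler_wpDr ?sumr_ge0//.
  rewrite -[X in _ <= X]big_filter; rewrite le_eqVlt; apply/orP; left; apply/eqP; apply: perm_big; apply: uniq_perm => //.
    rewrite filter_uniq//; apply: allpairs_uniq; rewrite ?undup_uniq//.
    by move=> [? ?] [? ?].
  move=> [k1 k2]; rewrite mem_filter andbC; case: (boolP (_ \in B)) => kB; rewrite ?andbF//.
  rewrite andbT; symmetry; apply: allpairs_f; rewrite mem_undup.
    exact: (map_f fst kB).
  exact: (map_f snd kB).
rewrite big_allpairs_dep/=.
under eq_bigr do (under eq_bigr do rewrite normrM; rewrite -mulr_sumr).
rewrite -mulr_suml ler_pM ?sumr_ge0// ?HM ?HN ?undup_uniq//.
Qed.

Lemma has_sum_tail K (F : K -> C) a : has_sum F a ->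
  forall e, 0 < e -> exists A : seq K, uniq A /\ forall B : seq K, uniq B ->
  (forall k, k \in B -> k \notin A) -> `|\sum_(k <- B) F k| < e.
Proof.
move=> Fa e e0; have e2 : 0 < e / 2 by rewrite divr_gt0.
have [A HA] := Fa _ e2; exists (undup A); split=> [|B uB dB]; first exact: undup_uniq.
have hA : `|\sum_(k <- undup A) F k - a| < e / 2.
  by apply: HA; rewrite ?undup_uniq// => x; rewrite mem_undup.
have := HA (undup A ++ B); rewrite big_cat/= => hAB.
have -> : \sum_(k <- B) F k = (\sum_(k <- undup A) F k + \sum_(k <- B) F k - a)
    - (\sum_(k <- undup A) F k - a) by ring.
rewrite (le_lt_trans (ler_normB _ _))// [ltRHS](splitr e) ltrD//; apply: hAB.
  rewrite cat_uniq undup_uniq uB/= andbT; apply/hasPn => k /dB.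
  by [].
by move=> x xA; rewrite mem_cat mem_undup xA.
Qed.

Lemma has_sum_tail_le K (F : K -> C) a (A : seq K) e : has_sum F a -> uniq A ->
  (forall B : seq K, uniq B -> (forall k, k \in B -> k \notin A) ->
    `|\sum_(k <- B) F k| <= e) -> `|\sum_(k <- A) F k - a| <= e.
Proof.
move=> Fa uA H; apply/ler_addgt0Pl => d d0; have [D HD] := Fa _ d0.
pose B := [seq k <- undup D | k \notin A].
have uB : uniq B by rewrite filter_uniq// undup_uniq.
have dB k : k \in B -> k \notin A by rewrite mem_filter => /andP[].
have hAB : `|\sum_(k <- A ++ B) F k - a| < d.
  apply: HD; first by rewrite cat_uniq uA uB andbT; apply/hasPn.
  by move=> x xD; rewrite mem_cat mem_filter mem_undup xD andbT orbN.
rewrite big_cat/= in hAB.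
have -> : \sum_(k <- A) F k - a = (\sum_(k <- A) F k + \sum_(k <- B) F k - a)
  - \sum_(k <- B) F k by ring.
by rewrite (le_trans (ler_normB _ _))// lerD ?(ltW hAB)// H.
Qed.

End HasSum.

Lemma pos_has_sum (R : realType) (K : eqType) (f : K -> R) :
  (forall k, 0 <= f k) -> summable f -> exists a, has_sum f a.
Proof.
move=> f0 [M HM]; pose E : set R := [set x | exists2 B : seq K, uniq B & x = \sum_(k <- B) f k]%classic.
have supE : has_sup E.
  split; first by exists (\sum_(k <- [::]) f k), [::].
  exists M => _ [B uB ->]; apply: le_trans (HM B uB).
  by apply: ler_sum => k _; apply: ler_norm.
exists (sup E) => e e0; have [_ [A uA ->] hA] := sup_adherent e0 supE.
exists A => B uB sB.
have AB : \sum_(k <- A) f k <= \sum_(k <- B) f k.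
  rewrite [leRHS](bigID (fun k => k \in A))/= ler_wpDr ?sumr_ge0//.
  rewrite -[X in _ <= X]big_filter le_eqVlt; apply/orP; left; apply/eqP.
  apply: perm_big; apply: uniq_perm; rewrite ?filter_uniq// => k.
  by rewrite mem_filter; case: (boolP (k \in A)) => //= /sB->.
have := sup_upper_bound supE (ex_intro2 _ _ B uB erefl).
by rewrite ltr_distlC => hB; apply/andP; split; lra.
Qed.

(** A real family is the difference of the nonnegative families [|f| + f] and [|f|]. *)
Lemma real_has_sum (R : realType) (K : eqType) (f : K -> R) :
  summable f -> exists a, has_sum f a.
Proof.
move=> fs; have ns := summable_norm fs.
have [a ha] := pos_has_sum (fun k => normr_ge0 (f k)) ns.
have [b hb] : exists b, has_sum (fun k => `|f k| + f k) b.
  apply: pos_has_sum (summableD ns fs) => k.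
  by rewrite -[f k]opprK subr_ge0 normrN ler_norm.
exists (b + -1 * a); apply: eq_has_sum (has_sumD hb (has_sumZ (-1) ha)) => k.
by ring.
Qed.

(** * Limits of sequences *)

Definition cvgs (C : numFieldType) (u : nat -> C) (l : C) := (u @ \oo --> l)%classic.

Section Limits.
Variable C : numFieldType.
Implicit Types (u v : nat -> C) (l : C).

Lemma cvgs_dist u l : cvgs u l <->
  forall e : C, 0 < e -> exists N, forall n, (N <= n)%N -> `|u n - l| < e.
Proof.
split=> [/cvgrPdist_lt ul e e0|ul].
  by have [N _ HN] := ul e e0; exists N => n Nn; rewrite distrC; apply: HN.
apply/cvgrPdist_lt => e e0; have [N HN] := ul e e0.
by exists N => // n /= /HN; rewrite distrC.
Qed.

Lemma cvgs_unique u l l' : cvgs u l -> cvgs u l' -> l = l'.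
Proof. exact: (cvg_unique (@norm_hausdorff C C)). Qed.

Lemma cvgs_cst l : cvgs (fun=> l) l.
Proof. exact: cvg_cst. Qed.
Arguments cvgs_cst l : clear implicits.

Lemma cvgsD u v l l' : cvgs u l -> cvgs v l' -> cvgs (fun n => u n + v n) (l + l').
Proof. exact: cvgD. Qed.

Lemma cvgsM u v l l' : cvgs u l -> cvgs v l' -> cvgs (fun n => u n * v n) (l * l').
Proof. exact: cvgM. Qed.

Lemma cvgsV u l : l != 0 -> cvgs u l -> cvgs (fun n => (u n)^-1) l^-1.
Proof. exact: cvgV. Qed.

Lemma cvgs_sum (K : Type) (r : seq K) (F : nat -> K -> C) (G : K -> C) :
  (forall k, cvgs (F^~ k) (G k)) ->
  cvgs (fun N => \sum_(k <- r) F N k) (\sum_(k <- r) G k).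
Proof.
move=> FG; elim: r => [|k r IH].
  rewrite big_nil (_ : (fun N => _) = fun=> 0); first exact: cvgs_cst.
  by apply/funext => N; rewrite big_nil.
rewrite big_cons (_ : (fun N => _) = (fun N => F N k + \sum_(j <- r) F N j)).
  exact: cvgsD.
by apply/funext => N; rewrite big_cons.
Qed.

Lemma cvgs_prod (K : Type) (r : seq K) (P : pred K) (F : nat -> K -> C) (G : K -> C) :
  (forall k, P k -> cvgs (F^~ k) (G k)) ->
  cvgs (fun N => \prod_(k <- r | P k) F N k) (\prod_(k <- r | P k) G k).
Proof.
move=> FG; elim: r => [|k r IH].
  rewrite big_nil (_ : (fun N => _) = fun=> 1); first exact: cvgs_cst.
  by apply/funext => N; rewrite big_nil.
rewrite big_cons; case: ifP => Pk.
  rewrite (_ : (fun N => _) = (fun N => F N k * \prod_(j <- r | P j) F N j)).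
    exact: cvgsM (FG k Pk) IH.
  by apply/funext => N; rewrite big_cons Pk.
by under eq_fun do rewrite big_cons Pk.
Qed.

Lemma cvgs_comp u l (s : nat -> nat) :
  (forall K, exists N, forall n, (N <= n)%N -> (K <= s n)%N) ->
  cvgs u l -> cvgs (u \o s) l.
Proof.
move=> soo /cvgs_dist ul; apply/cvgs_dist => e e0; have [K HK] := ul e e0.
by have [N HN] := soo K; exists N => n /HN; apply: HK.
Qed.

Lemma cvgs_bounded u l : cvgs u l -> exists M, forall n, `|u n| <= M.
Proof.
move=> /cvgs_dist/(_ 1 ltr01)[N HN].
exists (\sum_(i < N) `|u i| + (1 + `|l|)) => n.
have [nN|Nn] := ltnP n N.
  by rewrite (bigD1 (Ordinal nN))//= -addrA lerDl !addr_ge0// sumr_ge0.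
rewrite -[leLHS]add0r lerD ?sumr_ge0// -{1}(subrK l (u n)).
by rewrite (le_trans (ler_normD _ _))// lerD2r ltW// HN.
Qed.

End Limits.
Arguments cvgs_cst {C} l.

(** * Complex families: existence of sums, dominated convergence, lattices *)

Section ComplexSums.
Variable R : realType.
Local Notation C := R[i].
Local Notation toC := (real_complex R).

Lemma normc_real (x : R) : `|toC x| = toC `|x| :> C.
Proof. by rewrite normc_def/= expr0n addr0 sqrtr_sqr. Qed.

Lemma has_sum_toC (K : eqType) (f : K -> R) a :
  has_sum f a -> has_sum (fun k => toC (f k)) (toC a).
Proof.
move=> fa e e0.
have eE : e = toC (complex.Re e) by rewrite RRe_real// gtr0_real.
have [|A HA] := fa (complex.Re e); first by rewrite -ltcR/= -eE.
exists A => B uB sB; rewrite eE -rmorph_sum -rmorphB normc_real ltcR.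
exact: HA.
Qed.

Lemma normc_ge_Im (x : C) : toC `|complex.Im x| <= `|x|.
Proof.
have := normc_ge_Re (x * 'i%C); rewrite ReiNIm normrN => h; apply: le_trans h _.
rewrite normrM (_ : `|'i%C| = 1) ?mulr1//.
by rewrite normc_def/= expr0n expr1n add0r sqrtr1.
Qed.

Lemma summable_has_sum (K : eqType) (F : K -> C) : summable F -> exists a, has_sum F a.
Proof.
move=> [M HM].
have HB (g : C -> R) : (forall z, toC `|g z| <= `|z|) -> summable (fun k => g (F k)).
  move=> hg; exists (complex.Re M) => B uB.
  have : toC (\sum_(k <- B) `|g (F k)|) <= M.
    by rewrite rmorph_sum; apply: le_trans (HM B uB); apply: ler_sum => k _; apply: hg.
  by rewrite lecE => /andP[].
have [a ha] := real_has_sum (HB _ (@normc_ge_Re R)).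
have [b hb] := real_has_sum (HB _ normc_ge_Im).
exists (toC a + 'i%C * toC b).
apply: eq_has_sum (has_sumD (has_sum_toC ha) (has_sumZ 'i%C (has_sum_toC hb))) => k.
by rewrite -complexE.
Qed.

(** Dominated convergence. One finite set [A] makes the tails of [Bd] small, hence those of [G] and
    of every [F N] at once; on [A] only finitely many limits are involved. *)
Lemma tannery (K : eqType) (F : nat -> K -> C) (G Bd : K -> C) (s : nat -> C) (L : C) :
  summable Bd -> (forall N k, `|F N k| <= `|Bd k|) ->
  (forall k, cvgs (F^~ k) (G k)) ->
  (forall N, has_sum (F N) (s N)) ->
  cvgs s L ->
  summable G /\ has_sum G L.
Proof.
move=> Bs FB FG Fs sL.
have GB k : `|G k| <= `|Bd k|.
  apply/ler_addgt0Pr => e e0; have /cvgs_dist/(_ e e0)[N /(_ N (leqnn N)) HN] := FG k.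
  rewrite -(subrK (F N k) (G k)) addrC (le_trans (ler_normD _ _))// lerD//.
  by rewrite distrC ltW.
have Gs := summable_le GB Bs; split=> //.
have [a Ga] := summable_has_sum Gs; have [b Bb] := summable_has_sum (summable_norm Bs).
suff -> : L = a by [].
apply/eqP; rewrite -subr_eq0 -normr_le0; apply/ler_addgt0Pr => e e0; rewrite add0r.
have e4 : 0 < e / 4 by rewrite divr_gt0.
have [A [uA HA]] := has_sum_tail Bb e4.
have tl (H : K -> C) (c : C) : (forall k, `|H k| <= `|Bd k|) -> has_sum H c ->
    `|\sum_(k <- A) H k - c| <= e / 4.
  move=> HB Hc; apply: has_sum_tail_le => // D uD dD; apply: le_trans (ltW (HA D uD dD)).
  rewrite (le_trans (ler_norm_sum _ _ _))// [leRHS]ger0_norm ?sumr_ge0//.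
  by apply: ler_sum.
have /cvgs_dist/(_ _ e4)[N1 H1] := cvgs_sum (r := A) FG.
have /cvgs_dist/(_ _ e4)[N2 H2] := sL.
pose N := maxn N1 N2.
have h1 := ltW (H1 N (leq_maxl _ _)); have h2 := ltW (H2 N (leq_maxr _ _)).
have h3 := tl _ _ (FB N) (Fs N); have h4 := tl _ _ GB Ga.
have -> : L - a = - (s N - L) + (- (\sum_(k <- A) F N k - s N) +
  ((\sum_(k <- A) F N k - \sum_(k <- A) G k) + (\sum_(k <- A) G k - a))) by ring.
have -> : e = e / 4 + (e / 4 + (e / 4 + e / 4)) by field.
rewrite (le_trans (ler_normD _ _))// lerD ?normrN//.
rewrite (le_trans (ler_normD _ _))// lerD ?normrN//.
by rewrite (le_trans (ler_normD _ _))// lerD.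
Qed.

Definition fcons n (k : int * {ffun 'I_n -> int}) : {ffun 'I_n.+1 -> int} :=
  [ffun i => if unlift ord0 i is Some j then k.2 j else k.1].

Definition fsplit n (k : {ffun 'I_n.+1 -> int}) : int * {ffun 'I_n -> int} :=
  (k ord0, [ffun i => k (lift ord0 i)]).

Lemma fcons0 n k : @fcons n k ord0 = k.1.
Proof. by rewrite ffunE unlift_none. Qed.

Lemma fconsS n k i : @fcons n k (lift ord0 i) = k.2 i.
Proof. by rewrite ffunE liftK. Qed.

Lemma fconsK n : cancel (@fcons n) (@fsplit n).
Proof.
move=> [m k]; congr pair; first by rewrite fcons0.
by apply/ffunP => i; rewrite ffunE fconsS.
Qed.

Lemma fsplitK n : cancel (@fsplit n) (@fcons n).
Proof.
move=> k; apply/ffunP => i; case: (unliftP ord0 i) => [j ->|->].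
  by rewrite fconsS ffunE.
by rewrite fcons0.
Qed.

Lemma summable_prod n (f : 'I_n -> int -> C) : (forall i, summable (f i)) ->
  summable (fun k : {ffun 'I_n -> int} => \prod_i f i (k i)).
Proof.
elim: n f => [|n IH] f fs.
  exists 1 => -[|x [|y B]].
  - by rewrite big_nil.
  - by rewrite big_seq1 big_ord0 normr1.
  - suff -> : x = y by rewrite /= inE eqxx.
    by apply/ffunP => -[].
have h := summable_pair (fs ord0) (IH (fun i => f (lift ord0 i)) (fun i => fs _)).
apply: summable_le (summable_comp (can_inj (@fsplitK n)) h) => k.
by rewrite big_ord_recl/=; under [in leRHS]eq_bigr do rewrite ffunE.
Qed.

(** The boxes eventually contain any finite set of lattice points, so the box sums are among the
    test sums of the unordered sum. *)
Lemma has_sum_zsum r (F : ('I_r -> int) -> C) (a : C) :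
  summable (fun k : {ffun 'I_r -> int} => F k) ->
  has_sum (fun k : {ffun 'I_r -> int} => F k) a -> zsum_is F a.
Proof.
move=> Fs Fa.
pose bx N (t : {ffun 'I_r -> 'I_(N.*2.+1)}) : {ffun 'I_r -> int} :=
  [ffun i => (nat_of_ord (t i))%:Z - N%:Z].
have bx_inj N : injective (@bx N).
  move=> t t' /ffunP tt'; apply/ffunP => i; apply/val_inj.
  by have := tt' i; rewrite !ffunE => /addIr[].
have cvgbox (H : ('I_r -> int) -> C) (b : C) :
    has_sum (fun k : {ffun 'I_r -> int} => H k) b ->
    ((fun N => (boxsum N H : (C : numFieldType))) @ \oo --> (b : (C : numFieldType)))%classic.
  move=> Hb; apply/cvgs_dist => e e0; have [A HA] := Hb e e0.
  exists (\sum_(k <- A) \sum_i `|k i|)%N => N hN.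
  have -> : boxsum N H = \sum_(k <- map (@bx N) (index_enum {ffun 'I_r -> 'I_(N.*2.+1)})) H k.
    rewrite big_map; apply: eq_bigr => t _; congr H.
    by apply/funext => i; rewrite ffunE.
  apply: HA; first by rewrite (map_inj_uniq (bx_inj N)) index_enum_uniq.
  move=> k kA; have kN i : (`|k i| <= N)%N.
    apply: leq_trans hN; rewrite (big_rem k)//= (bigD1 i)//=.
    by rewrite -addnA leq_addr.
  apply/mapP; exists [ffun i => inord (absz (k i + N%:Z)%R)]; first by rewrite mem_index_enum.
  apply/ffunP => i; rewrite !ffunE inordK; have := kN i; lia.
split; last exact: cvgbox.
have [b hb] := summable_has_sum (summable_norm Fs).
by apply/cvg_ex; exists b; apply: cvgbox.
Qed.

End ComplexSums.

(** * q-Pochhammer symbols and theta products *)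

Section Geometric.
Variable R : realType.
Local Notation C := R[i].
Implicit Types (z a u : C).

Lemma sum_geometric_le z n : 0 <= z < 1 -> \sum_(j < n) z ^+ j <= (1 - z)^-1.
Proof.
move=> /andP[z0 z1]; rewrite -[leRHS]mul1r ler_pdivlMr ?subr_gt0// mulrC.
by rewrite -opprB mulNr -subrX1 opprB gerBl exprn_ge0.
Qed.

Lemma summable_expn z : `|z| < 1 -> summable (fun j : nat => z ^+ j).
Proof.
move=> z1; exists (1 - `|z|)^-1 => B uB; under eq_bigr do rewrite normrX.
pose N := (\sum_(j <- B) j).+1.
apply: le_trans (@sum_geometric_le _ N _); last by rewrite normr_ge0.
rewrite -[leRHS](big_mkord xpredT (fun j => `|z| ^+ j)) [leRHS](bigID (fun j => j \in B))/=.
rewrite ler_wpDr ?sumr_ge0//.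
rewrite -[X in _ <= X]big_filter le_eqVlt; apply/orP; left; apply/eqP.
apply: perm_big; apply: uniq_perm; rewrite ?filter_uniq ?iota_uniq// => k.
rewrite mem_filter mem_index_iota; case: (boolP (k \in B)) => //= kB; symmetry.
by rewrite ltnS (big_rem k)//= leq_addr.
Qed.

Lemma summable_expz z : `|z| < 1 -> summable (fun k : int => z ^+ `|k|%N).
Proof.
move=> z1; have [M HM] := summable_expn z1.
exists (M + M) => B uB; rewrite (bigID (fun k : int => 0 <= k))/=; apply: lerD.
  rewrite -big_filter; apply: le_trans (HM (map absz [seq k <- B | (0 <= k)]) _).
    by rewrite big_map.
  rewrite map_inj_in_uniq ?filter_uniq// => k k'; rewrite !mem_filter; lia.
rewrite -big_filter; apply: le_trans (HM (map absz [seq k <- B | ~~ (0 <= k)]) _).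
  by rewrite big_map.
by rewrite map_inj_in_uniq ?filter_uniq// => k k'; rewrite !mem_filter; lia.
Qed.

Lemma cvgs_expn z : `|z| < 1 -> cvgs (fun n => z ^+ n) 0.
Proof.
move=> z1; apply/cvgs_dist => e e0.
have [a ha] := summable_has_sum (summable_norm (summable_expn z1)).
have [A [_ HA]] := has_sum_tail ha e0.
exists (\sum_(j <- A) j).+1 => n hn; have := HA [:: n] isT.
rewrite big_seq1 normr_id subr0; apply => k; rewrite inE => /eqP->.
by apply/negP => nA; move: hn; rewrite (big_rem n)//= -ltn_subRL subnn.
Qed.

Lemma has_sum_nat_cvgs (d : nat -> C) s :
  has_sum d s -> cvgs (fun n => \sum_(j < n) d j) s.
Proof.
move=> ds; apply/cvgs_dist => e e0; have [A HA] := ds e e0.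
exists (\sum_(j <- A) j).+1 => n hn.
rewrite -(big_mkord xpredT d); apply: HA; first exact: iota_uniq.
move=> k kA; rewrite mem_index_iota/=; apply: leq_trans hn.
by rewrite ltnS (big_rem k)//= leq_addr.
Qed.

(** Both numbers are real, being comparable with 0. Hence [1 + x <= expR x] bounds the factors and
    the geometric series bounds the exponent. *)
Lemma prod_geometric_bounded a z : 0 <= a -> 0 <= z < 1 ->
  exists M, forall n, \prod_(j < n) (1 + a * z ^+ j) <= M.
Proof.
move=> a0 /andP[z0 z1].
have aE : a = real_complex R (complex.Re a) by rewrite RRe_real// ger0_real.
have zE : z = real_complex R (complex.Re z) by rewrite RRe_real// ger0_real.
move: a0 z0 z1; rewrite aE zE; set x := complex.Re a; set p := complex.Re z.
rewrite ler0c lecR -[1]/(real_complex R 1) ltcR => x0 p0 p1.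
exists (real_complex R (expR (x * (1 - p)^-1))) => n.
have -> : \prod_(j < n) (1 + real_complex R x * real_complex R p ^+ j)
    = real_complex R (\prod_(j < n) (1 + x * p ^+ j)).
  by rewrite rmorph_prod; apply: eq_bigr => j _; rewrite rmorphD rmorphM rmorphXn.
rewrite lecR; apply: (@le_trans _ _ (expR (\sum_(j < n) x * p ^+ j))).
  rewrite expR_sum; apply: ler_prod => j _.
  by rewrite expR_ge1Dx andbT addr_ge0// mulr_ge0// exprn_ge0.
rewrite ler_expR -mulr_sumr ler_wpM2l//.
rewrite -[leRHS]mul1r ler_pdivlMr ?subr_gt0// mulrC.
by rewrite -opprB mulNr -subrX1 opprB gerBl exprn_ge0.
Qed.

End Geometric.

Section Pochhammer.
Variables (R : realType) (q : R[i]).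
Hypotheses (q0 : q != 0) (q1 : `|q| < 1).
Local Notation C := R[i].
Implicit Types (a u : C) (p k : int) (n m : nat).

Definition poch a n := \prod_(j < n) (1 - a * q ^+ j).

Definition pskip a (p n : nat) := \prod_(j < n | j != p :> nat) (1 - a * q ^+ j).

Lemma prod_skip_bounded a : exists M, forall n (P : pred 'I_n),
  `|\prod_(j < n | P j) (1 - a * q ^+ j)| <= M.
Proof.
have [|M HM] := @prod_geometric_bounded R `|a| `|q| (normr_ge0 _).
  by rewrite normr_ge0.
exists M => n P; rewrite normr_prod; apply: le_trans (HM n).
rewrite [leRHS](bigID P)/= -[leLHS]mulr1; apply: ler_pM.
- by rewrite prodr_ge0.
- by [].
- apply: ler_prod => j _; rewrite normr_ge0/= (le_trans (ler_normB _ _))//.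
  by rewrite normr1 normrM normrX.
- apply: (@le_trans _ _ (\prod_(j < n | ~~ P j) 1)); first by rewrite big1.
  by apply: ler_prod => j _; rewrite ler01 lerDl mulr_ge0// exprn_ge0.
Qed.

Lemma poch_recl a n : poch a n.+1 = (1 - a) * poch (a * q) n.
Proof.
rewrite /poch big_ord_recl expr0 mulr1; congr (_ * _).
by apply: eq_bigr => j _; rewrite exprS mulrA.
Qed.

Lemma poch_recr a n : poch a n.+1 = poch a n * (1 - a * q ^+ n).
Proof. by rewrite /poch big_ord_recr. Qed.

Lemma poch_cat a n m : poch a (n + m) = poch a n * poch (a * q ^+ n) m.
Proof.
rewrite /poch big_split_ord/=; congr (_ * _).
by apply: eq_bigr => j _; rewrite exprD mulrA.
Qed.

(** The increments [d n] of the finite products are dominated by a geometric sequence, since the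
    products themselves stay bounded. *)
Lemma poch_cvg a : cvgs (poch a) (qinf q a).
Proof.
suff [l hl] : exists l, cvgs (poch a) l by apply: (cvgP (l : (C : numFieldType))).
pose d n := poch a n * (- (a * q ^+ n)).
have pE n : poch a n = 1 + \sum_(j < n) d j.
  elim: n => [|n IH]; first by rewrite big_ord0 addr0 /poch big_ord0.
  by rewrite big_ord_recr/= addrA -IH poch_recr /d mulrBr mulr1 mulrN.
have [M HM] := prod_skip_bounded a.
have [|s ds] := @summable_has_sum R _ d.
  apply: summable_le (summableZ (M * a) (summable_expn q1)) => n.
  rewrite /d !normrM normrN normrM mulrA ler_wpM2r// ler_wpM2r//.
  have h := HM n xpredT; apply: le_trans h _.
  by rewrite real_ler_norm// ger0_real// (le_trans _ (HM n xpredT)).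
exists (1 + s); rewrite (_ : poch a = fun n => 1 + \sum_(j < n) d j).
  exact: cvgsD (cvgs_cst 1) (has_sum_nat_cvgs ds).
by apply/funext => n; rewrite pE.
Qed.
Arguments poch_cvg a : clear implicits.

Lemma qinf_poch a n : qinf q a = poch a n * qinf q (a * q ^+ n).
Proof.
have h : cvgs (poch a \o (addn n)) (qinf q a).
  apply: cvgs_comp (poch_cvg a) => K; exists K => m Km.
  exact: leq_trans (leq_addl _ _).
apply: (cvgs_unique h); rewrite (_ : _ \o _ = (fun m => poch a n * poch (a * q ^+ n) m)).
  exact: cvgsM (cvgs_cst _) (poch_cvg _).
by apply/funext => m /=; rewrite poch_cat.
Qed.

Lemma qinf_recl a : qinf q a = (1 - a) * qinf q (a * q).
Proof. by rewrite (qinf_poch a 1) poch_recl /poch big_ord0 mulr1 expr1. Qed.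

Lemma pskip_cat a n m : pskip a n (n.+1 + m) = poch a n * poch (a * q ^+ n.+1) m.
Proof.
rewrite /pskip big_mkcond big_split_ord/= big_ord_recr/= eqxx mulr1.
congr (_ * _); apply: eq_bigr => j _; first by rewrite ltn_eqF.
by rewrite gtn_eqF ?ltn_addr// exprD mulrA.
Qed.

(** The infinite product without its factor of index [n], written without division so that this
    factor may vanish. *)
Definition qskip a n := poch a n * qinf q (a * q ^+ n.+1).

Lemma pskip_cvg a n : cvgs (pskip a n) (qskip a n).
Proof.
have h : cvgs (fun m => poch a n * poch (a * q ^+ n.+1) (m - n.+1)) (qskip a n).
  apply: cvgsM (cvgs_cst _) _.
  apply: (@cvgs_comp _ _ _ (fun m => m - n.+1)%N) (poch_cvg _) => K.
  by exists (K + n.+1)%N => m Km; rewrite leq_subRL; lia.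
apply/cvgs_dist => e e0; have /cvgs_dist/(_ e e0)[N HN] := h.
exists (N + n.+1)%N => m Nm; rewrite -(@subnKC n.+1 m) ?pskip_cat; last by lia.
by apply: HN; lia.
Qed.
Arguments pskip_cvg a n : clear implicits.

Lemma qskipE a n : qskip a n * (1 - a * q ^+ n) = qinf q a.
Proof. by rewrite (qinf_poch a n.+1) poch_recr /qskip mulrAC. Qed.

(** Jacobi's theta function in multiplicative notation, without the constant factor [qinf q q]. *)
Definition theta u := qinf q u * qinf q (q / u).

Lemma thetaE u : theta u = qinf q u * qinf q (q / u).
Proof. by []. Qed.

(** Truncation of [theta u]: up to a monomial in [u], the product of [1 - u * q ^ s] over the
    exponents [- n <= s < m]. *)
Definition pochth n m u := poch u m * poch (q / u) n.

(* The product [theta u / (1 - u * q ^ p)] with its (possibly zero) factor cancelled. *)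
Definition thskip p u := match p with
  | Posz n => qskip u n * qinf q (q / u)
  | Negz n => qinf q u * qskip (q / u) n * (- (q ^+ n.+1 / u))
  end.

(** The same truncation without the exponent [p]. For negative [p] the removed factor is
    [1 - u * q ^ p], whereas [pskip] drops [1 - q ^+ n'.+1 / u]; the last factor is the quotient of
    the latter by the former. *)
Definition pochskip p n m u := match p with
  | Posz n' => pskip u n' m * poch (q / u) n
  | Negz n' => poch u m * pskip (q / u) n' n * (- (q ^+ n'.+1 / u))
  end.

Lemma thskipE p u : u != 0 -> thskip p u * (1 - u * q ^ p) = theta u.
Proof.
move=> u0; case: p => n /=; first by rewrite mulrAC qskipE.
rewrite /theta -(qskipE (q / u) n) -!mulrA; congr (_ * (_ * _)).
by rewrite NegzE -exprnN exprS; field; rewrite u0 q0 expf_neq0.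
Qed.

Section Truncation.
Variables (s t : nat -> nat).
Hypotheses (soo : forall K, exists N, forall n, (N <= n)%N -> (K <= s n)%N)
           (too : forall K, exists N, forall n, (N <= n)%N -> (K <= t n)%N).

Lemma pochth_cvg u : cvgs (fun N => pochth (s N) (t N) u) (theta u).
Proof. exact: cvgsM (cvgs_comp too (poch_cvg _)) (cvgs_comp soo (poch_cvg _)). Qed.

Lemma pochskip_cvg p u : cvgs (fun N => pochskip p (s N) (t N) u) (thskip p u).
Proof.
case: p => n /=.
  exact: cvgsM (cvgs_comp too (pskip_cvg _ _)) (cvgs_comp soo (poch_cvg _)).
apply: cvgsM (cvgs_cst _).
exact: cvgsM (cvgs_comp too (poch_cvg _)) (cvgs_comp soo (pskip_cvg _ _)).
Qed.
End Truncation.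

(** This is [|q|] to the power max(0, -k), the decay at minus infinity shared by [pochskip] and by
    the fractions [1 / (1 - u * q ^ k)]. *)
Definition qweight k : C := if k is Negz n then `|q| ^+ n.+1 else 1.

Lemma pochskip_le u : exists M, forall p n m, `|pochskip p n m u| <= M * qweight p.
Proof.
have [M1 H1] := prod_skip_bounded u; have [M2 H2] := prod_skip_bounded (q / u).
have M10 : 0 <= M1 by apply: le_trans (H1 0%N xpredT).
have M20 : 0 <= M2 by apply: le_trans (H2 0%N xpredT).
exists (M1 * M2 * (1 + `|u|^-1)) => -[n'|n'] n m /=.
  rewrite mulr1 normrM (@le_trans _ _ (M1 * M2))//; first by rewrite ler_pM ?H1 ?H2.
  by rewrite ler_peMr ?mulr_ge0// lerDl invr_ge0.
rewrite !normrM normrN normrM normrX normfV -[leRHS]mulrA; apply: ler_pM.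
- by rewrite mulr_ge0.
- by rewrite mulr_ge0 ?exprn_ge0 ?invr_ge0.
- by rewrite ler_pM ?H1 ?H2.
- by rewrite [leLHS]mulrC ler_wpM2r ?exprn_ge0// lerDr.
Qed.

Lemma pochthV_le u : theta u != 0 -> exists M, forall n m, `|(pochth n m u)^-1| <= M.
Proof.
rewrite mulf_eq0 negb_or => /andP[h1 h2].
have [M1 H1] := cvgs_bounded (cvgsV h1 (poch_cvg _)).
have [M2 H2] := cvgs_bounded (cvgsV h2 (poch_cvg _)).
by exists (M1 * M2) => n m; rewrite invfM normrM ler_pM ?H1 ?H2.
Qed.

Lemma pochth_le u : exists M, forall n m, `|pochth n m u| <= M.
Proof.
have [M1 H1] := cvgs_bounded (poch_cvg u).
have [M2 H2] := cvgs_bounded (poch_cvg (q / u)).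
by exists (M1 * M2) => n m; rewrite normrM ler_pM ?H1 ?H2.
Qed.

Lemma theta_neq0 u k : u != 0 -> theta u != 0 -> 1 - u * q ^ k != 0.
Proof. by move=> u0; rewrite -(thskipE k u0) mulf_eq0 negb_or => /andP[]. Qed.

(** The fraction tends to 1 at plus infinity. At [k = - n] it equals [q ^+ n / (q ^+ n - u)], whose
    denominator tends to [- u]. *)
Lemma geom_frac_le u : u != 0 -> theta u != 0 ->
  exists M, forall k : int, `|(1 - u * q ^ k)^-1| <= M * qweight k.
Proof.
move=> u0 th0.
have [M1 H1] : exists M, forall n, `|(1 - u * q ^+ n)^-1| <= M.
  apply: (@cvgs_bounded _ _ 1^-1); apply: cvgsV; first exact: oner_neq0.
  rewrite -[X in cvgs _ X]addr0 -[0 in X in cvgs _ X](mulr0 (- u)).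
  under eq_fun do rewrite -mulNr.
  exact: cvgsD (cvgs_cst _) (cvgsM (cvgs_cst _) (cvgs_expn q1)).
have [M2 H2] : exists M, forall n, `|(q ^+ n - u)^-1| <= M.
  apply: (@cvgs_bounded _ _ (0 - u)^-1); apply: cvgsV; first by rewrite sub0r oppr_eq0.
  exact: cvgsD (cvgs_expn q1) (cvgs_cst _).
have M10 : 0 <= M1 by apply: le_trans (H1 0%N).
have M20 : 0 <= M2 by apply: le_trans (H2 0%N).
exists (M1 + M2) => -[n|n] /=; first by rewrite mulr1 (le_trans (H1 n))// lerDl.
have -> : 1 - u * q ^ (Negz n) = (q ^+ n.+1 - u) / q ^+ n.+1.
  by rewrite NegzE -exprnN mulrBl divff// expf_neq0.
rewrite invf_div normrM normrX mulrC ler_wpM2r ?exprn_ge0//.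
by rewrite (le_trans (H2 _))// lerDr.
Qed.

Lemma qinf_expz a k : (forall j, 1 - a * q ^ j != 0) -> qinf q a != 0 -> qinf q (a * q ^ k) != 0.
Proof.
move=> ha a0; case: k => n.
  by move: a0; rewrite (qinf_poch a n) mulf_eq0 negb_or => /andP[].
rewrite (qinf_poch _ n.+1) mulf_neq0//; last by rewrite NegzE -exprnN mulfVK// expf_neq0.
apply/prodf_neq0 => j _; rewrite -mulrA (_ : _ * q ^+ j = q ^ (Negz n + j)) ?ha//.
by rewrite expfzDr.
Qed.

End Pochhammer.

(** * Partial fractions *)

Section PartialFractions.
Variables (F : fieldType) (S : finType).
Implicit Types (B : S -> F) (P : {poly F}).

Lemma size_prod_affine B (D : pred S) :
  (size (\prod_(s | D s) (1 - B s *: 'X) : {poly F})%R <= #|D|.+1)%N.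
Proof.
apply: leq_trans (size_poly_prod_leq _ _) _; rewrite leq_subLR.
apply: (@leq_ltn_trans (\sum_(s | D s) 2)).
  apply: leq_sum => s _; rewrite (leq_trans (size_polyD _ _))// size_polyN.
  by rewrite size_poly1 geq_max/= (leq_trans (size_scale_leq _ _))// size_polyX.
by rewrite sum_nat_const; lia.
Qed.

Lemma partial_fractions B P y : (forall s, B s != 0) -> injective B ->
  (size P <= #|S|)%N -> (forall s, 1 - B s * y != 0) ->
  P.[y] / \prod_s (1 - B s * y) =
  \sum_s P.[(B s)^-1] / \prod_(t | t != s) (1 - B t / B s) / (1 - B s * y).
Proof.
move=> B0 Binj sP By.
pose L s : {poly F} := \prod_(t | t != s) (1 - B t *: 'X).
have LE s z : (L s).[z] = \prod_(t | t != s) (1 - B t * z).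
  by rewrite horner_prod; apply: eq_bigr => t _; rewrite !hornerE.
have L0 s : (L s).[(B s)^-1] != 0.
  rewrite LE; apply/prodf_neq0 => t ts; rewrite subr_eq0 eq_sym.
  by apply: contraNneq ts => /divr1_eq/Binj->.
have LL s t : t != s -> (L s).[(B t)^-1] = 0.
  by move=> ts; rewrite LE (bigD1 t)//= mulfV// subrr mul0r.
pose Q := P - \sum_s (P.[(B s)^-1] / (L s).[(B s)^-1]) *: L s.
have sQ : (size Q <= #|S|)%N.
  rewrite (leq_trans (size_polyD _ _))// size_polyN geq_max sP/=.
  apply: (leq_trans (size_sum _ _ _)); apply/bigmax_leqP => s _.
  rewrite (leq_trans (size_scale_leq _ _))// (leq_trans (size_prod_affine _ _))//.
  by rewrite cardC1 prednK//; apply/card_gt0P; exists s.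
have Q0 : Q = 0.
  apply/eqP; apply: contraTT sQ => Q0; rewrite -ltnNge.
  have := @max_poly_roots F Q [seq (B s)^-1 | s <- enum S] Q0.
  rewrite size_map -cardE; apply.
    apply/allP => _ /mapP[s _ ->]; rewrite rootE !hornerE horner_sum (bigD1 s)//=.
    rewrite big1 ?addr0 => [|t ts]; last first.
      by rewrite hornerE (LL t s) ?mulr0 1?eq_sym.
    by rewrite hornerE divfK// subrr.
  by rewrite map_inj_uniq ?enum_uniq// => s t /invr_inj/Binj.
have -> : P = \sum_s (P.[(B s)^-1] / (L s).[(B s)^-1]) *: L s by apply/subr0_eq.
rewrite horner_sum mulr_suml; apply: eq_bigr => s _; rewrite hornerE.
have -> : \sum_s (P.[(B s)^-1] / (L s).[(B s)^-1]) *: L s = P by apply/esym/subr0_eq.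
rewrite -!mulrA; congr (_ * _); rewrite -LE; congr (_ * _).
rewrite (bigD1 s)//= invfM mulrCA LE divff ?mulr1//.
exact/prodf_neq0.
Qed.

End PartialFractions.

Lemma has_sum_fin (C : numFieldType) (K : eqType) (F : K -> C) (A : seq K) :
  uniq A -> (forall k, k \notin A -> F k = 0) -> has_sum F (\sum_(k <- A) F k).
Proof.
move=> uA F0 e e0; exists A => B uB sB.
suff -> : \sum_(k <- B) F k = \sum_(k <- A) F k by rewrite subrr normr0.
rewrite (bigID (fun k => k \in A))/= [X in _ + X]big1 ?addr0// -big_filter.
apply: perm_big; apply: uniq_perm; rewrite ?filter_uniq// => k.
by rewrite mem_filter; case: (boolP (k \in A)) => // /sB->.
Qed.

Lemma cvgs_eventually (C : numFieldType) (u v : nat -> C) l N :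
  (forall n, (N <= n)%N -> u n = v n) -> cvgs v l -> cvgs u l.
Proof.
move=> uv /cvgs_dist vl; apply/cvgs_dist => e e0; have [M HM] := vl e e0.
exists (maxn M N) => n; rewrite geq_max => /andP[Mn Nn]; rewrite uv//; exact: HM.
Qed.

(** * Finite products over windows of exponents *)

Section ThetaPartialFractions.
Variables (R : realType) (q : R[i]).
Hypotheses (q0 : q != 0) (q1 : `|q| < 1).
Local Notation C := R[i].
Implicit Types (a u : C) (p k : int).

Lemma prod_range (G : int -> C) n T : (n <= T)%N ->
  \prod_(s < T) G (s%:Z - n%:Z) = \prod_(j < T - n) G j * \prod_(j < n) G (Negz j).
Proof.
move=> nT; have [m ->] : exists m, T = (n + m)%N by exists (T - n)%N; rewrite subnKC.
rewrite addKn big_split_ord/= mulrC; congr (_ * _).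
  by apply: eq_bigr => j _; congr G; lia.
rewrite (reindex_inj rev_ord_inj)/=; apply: eq_bigr => j _; congr G.
by have := ltn_ord j; lia.
Qed.

(** The monomial by which the product of [1 - u * q ^ s] over [- n <= s < 0] differs from
    [poch q (q / u) n]. *)
Definition thmono n u : C := \prod_(j < n) (- (u / q ^+ j.+1)).

Lemma thmono_neq0 n u : u != 0 -> thmono n u != 0.
Proof.
by move=> u0; apply/prodf_neq0 => j _; rewrite oppr_eq0 mulf_neq0// invr_eq0 expf_neq0.
Qed.

(** Only the product of the arguments matters. Hence the monomials of numerator and denominator
    cancel under the balancing condition, and the finite expansions have a limit in terms of theta
    functions. *)
Lemma thmono_balanced r n (u v : 'I_r -> C) : \prod_i u i = \prod_i v i ->
  \prod_i thmono n (u i) = \prod_i thmono n (v i).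
Proof.
move=> uv; rewrite exchange_big [RHS]exchange_big; apply: eq_bigr => j _.
under eq_bigr do rewrite -mulrN; under [RHS]eq_bigr do rewrite -mulrN.
by rewrite !big_split/= uv.
Qed.

Lemma one_sub_Negz u j : u != 0 ->
  1 - u * q ^ (Negz j) = (1 - q / u * q ^+ j) * (- (u / q ^+ j.+1)).
Proof. by move=> u0; rewrite NegzE -exprnN exprS; field; rewrite q0 u0 expf_neq0. Qed.

Lemma prod_range_pochth u n T : u != 0 -> (n <= T)%N ->
  \prod_(s < T) (1 - u * q ^ (s%:Z - n%:Z)) = pochth q n (T - n) u * thmono n u.
Proof.
move=> u0 nT; rewrite (prod_range (fun p => 1 - u * q ^ p))// -mulrA; congr (_ * _).
under eq_bigr do rewrite one_sub_Negz//.
by rewrite big_split.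
Qed.

Lemma prod_range_pochskip u n T (s0 : 'I_T) : u != 0 -> (n <= T)%N ->
  \prod_(s < T | s != s0) (1 - u * q ^ (s%:Z - n%:Z)) =
  pochskip q (s0%:Z - n%:Z) n (T - n) u * thmono n u.
Proof.
move=> u0 nT; pose p := s0%:Z - n%:Z.
pose G k := if k != p then 1 - u * q ^ k else 1.
rewrite big_mkcond (_ : \prod_(i < T) _ = \prod_(s < T) G (s%:Z - n%:Z)); last first.
  apply: eq_bigr => s _; rewrite /G /p (_ : _ - _ != _ = (s != s0))//.
  by rewrite -val_eqE/=; apply/negb_inj; rewrite !negbK; apply/eqP/eqP; lia.
rewrite prod_range// -/p {}/G.
have hp : (p < (T - n)%N%:Z) && (- n%:Z <= p) by rewrite /p; have := ltn_ord s0; lia.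
case: p hp => n' hp /=.
  rewrite -mulrA; congr (_ * _); first by rewrite /pskip [RHS]big_mkcond.
  rewrite -big_split/=; apply: eq_bigr => j _; exact: one_sub_Negz.
rewrite -!mulrA; congr (_ * _).
have n'n : (n' < n)%N by lia.
have -> : - (q ^+ n'.+1 / u) * thmono n u =
    \prod_(j < n | j != n' :> nat) (- (u / q ^+ j.+1)).
  rewrite /thmono (bigD1 (Ordinal n'n))//= mulrA mulrNN.
  have -> : q ^+ n'.+1 / u * (u / q ^+ n'.+1) = 1 by rewrite mulrA mulfVK// divff// expf_neq0.
  by rewrite mul1r.
rewrite -big_mkcond/= /pskip -big_split/=; apply: eq_big => j; last by move=> _; apply: one_sub_Negz.
by congr negb; apply/eqP/eqP => [[]|->].
Qed.

Lemma prod_range_pairs r (u : 'I_r -> C) n T (j0 : 'I_r) (s0 : 'I_T) :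
  (forall i, u i != 0) -> (n <= T)%N ->
  \prod_(t : 'I_r * 'I_T | t != (j0, s0)) (1 - u t.1 * q ^ (t.2%:Z - n%:Z)) =
  pochskip q (s0%:Z - n%:Z) n (T - n) (u j0) *
  \prod_(i | i != j0) pochth q n (T - n) (u i) * \prod_i thmono n (u i).
Proof.
move=> u0 nT.
rewrite -(pair_big_dep xpredT (fun i s => (i, s) != (j0, s0))
  (fun i (s : 'I_T) => 1 - u i * q ^ (s%:Z - n%:Z)))/=.
rewrite [RHS]mulrAC (bigD1 j0)//= [X in _ = _ * X * _](bigD1 j0)//= mulrA -mulrA.
congr (_ * _).
  rewrite -prod_range_pochskip//; apply: eq_bigl => s.
  by rewrite xpair_eqE eqxx.
rewrite mulrC -big_split/=; apply: eq_bigr => i ij.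
rewrite -prod_range_pochth//; apply: eq_bigl => s.
by rewrite xpair_eqE (negbTE ij).
Qed.

(** Two one-sided decays at opposite ends combine into decay in [|k|], with a loss that depends on
    [M] only. *)
Lemma qweight_le M k : qweight q (M - k) * qweight q k <= `|q| ^- `|M| * `|q| ^+ `|k|.
Proof.
have wE p : qweight q p = `|q| ^+ (if p < 0 then `|p|%N else 0%N) by case: p.
rewrite !wE -exprD mulrC ler_pdivlMr ?exprn_gt0 ?normr_gt0// -exprD.
apply: ler_wiXn2l => //; first exact: ltW.
by case: ifP; case: ifP; lia.
Qed.

End ThetaPartialFractions.

(** * Partial fraction expansion of a quotient of theta products *)

Section ThetaExpansion.
Variables (R : realType) (q : R[i]).
Hypotheses (q0 : q != 0) (q1 : `|q| < 1) (qq0 : qinf q q != 0).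
Local Notation C := R[i].
Local Notation theta := (theta q).
Local Notation thskip := (thskip q).
Local Notation pochth := (pochth q).
Local Notation pochskip := (pochskip q).

Lemma expz_eq1 (k : int) : q ^ k = 1 -> k = 0.
Proof.
have h n : (0 < n)%N -> q ^+ n != 1.
  move=> n0; apply/eqP => qn; have : `|q| ^+ n < 1 by rewrite exprn_ilt1// -lt0n.
  by rewrite -normrX qn normr1 ltxx.
case: k => [[|n] //= /eqP|n]; first by rewrite -exprnP (negbTE (h _ _)).
by rewrite NegzE -exprnN => /(congr1 GRing.inv)/eqP; rewrite invrK invr1 (negbTE (h _ _)).
Qed.

Section Expansion.
Variables (r : nat) (A al : 'I_r.+1 -> C).
Hypotheses (A0 : forall i, A i != 0) (al0 : forall i, al i != 0)
  (Aal : \prod_i al i = \prod_i A i)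
  (AA : forall i j, i != j -> theta (A i / A j) != 0).

(** Coefficient at a pole of label [j]. Setting [x] to [(A j * q ^ k)^-1] moves the removed exponent
    from [M] to [p = M - k], and by balancing nothing else depends on [k]. The factor
    [qinf q q ^+ 2], which is [thskip q 0 1], comes from the other poles of the same label. *)
Definition thcoef p j := thskip p (al ord0 / A j) * \prod_(i | i != ord0) theta (al i / A j)
  / (qinf q q ^+ 2 * \prod_(i | i != j) theta (A i / A j)).

Let pochcoef n m p j := pochskip p n m (al ord0 / A j) *
  \prod_(i | i != ord0) pochth n m (al i / A j)
  / (pochskip 0 n m 1 * \prod_(i | i != j) pochth n m (A i / A j)).

(** Partial fractions with the poles of exponent in [[-N, N)]. Removing the exponent [M] from the
    numerator brings its degree below the number of poles. *)
Let pochcoef_expansion x (M : int) (N : nat) : x != 0 -> (forall j, theta (A j * x) != 0) ->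
  (`|M| < N)%N ->
  \sum_j \sum_(k < N + N) pochcoef k (N + N - k) (M + N%:Z - k%:Z) j
      / (1 - A j * x * q ^ (k%:Z - N%:Z))
  = pochskip M N N (al ord0 * x) * \prod_(i | i != ord0) pochth N N (al i * x)
    / \prod_j pochth N N (A j * x).
Proof.
move=> x0 Ax MN; set T := (N + N)%N.
have hs0 : (absz (M + N%:Z)%R < T)%N by rewrite /T; lia.
pose s0 := Ordinal hs0; have s0E : s0%:Z = M + N%:Z by rewrite /=; lia.
pose B (t : 'I_r.+1 * 'I_T) := A t.1 * q ^ (t.2%:Z - N%:Z).
pose P : {poly C} := \prod_(t : 'I_r.+1 * 'I_T | t != (ord0, s0))
  (1 - (al t.1 * q ^ (t.2%:Z - N%:Z)) *: 'X).
have PE y : P.[y] = \prod_(t : 'I_r.+1 * 'I_T | t != (ord0, s0))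
    (1 - al t.1 * y * q ^ (t.2%:Z - N%:Z)).
  by rewrite horner_prod; apply: eq_bigr => t _; rewrite !hornerE mulrAC.
have B0 t : B t != 0 by rewrite mulf_neq0// expfz_neq0.
have Binj : injective B.
  move=> [i s] [j t]; rewrite /B/= => BB; have [ij|ij] := eqVneq i j.
    move: BB; rewrite ij => /(mulfI (A0 j)) BB.
    have /expz_eq1 : q ^ (s%:Z - N%:Z - (t%:Z - N%:Z)) = 1.
      by rewrite expfzDr// BB -expfzDr// subrr.
    by move=> st; congr pair; apply/val_inj; move: st => /=; lia.
  have := theta_neq0 q0 q1 (s%:Z - N%:Z - (t%:Z - N%:Z)) _ (AA ij).
  rewrite mulf_neq0 ?invr_eq0// => /(_ isT); rewrite expfzDr// -invr_expz.
  have qt : q ^ (t%:Z - N%:Z) != 0 by rewrite expfz_neq0.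
  rewrite (_ : _ * _ = 1) ?subrr ?eqxx//.
  by rewrite mulrACA BB -invfM divff// mulf_neq0.
have By t : 1 - B t * x != 0.
  by rewrite /B mulrAC; apply: theta_neq0 => //; rewrite mulf_neq0.
have sP : (size P <= #|{: 'I_r.+1 * 'I_T}|)%N.
  apply: (leq_trans (size_prod_affine _ _)).
  by rewrite cardC1 prednK//; apply/card_gt0P; exists (ord0, s0).
have NT : (N <= T)%N by rewrite leq_addr.
have TN : (T - N = N)%N by rewrite addnK.
have := partial_fractions B0 Binj sP By.
have -> : \prod_s (1 - B s * x) = \prod_j pochth N N (A j * x) * \prod_j thmono q N (A j * x).
  rewrite -(pair_bigA _ (fun i (s : 'I_T) => 1 - B (i, s) * x))/= -big_split/=.
  apply: eq_bigr => i _; have := @prod_range_pochth _ q q0 q1 (A i * x) N T.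
  rewrite TN => <- //; last by rewrite mulf_neq0.
  by apply: eq_bigr => s _; rewrite /B mulrAC.
rewrite PE (prod_range_pairs q0 q1 (u := fun i => al i * x)) => [|i|]//; last by rewrite mulf_neq0.
rewrite TN s0E addrK.
rewrite (@thmono_balanced _ q _ N (fun i => al i * x) (fun i => A i * x)); last first.
  by rewrite !big_split/= Aal.
have m0 : \prod_j thmono q N (A j * x) != 0.
  by apply/prodf_neq0 => j _; rewrite thmono_neq0// mulf_neq0.
rewrite -mulf_div divff// mulr1 => ->.
rewrite pair_bigA/=; apply: eq_bigr => -[j k] _ /=.
have -> : B (j, k) * x = A j * x * q ^ (k%:Z - N%:Z) by rewrite /B mulrAC.
congr (_ / _).
have kT : (k <= T)%N by apply: ltnW.
(* Evaluation at the pole of index [k] translates the window of exponents to [[-k, 2N - k)]; hence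
   the arguments [k] and [N + N - k] of [pochcoef]. *)
have qk (s : 'I_T) : q ^ (s%:Z - N%:Z) / q ^ (k%:Z - N%:Z) = q ^ (s%:Z - k%:Z).
  by rewrite invr_expz -expfzDr//; congr (q ^ _); lia.
rewrite PE (eq_bigr (fun t : 'I_r.+1 * 'I_T => 1 - al t.1 / A j * q ^ (t.2%:Z - k%:Z))); last first.
  by move=> t _; rewrite /B/= invfM -qk; congr (1 - _); ring.
rewrite (prod_range_pairs q0 q1 (u := fun i => al i / A j)) => [|i|]//; last first.
  by rewrite mulf_neq0 ?invr_eq0.
rewrite [X in _ = _ / X](eq_bigr (fun t : 'I_r.+1 * 'I_T => 1 - A t.1 / A j * q ^ (t.2%:Z - k%:Z))); last first.
  by move=> t _; rewrite /B/= invfM -qk; congr (1 - _); ring.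
rewrite (prod_range_pairs q0 q1 (u := fun i => A i / A j)) => [|i|]//; last first.
  by rewrite mulf_neq0 ?invr_eq0.
rewrite (@thmono_balanced _ q _ k (fun i => al i / A j) (fun i => A i / A j)); last first.
  by rewrite !big_split/= Aal.
rewrite -mulf_div divff ?mulr1; last first.
  by apply/prodf_neq0 => i _; rewrite thmono_neq0// mulf_neq0 ?invr_eq0.
by rewrite /pochcoef divff// subrr s0E.
Qed.

Let pochskipV_le : exists M, forall n m, `|(pochskip 0 n m 1)^-1| <= M.
Proof.
have h1 : qskip q 1 0 != 0 by rewrite /qskip /poch big_ord0 mul1r expr1 mul1r.
have [M1 H1] := cvgs_bounded (cvgsV h1 (@pskip_cvg _ _ q0 q1 1 0)).
have h2 : qinf q (q / 1) != 0 by rewrite divr1.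
have [M2 H2] := cvgs_bounded (cvgsV h2 (@poch_cvg _ _ q1 (q / 1))).
by exists (M1 * M2) => n m; rewrite invfM normrM ler_pM ?H1 ?H2.
Qed.

Let pochcoef_le j : exists M, forall p n m, `|pochcoef n m p j| <= M * qweight q p.
Proof.
have [M1 H1] := pochskip_le q1 (al ord0 / A j).
have /choice[M2 H2] := fun i => pochth_le q1 (al i / A j).
have [M3 H3] := pochskipV_le.
have /choice[M4 H4] i : exists M, i != j -> forall n m, `|(pochth n m (A i / A j))^-1| <= M.
  have [->|/AA ij] := eqVneq i j; first by exists 0.
  by have [M HM] := pochthV_le q1 ij; exists M.
exists (M1 * \prod_(i | i != ord0) M2 i * (M3 * \prod_(i | i != j) M4 i)) => p n m.
rewrite normrM [leRHS]mulrAC; apply: ler_pM => //.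
  rewrite normrM [leRHS]mulrAC; apply: ler_pM => //.
  by rewrite normr_prod; apply: ler_prod => i _; rewrite normr_ge0 H2.
rewrite invfM normrM; apply: ler_pM => //.
by rewrite -prodfV normr_prod; apply: ler_prod => i ij; rewrite normr_ge0 H4.
Qed.

Let pochcoef_cvg (s t : nat -> nat) p j :
  (forall K, exists N, forall n, (N <= n)%N -> (K <= s n)%N) ->
  (forall K, exists N, forall n, (N <= n)%N -> (K <= t n)%N) ->
  cvgs (fun N => pochcoef (s N) (t N) p j) (thcoef p j).
Proof.
move=> soo too; rewrite /pochcoef /thcoef.
have d0 : qinf q q ^+ 2 * \prod_(i | i != j) theta (A i / A j) != 0.
  by rewrite mulf_neq0 ?expf_neq0//; apply/prodf_neq0 => i /AA.
have qqE : qinf q q ^+ 2 = thskip 0 1.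
  by rewrite /= /qskip /poch big_ord0 !mul1r expr1 divr1.
apply: cvgsM.
  apply: cvgsM; first exact: pochskip_cvg.
  by apply: cvgs_prod => i _; apply: pochth_cvg.
apply: cvgsV => //; apply: cvgsM; first by rewrite qqE; apply: pochskip_cvg.
by apply: cvgs_prod => i _; apply: pochth_cvg.
Qed.

(* Partial fractions of the truncations to exponents in [-N, N), whose monomial
   prefactors cancel because [al] and [A] have the same product, and N to infinity. *)
Theorem theta_expansion x (M : int) : x != 0 -> (forall j, theta (A j * x) != 0) ->
  has_sum (fun k : int => \sum_j thcoef (M - k) j / (1 - A j * x * q ^ k))
    (thskip M (al ord0 * x) * \prod_(i | i != ord0) theta (al i * x)
     / \prod_j theta (A j * x)).
Proof.
(* Starting the windows at [|M| + 1] keeps the removed exponent [M] inside all of them. *)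
move=> x0 Ax; pose N0 := `|M|%N.+1; pose N_ n := (n + N0)%N.
pose F n k := \sum_j (if (- (N_ n)%:Z <= k) && (k < (N_ n)%:Z) then
  pochcoef (absz (k + (N_ n)%:Z)) (absz ((N_ n)%:Z - k)) (M - k) j / (1 - A j * x * q ^ k)
  else 0).
pose L n := pochskip M (N_ n) (N_ n) (al ord0 * x) *
  \prod_(i | i != ord0) pochth (N_ n) (N_ n) (al i * x) / \prod_j pochth (N_ n) (N_ n) (A j * x).
have /choice[B1 HB1] j := pochcoef_le j.
have /choice[B2 HB2] j : exists B : C, forall k : int, `|(1 - A j * x * q ^ k)^-1| <= B * qweight q k.
  have h := geom_frac_le q0 q1 (mulf_neq0 (A0 j) x0) (Ax j).
  exact: h.
(* The coefficients decay at plus infinity and the fractions at minus infinity; [qweight_le] joins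
   the two bounds. *)
pose Bd k := (\sum_j B1 j * B2 j * `|q| ^- `|M|) * `|q| ^+ `|k|.
have w0 k : 0 < qweight q k by case: k => n //=; rewrite exprn_gt0 ?normr_gt0.
have B10 j : 0 <= B1 j.
  by rewrite -(pmulr_lge0 _ (w0 0)); apply: le_trans (HB1 j 0 0%N 0%N).
have B20 j : 0 <= B2 j.
  by rewrite -(pmulr_lge0 _ (w0 0)); apply: le_trans (HB2 j 0).
have FB n k : `|F n k| <= `|Bd k|.
  have Bd0 : 0 <= Bd k.
    rewrite mulr_ge0 ?exprn_ge0// sumr_ge0// => j _.
    by rewrite !mulr_ge0 ?invr_ge0 ?exprn_ge0.
  rewrite (ger0_norm Bd0) /Bd mulr_suml; apply: (le_trans (ler_norm_sum _ _ _)).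
  apply: ler_sum => j _; case: ifP => _; last first.
    by rewrite normr0 !mulr_ge0 ?invr_ge0 ?exprn_ge0.
  rewrite normrM; apply: (@le_trans _ _ (B1 j * qweight q (M - k) * (B2 j * qweight q k))).
    exact: ler_pM.
  by rewrite mulrACA -[leRHS]mulrA ler_wpM2l ?mulr_ge0// qweight_le.
have Bs : summable Bd by apply: summableZ; apply: summable_expz; rewrite normr_id.
have FL n : has_sum (F n) (L n).
  have N0n : (`|M| < N_ n)%N by rewrite /N_ /N0; lia.
  rewrite /L -pochcoef_expansion//.
  pose A_ := [seq i%:Z - (N_ n)%:Z | i <- iota 0 (N_ n + N_ n)].
  have -> : \sum_j \sum_(k < N_ n + N_ n)
      pochcoef k (N_ n + N_ n - k) (M + (N_ n)%:Z - k%:Z) j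
      / (1 - A j * x * q ^ (k%:Z - (N_ n)%:Z)) = \sum_(k <- A_) F n k.
    rewrite exchange_big big_map.
    rewrite -(big_mkord xpredT (fun k => \sum_j pochcoef k (N_ n + N_ n - k)
      (M + (N_ n)%:Z - k%:Z) j / (1 - A j * x * q ^ (k%:Z - (N_ n)%:Z)))) /index_iota subn0.
    apply: eq_big_seq => k; rewrite mem_iota => hk; apply: eq_bigr => j _.
    rewrite ifT; last by lia.
    by congr (pochcoef _ _ _ _ / _); lia.
  apply: has_sum_fin.
    by rewrite map_inj_uniq ?iota_uniq// => i i'; lia.
  move=> k kA; rewrite /F big1// => j _; rewrite ifF//; apply/negbTE; apply: contra kA => hk.
  by apply/mapP; exists (absz (k + (N_ n)%:Z)); rewrite ?mem_iota; lia.
have Noo K : exists N, forall n, (N <= n)%N -> (K <= N_ n)%N.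
  by exists K => n; rewrite /N_; lia.
apply: (tannery Bs FB _ FL _).2 => [k|].
  apply: cvgs_sum => j.
  apply: (@cvgs_eventually _ _ (fun n =>
    pochcoef (absz (k + (N_ n)%:Z)) (absz ((N_ n)%:Z - k)) (M - k) j / (1 - A j * x * q ^ k)) _ `|k|).
    by move=> n kn; rewrite ifT// /N_; lia.
  apply: cvgsM (cvgs_cst _); apply: pochcoef_cvg => K; exists (K + `|k|)%N => n; rewrite /N_; lia.
apply: cvgsM.
  apply: cvgsM; first exact: pochskip_cvg.
  by apply: cvgs_prod => i _; apply: pochth_cvg.
apply: cvgsV; first exact/prodf_neq0.
by apply: cvgs_prod => j _; apply: pochth_cvg.
Qed.

End Expansion.
End ThetaExpansion.

Definition vdm (F : fieldType) n (Z : 'I_n -> F) :=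
  \prod_(i < n) \prod_(j < n | (i < j)%N) (Z i - Z j).

(** * Lattice sums of Vandermonde products *)

Section VandermondeExpansion.
Variables (F : fieldType) (n : nat) (S : finType).

Lemma vdm_det (Z : 'I_n -> F) :
  vdm Z = (\prod_(i < n) \prod_(j < n | (i < j)%N) -1) *
    \det (\matrix_(i < n, p < n) Z i ^+ p).
Proof.
have -> : \matrix_(i < n, p < n) Z i ^+ p = (Vandermonde n (\row_j Z j))^T.
  by apply/matrixP => i p; rewrite !mxE.
rewrite det_tr det_Vandermonde -big_split; apply: eq_bigr => i _.
rewrite -big_split; apply: eq_bigr => j _.
by rewrite /= !mxE mulN1r opprB.
Qed.

(* The expansion coefficients alternate because they are minors of a matrix. *)
Lemma vdm_expansion (B : S -> F) (P : {poly F}) :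
  (forall s, B s != 0) -> injective B -> (n + size P <= #|S|.+1)%N ->
  exists coef : {ffun 'I_n -> S} -> F,
    (forall (f : {ffun 'I_n -> S}) i1 i2, i1 != i2 ->
       coef [ffun i => f (tperm i1 i2 i)] = - coef f) /\
    forall Z : 'I_n -> F, (forall i s, 1 - B s * Z i != 0) ->
      vdm Z * \prod_i (P.[Z i] / \prod_s (1 - B s * Z i)) =
      \sum_f coef f * \prod_i (1 - B (f i) * Z i)^-1.
Proof.
move=> B0 Binj sP.
(* The coefficient of [(1 - B s * z)^-1] in the expansion with numerator [z ^ p * P]. The size
   hypothesis is what the powers [p < n] of the Vandermonde determinant require. *)
pose g (p : 'I_n) s := ('X^p * P).[(B s)^-1] / \prod_(t | t != s) (1 - B t / B s).
pose eps : F := \prod_(i < n) \prod_(j < n | (i < j)%N) -1.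
pose D (f : {ffun 'I_n -> S}) := \matrix_(i < n, p < n) g p (f i).
exists (fun f => eps * \det (D f)); split=> [f i1 i2 i12|Z BZ].
  have -> : D [ffun i => f (tperm i1 i2 i)] = row_perm (tperm i1 i2) (D f).
    by apply/matrixP => i p; rewrite !mxE ffunE.
  by rewrite row_permE det_mulmx det_perm odd_tperm i12 expr1 mulN1r mulrN.
rewrite vdm_det -/eps -mulrA; under [RHS]eq_bigr do rewrite -mulrA.
rewrite -mulr_sumr; congr (_ * _).
pose h i := P.[Z i] / \prod_s (1 - B s * Z i).
have hE (i p : 'I_n) : Z i ^+ p * h i = \sum_s g p s * (1 - B s * Z i)^-1.
  rewrite -(@partial_fractions _ _ B ('X^p * P))//.
  by rewrite hornerM hornerXn /h mulrA.
rewrite (leq_trans (size_polyMleq _ _))// size_polyXn.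
by have := ltn_ord p; lia.
transitivity (\sum_(s : 'S_n) (-1) ^+ s * \prod_i (Z i ^+ s i * h i)).
  rewrite mulr_suml; apply: eq_bigr => s _; rewrite -[LHS]mulrA [in RHS]big_split/=.
  congr (_ * _); congr (_ * _).
  by apply: eq_bigr => i _; rewrite mxE.
(* The product of sums is expanded over the maps [f] from variables to poles; summing over
   permutations first then rebuilds the determinant of [D f]. *)
under eq_bigr do under eq_bigr do rewrite hE.
under eq_bigr do rewrite bigA_distr_bigA/= mulr_sumr.
rewrite exchange_big/=; apply: eq_bigr => f _; rewrite mulr_suml; apply: eq_bigr => s _.
rewrite big_split/= mulrA; congr (_ * _ * _).
by apply: eq_bigr => i _; rewrite mxE.
Qed.

End VandermondeExpansion.

Section LatticeSums.
Variables (R : realType) (q : R[i]).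
Hypotheses (q0 : q != 0) (q1 : `|q| < 1).
Local Notation C := R[i].
Local Notation theta := (theta q).

Lemma vabsD n (k l : 'I_n -> int) : vabs (fun i => k i + l i) = vabs k + vabs l.
Proof. by rewrite /vabs big_split. Qed.

(** Extension by zero outside the level keeps all of Z^n as index set, so that product bounds apply
    and a coordinate can be split off. *)
Definition onlevel n (M : int) (F : ('I_n -> C) -> C) (Z : 'I_n -> C)
  (k : {ffun 'I_n -> int}) := if vabs k == M then F (fun i => Z i * q ^ k i) else 0.

(** Translating the lattice by [v] preserves every level because [v] has total 0. *)
Lemma has_sum_shift n (F : ('I_n -> C) -> C) (Z : 'I_n -> C) M (v : 'I_n -> int) a :
  vabs v = 0 -> has_sum (onlevel M F Z) a ->
  has_sum (onlevel M F (fun i => Z i * q ^ v i)) a.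
Proof.
move=> v0 Fa; pose e (k : {ffun 'I_n -> int}) := [ffun i => v i + k i].
pose e' (k : {ffun 'I_n -> int}) := [ffun i => k i - v i].
have eK : cancel e e' by move=> k; apply/ffunP => i; rewrite !ffunE addrAC subrr add0r.
have eK' : cancel e' e by move=> k; apply/ffunP => i; rewrite !ffunE addrC subrK.
have h : has_sum (onlevel M F Z \o e) a.
  by apply: (@has_sum_reindex _ _ _ e (Some \o e')) Fa => // k /=; rewrite ?eK ?eK'.
apply: eq_has_sum h => k /=.
rewrite /onlevel (_ : vabs (e k) = vabs k); last first.
  by rewrite -[RHS]add0r -v0 -vabsD; apply: eq_bigr => i _; rewrite ffunE.
case: ifP => // _; congr F; apply/funext => i.
by rewrite ffunE expfzDr// mulrA.
Qed.

(* On a level, the weights [t ^ k i] with [t ^ 2 = |q|] multiply to a constant and make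
   every factor decay at both ends. *)
Lemma summable_lattice_frac n (u : 'I_n -> C) M : (forall i, u i != 0) ->
  (forall i, theta (u i) != 0) ->
  summable (onlevel M (fun w => \prod_i (1 - w i)^-1) u).
Proof.
move=> u0 thu; pose t : C := sqrtC `|q|.
have t0 : t != 0 by rewrite sqrtC_eq0 normr_eq0.
have tn : `|t| = t by rewrite ger0_norm// sqrtC_ge0.
have t1 : `|t| < 1.
  rewrite tn -(@expr_lt1 _ 2)//; first by rewrite sqrtCK.
  by rewrite sqrtC_ge0.
(* At plus infinity [t ^ k] decays; at minus infinity the fraction contributes [t ^ (2|k|)] against
   the growth [t ^ (- |k|)]. *)
have fs i : summable (fun k : int => t ^ k * (1 - u i * q ^ k)^-1).
  have [B HB] := geom_frac_le q0 q1 (u0 i) (thu i).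
  apply: summable_le (summableZ B (summable_expz t1)) => k.
  rewrite normrM; apply: (@le_trans _ _ (`|t ^ k| * (B * qweight q k))).
    by rewrite ler_wpM2l.
  rewrite mulrCA normrM normrX tn.
  have B0 : 0 <= B by rewrite -[B]mulr1; apply: le_trans (HB 0).
  rewrite (ger0_norm B0) ler_wpM2l//.
  case: k => k /=; first by rewrite mulr1 -exprnP normrX tn.
  rewrite NegzE -exprnN normfV normrX tn -[in leLHS](sqrtCK `|q|) -/t.
  by rewrite exprAC expr2 mulKf// expf_neq0.
apply: summable_le (summableZ (t ^ (- M)) (summable_prod fs)) => k.
rewrite /onlevel; case: eqP => [<-|_]; last by rewrite normr0.
rewrite big_split/= mulrA (_ : t ^ _ * _ = 1) ?mul1r//.
suff -> : \prod_i t ^ k i = t ^ vabs k by rewrite -expfzDr// addNr.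
rewrite /vabs; elim/big_rec2: _ => // i y1 y2 _ ->.
by rewrite expfzDr.
Qed.

End LatticeSums.

(** * Absolute convergence and vanishing on a level *)

Section Vanishing.
Variables (R : realType) (q : R[i]).
Hypotheses (q0 : q != 0) (q1 : `|q| < 1).
Local Notation C := R[i].
Local Notation theta := (theta q).

Lemma one_sub_inv_neq0 (F : fieldType) (u : F) : u != 0 -> (1 - u^-1 != 0) = (1 - u != 0).
Proof. by move=> u0; rewrite !subr_eq0 ![1 == _]eq_sym invr_eq1. Qed.

Lemma theta_expz_neq0 u k : u != 0 -> theta u != 0 -> theta (u * q ^ k) != 0.
Proof.
move=> u0 thu; have h j := theta_neq0 q0 q1 j u0 thu.
move: (thu); rewrite mulf_eq0 negb_or => /andP[h1 h2].
apply: mulf_neq0; first exact: qinf_expz.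
rewrite (_ : q / (u * q ^ k) = q / u * q ^ (- k)); last by rewrite -invr_expz invfM mulrA.
apply: qinf_expz => // j; rewrite (_ : q / u * q ^ j = (u * q ^ (- 1 - j))^-1).
  by rewrite one_sub_inv_neq0 ?h// mulf_neq0// expfz_neq0.
by rewrite invfM invr_expz opprB opprK addrC expfzDr// expr1z; ring.
Qed.

Lemma eq_onlevel n M (F G : ('I_n -> C) -> C) Z :
  (forall k : 'I_n -> int, F (fun i => Z i * q ^ k i) = G (fun i => Z i * q ^ k i)) ->
  onlevel q M F Z =1 onlevel q M G Z.
Proof. by move=> FG k; rewrite /onlevel FG. Qed.

Section Sums.
Variables (n : nat) (S : finType) (A Z : 'I_n -> C) (lab : S -> 'I_n) (ex : S -> int).
Variable P : {poly C}.
Hypotheses (A0 : forall j, A j != 0) (Z0 : forall i, Z i != 0)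
  (AZ : forall i j, theta (A j * Z i) != 0).
Let B s := A (lab s) * q ^ ex s.
Hypotheses (Binj : injective B) (sP : (n + size P <= #|S|.+1)%N).
Let W (w : 'I_n -> C) := vdm w * \prod_i (P.[w i] / \prod_s (1 - B s * w i)).
Let T (f : {ffun 'I_n -> S}) M := onlevel q M (fun w => \prod_i (1 - w i)^-1)
  (fun i => B (f i) * Z i).

Let Tsummable f M : summable (T f M).
Proof.
apply: summable_lattice_frac => // i.
  by rewrite !mulf_neq0// expfz_neq0.
by rewrite /B mulrAC; apply: theta_expz_neq0 => //; rewrite mulf_neq0.
Qed.

Let expansion M : exists coef : {ffun 'I_n -> S} -> C,
  (forall (f : {ffun 'I_n -> S}) i1 i2, i1 != i2 ->
     coef [ffun i => f (tperm i1 i2 i)] = - coef f) /\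
  onlevel q M W Z =1 (fun k => \sum_f coef f * T f M k).
Proof.
have B0 s : B s != 0 by rewrite mulf_neq0// expfz_neq0.
have [coef [coefN coefE]] := vdm_expansion B0 Binj sP.
exists coef; split=> // k; rewrite /T /onlevel; case: ifP => _; last first.
  by rewrite big1// => f _; rewrite mulr0.
rewrite /W coefE => [|i s].
  by apply: eq_bigr => f _; congr (_ * _); apply: eq_bigr => i _; rewrite mulrA.
have := theta_neq0 q0 q1 (ex s + k i) (mulf_neq0 (A0 (lab s)) (Z0 i)) (AZ _ _).
by rewrite expfzDr// mulrACA.
Qed.

Lemma summable_onlevel_vdm M : summable (onlevel q M W Z).
Proof.
have [coef [_ /funext->]] := expansion M.
by apply: summable_sum => f; apply: summableZ.
Qed.

(* Two variables meet poles with the same label; exchanging these poles negates the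
   coefficient, but not the lattice sum, which depends only on the labels and on the
   total exponent. *)
Lemma has_sum_onlevel_vdm0 M j0 : (forall s, lab s != j0) -> has_sum (onlevel q M W Z) 0.
Proof.
move=> labj0; have [coef [coefN /funext->]] := expansion M.
have /choice[L HL] f := summable_has_sum (Tsummable f M).
suff L0 : \sum_f coef f * L f = 0.
  rewrite -[X in has_sum _ X]L0.
  have h := has_sum_sum (index_enum {ffun 'I_n -> S}) (fun f => has_sumZ (coef f) (HL f)).
  exact: h.
(* The terms are grouped by the labels [g] of the poles that the variables meet. *)
rewrite (partition_big (fun f : {ffun 'I_n -> S} => [ffun i => lab (f i)]) xpredT)//=.
apply: big1 => g _.
(* An injective [g] would reach every label, the excluded [j0] included. *)
have [/injectiveP ginj|/injectivePn[i1 [i2 i12 gi]]] := boolP (injectiveb g).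
  rewrite big_pred0// => f; apply/eqP => fg.
  have /codomP[i0 i0E] := injF_onto ginj j0.
  by move: i0E; rewrite -fg ffunE => /eqP; rewrite eq_sym (negbTE (labj0 _)).
pose e (f : {ffun 'I_n -> S}) := [ffun i => f (tperm i1 i2 i)].
have eK : involutive e by move=> f; apply/ffunP => i; rewrite !ffunE tpermK.
set X := \sum_(f | _) _; have : X = - X; last first.
  by move/eqP; rewrite -addr_eq0 -mulr2n mulrn_eq0 => /eqP.
rewrite /X -sumrN (reindex_inj (inv_inj eK))/=; apply: eq_big => [f|f /eqP fg].
  apply/eqP/eqP => /ffunP fg; apply/ffunP => i.
    have := fg (tperm i1 i2 i); rewrite !ffunE tpermK => ->.
    by case: tpermP => [->|->|//]; rewrite gi.
  rewrite !ffunE; have := fg (tperm i1 i2 i); rewrite !ffunE => ->.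
  by case: tpermP => [->|->|//]; rewrite gi.
rewrite coefN// mulNr; congr (- (_ * _)); rewrite -/e.
have labf i : lab (f (tperm i1 i2 i)) = lab (f i).
  move/ffunP: fg => fg; have := fg (tperm i1 i2 i); have := fg i; rewrite !ffunE.
  by rewrite tpermK => -> ->; case: tpermP => [->|->|//]; rewrite gi.
(* The maps [f] and [e f] have the same labels and their exponents differ by a vector of total 0, so
   a translation identifies the two lattice sums. *)
apply: has_sum_unique (HL _) _.
have := @has_sum_shift _ _ q0 n (fun w => \prod_i (1 - w i)^-1)
  (fun i => B (f i) * Z i) M (fun i => ex (f (tperm i1 i2 i)) - ex (f i)) (L f) _ (HL f).
have h0 : vabs (fun i => ex (f (tperm i1 i2 i)) - ex (f i)) = 0.
  rewrite /vabs sumrB (reindex_inj (@perm_inj _ (tperm i1 i2)))/=.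
  by under eq_bigr do rewrite tpermK; rewrite subrr.
move=> /(_ h0); rewrite /T; congr (has_sum (onlevel _ _ _ _) _).
apply/funext => i; rewrite ffunE /B labf expfzDr// -invr_expz.
by have x0 : q ^ ex (f i) != 0 by [rewrite expfz_neq0]; field.
Qed.

End Sums.
End Vanishing.

(** * Cauchy kernels *)

Lemma prod_offdiag (F : comPzRingType) n (f : 'I_n -> 'I_n -> F) :
  \prod_i \prod_(j | j != i) f i j = \prod_(i < n) \prod_(j < n | (i < j)%N) (f i j * f j i).
Proof.
under [RHS]eq_bigr do rewrite big_split.
rewrite big_split/= [X in _ * X](exchange_big_dep xpredT)//= -big_split/=.
apply: eq_bigr => i _; rewrite (bigID (fun j : 'I_n => (i < j)%N))/=; congr (_ * _).
  by apply: eq_bigl => j; rewrite andbC neq_ltn orbC andb_orr andbb; case: ltngtP.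
by apply: eq_bigl => j; rewrite neq_ltn -leqNgt; case: ltngtP.
Qed.

Lemma big_neq_lift (F : comPzRingType) n (j : 'I_n.+1) (f : 'I_n.+1 -> F) :
  \prod_(i | i != j) f i = \prod_i f (lift j i).
Proof.
rewrite big_mkcond (bigD1_ord j)//= eqxx mul1r; apply: eq_bigr => i _.
by rewrite eq_sym neq_lift.
Qed.

Lemma big2_lift (F : comPzRingType) n (j : 'I_n.+1) (f : 'I_n.+1 -> 'I_n.+1 -> F) :
  \prod_i \prod_i' f i i' = f j j * \prod_i (f j (lift j i) * f (lift j i) j) *
    \prod_i \prod_i' f (lift j i) (lift j i').
Proof.
rewrite (bigD1_ord j)//= (bigD1_ord j)//= big_split/=.
under [X in _ * _ * X = _]eq_bigr do rewrite (bigD1_ord j)//=.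
by rewrite big_split/= !mulrA.
Qed.

Lemma vdm_recl (F : fieldType) n (w : 'I_n.+1 -> F) :
  vdm w = \prod_i (w ord0 - w (lift ord0 i)) * vdm (fun i => w (lift ord0 i)).
Proof.
rewrite /vdm big_ord_recl big_mkcond big_ord_recl/= mul1r; congr (_ * _).
apply: eq_bigr => i _; rewrite big_mkcond big_ord_recl/= mul1r [RHS]big_mkcond.
by apply: eq_bigr.
Qed.

Lemma vdm_neq0 (F : fieldType) n (w : 'I_n -> F) : injective w -> vdm w != 0.
Proof.
move=> winj; apply/prodf_neq0 => i _; apply/prodf_neq0 => j ij; rewrite subr_eq0.
by apply: contraTneq ij => /winj->; rewrite ltnn.
Qed.

Section Cauchy.
Variable F : fieldType.

Definition cauchy_kernel n (A w : 'I_n -> F) := vdm w / \prod_i \prod_j (1 - A j * w i).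

(** Partial fractions of [w i ^ p] over the product of the [1 - A j * w i] factor the Vandermonde
    matrix of [w], with scaled rows, as the Cauchy matrix times a row-scaled Vandermonde matrix of
    the [(A j)^-1]. The remaining constants cancel pair by pair. *)
Lemma cauchy_det n (A w : 'I_n -> F) : (forall j, A j != 0) -> injective A ->
  (forall i j, 1 - A j * w i != 0) ->
  vdm A * cauchy_kernel A w = \det (\matrix_(i < n, j < n) (1 - A j * w i)^-1).
Proof.
move=> A0 Ainj Aw.
pose g j := (\prod_(t | t != j) (1 - A t / A j))^-1.
pose Phi := \matrix_(i < n, j < n) (1 - A j * w i)^-1.
have key : vdm w * \prod_i (\prod_j (1 - A j * w i))^-1 =
    \det Phi * (vdm (fun j => (A j)^-1) * \prod_j g j).
  rewrite !vdm_det -!mulrA [RHS]mulrCA; congr (_ * _).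
  have detD (d : 'I_n -> F) (V : 'M[F]_n) :
      \det V * \prod_i d i = \det (\matrix_(i < n, p < n) (V i p * d i)).
    have -> : \matrix_(i < n, p < n) (V i p * d i) = diag_mx (\row_i d i) *m V.
      apply/matrixP => i p; rewrite mul_diag_mx !mxE mulrC //.
    by rewrite det_mulmx det_diag mulrC; congr (_ * _); apply: eq_bigr => i _; rewrite mxE.
  rewrite !detD -det_mulmx; congr (\det _); apply/matrixP => i p; rewrite !mxE.
  have := @partial_fractions _ _ A 'X^p (w i) A0 Ainj.
  rewrite size_polyXn card_ord hornerXn => -> //.
  by apply: eq_bigr => j _; rewrite !mxE hornerXn mulrC.
have {}key : cauchy_kernel A w = \det Phi * (vdm (fun j => (A j)^-1) * \prod_j g j).
  by rewrite -key prodfV.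
rewrite key mulrCA -[RHS]mulr1; congr (_ * _).
have -> : \prod_j g j =
    \prod_(i < n) \prod_(j < n | (i < j)%N) ((1 - A j / A i) * (1 - A i / A j))^-1.
  rewrite /g prodfV (prod_offdiag (fun j t => 1 - A t / A j)) -prodfV.
  by apply: eq_bigr => i _; rewrite -prodfV.
rewrite -!big_split big1// => i _; rewrite -!big_split big1// => j ij /=.
have Aij : A i - A j != 0.
  by rewrite subr_eq0; apply: contraTneq ij => /Ainj->; rewrite ltnn.
have Aji : A j - A i != 0 by rewrite -opprB oppr_eq0.
by field; rewrite A0 A0 Aij Aji.
Qed.

(** The Laplace expansion of Cauchy's determinant along its first row, obtained as partial fractions
    in [w ord0]: the numerator has [n] linear factors against [n.+1] poles. *)
Lemma cauchy_kernel_recl n (A w : 'I_n.+1 -> F) : (forall j, A j != 0) -> injective A ->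
  (forall i j, 1 - A j * w i != 0) ->
  cauchy_kernel A w = \sum_j (\prod_i (A j - A (lift j i)))^-1 / (1 - A j * w ord0)
    * cauchy_kernel (fun i => A (lift j i)) (fun i => w (lift ord0 i)).
Proof.
move=> A0 Ainj Aw.
pose P : {poly F} := \prod_(i < n) ('X - (w (lift ord0 i))%:P).
have PE y : P.[y] = \prod_(i < n) (y - w (lift ord0 i)).
  by rewrite horner_prod; apply: eq_bigr => i _; rewrite !hornerE.
have sP : (size P <= #|'I_n.+1|)%N.
  by rewrite size_prod_XsubC -[index_enum _]enumT size_enum_ord card_ord.
have pf := partial_fractions A0 Ainj sP (Aw ord0).
rewrite /cauchy_kernel vdm_recl big_ord_recl invfM mulrACA -PE pf mulr_suml.
apply: eq_bigr => j _; rewrite PE big_neq_lift.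
under [X in _ * (_ / X) = _]eq_bigr do rewrite (bigD1_ord j)//=.
rewrite big_split/=.
set v := vdm _; set D := \prod_i \prod_(i0 < n) _.
set a := \prod_(i < n) ((A j)^-1 - w (lift ord0 i)).
set b := \prod_(i < n) (1 - A (lift j i) / A j).
set c := \prod_(i < n) (1 - A j * w (lift ord0 i)).
set d := \prod_(i < n) (A j - A (lift j i)).
have b0 : b != 0.
  apply/prodf_neq0 => i _; rewrite subr_eq0 eq_sym; apply/eqP => /divr1_eq/Ainj/eqP.
  by rewrite eq_sym (negbTE (neq_lift _ _)).
have c0 : c != 0 by apply/prodf_neq0.
have d0 : d != 0.
  apply/prodf_neq0 => i _; rewrite subr_eq0; apply/eqP => /Ainj/eqP.
  by rewrite (negbTE (neq_lift _ _)).
have D0 : D != 0 by apply/prodf_neq0 => i _; apply/prodf_neq0.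
have abcd : a * d = b * c.
  rewrite /a /b /c /d -!big_split; apply: eq_bigr => i _ /=.
  by field.
have -> : a = b * c / d by rewrite -abcd mulfK.
by field; rewrite D0 c0 d0 b0 Aw.
Qed.

End Cauchy.

(** * Value of the lattice sum of a Cauchy kernel *)

Section Evaluation.
Variables (R : realType) (q : R[i]).
Hypotheses (q0 : q != 0) (q1 : `|q| < 1) (qq0 : qinf q q != 0).
Local Notation C := R[i].
Local Notation theta := (theta q).

Lemma theta1 : theta 1 = 0.
Proof. by rewrite thetaE (qinf_recl q1 1) subrr !mul0r. Qed.

Lemma theta_split u : theta u = (1 - u) * (qinf q (q * u) * qinf q (q / u)).
Proof. by rewrite thetaE (qinf_recl q1 u) mulrA [u * q]mulrC. Qed.

Lemma theta_inv u : u != 0 -> theta u^-1 = - (theta u / u).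
Proof.
by move=> u0; rewrite !theta_split invrK; field.
Qed.

Lemma theta_div_inj n (A : 'I_n -> C) : (forall j, A j != 0) ->
  (forall i j, i != j -> theta (A i / A j) != 0) -> injective A.
Proof.
move=> A0 AA i j Aij; apply/eqP; apply: contraT => /AA.
by rewrite Aij divff// theta1 eqxx.
Qed.

(** Up to monomials and powers of [qinf q q], the Vandermonde and double products in [Z] combine
    into theta functions of the ratios of the [Z i], and those in [A] do so after multiplication by
    [vdm A]. This is the shape of Frobenius' determinant of theta functions. *)
Definition theta_cauchy n (A Z : 'I_n -> C) :=
  (qinf q q ^+ 2)^-1 * (\prod_i \prod_j qinf q (q * A i / A j)) *
  (\prod_i \prod_j qinf q (q * Z i / Z j)) * vdm Z / \prod_i \prod_j theta (A j * Z i).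

(** What matters is that [lam] is the same for all [j]: after division by it, the full value and the
    values with [A j] and the first [Z] removed become the two sides of [theta_expansion], apart
    from the [thskip] factors. *)
Lemma theta_cauchy_lift n (A Z : 'I_n.+1 -> C) :
  (forall j, A j != 0) -> (forall i, Z i != 0) ->
  (forall i j, i != j -> theta (A i / A j) != 0) ->
  (forall i j, theta (A j * Z i) != 0) ->
  exists lam : C,
    theta_cauchy A Z =
      lam * (\prod_i theta ((Z (lift ord0 i))^-1 * Z ord0) / \prod_j theta (A j * Z ord0)) /\
    forall j, (\prod_i (A j - A (lift j i)))^-1 *
        theta_cauchy (fun i => A (lift j i)) (fun i => Z (lift ord0 i)) =
      lam * (\prod_i theta ((Z (lift ord0 i))^-1 / A j) /
        (qinf q q ^+ 2 * \prod_i theta (A (lift j i) / A j))).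
Proof.
move=> A0 Z0 AA AZ; have Ainj := theta_div_inj A0 AA.
pose s := \prod_i - Z (lift ord0 i).
pose Y := \prod_(i < n) \prod_(i' < n) qinf q (q * Z (lift ord0 i) / Z (lift ord0 i')).
pose v := vdm (fun i => Z (lift ord0 i)).
pose E := \prod_(i < n) \prod_j theta (A j * Z (lift ord0 i)).
exists (s * ((qinf q q)^-1 * (\prod_i \prod_j qinf q (q * A i / A j)) * Y * v / E)).
have E0 : E != 0 by apply/prodf_neq0 => i _; apply/prodf_neq0.
split=> [|j].
  rewrite /theta_cauchy (big2_lift ord0 (fun i j => qinf q (q * Z i / Z j))) -/Y.
  rewrite mulfK// vdm_recl -/v [X in _ / X = _]big_ord_recl -/E.
  set X := \prod_i \prod_j _; set d := \prod_j theta _.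
  set t := \prod_i theta _; set y := \prod_i (_ * _); set z := \prod_i (_ - _).
  have e1 : s * t = y * z.
    rewrite /s /t /y /z -!big_split; apply: eq_bigr => i _ /=.
    rewrite [_^-1 * _]mulrC theta_split invf_div !mulrA.
    by field.
  have d0 : d != 0 by apply/prodf_neq0.
  transitivity ((qinf q q)^-1 * X * Y * v * (y * z) / (d * E)).
    by field; rewrite d0 E0 qq0.
  by rewrite -e1; field; rewrite d0 E0 qq0.
have thA i : theta (A (lift j i) / A j) != 0 by apply: AA; rewrite eq_sym neq_lift.
have sA i : A j - A (lift j i) != 0.
  by rewrite subr_eq0; apply/eqP => /Ainj/eqP; rewrite (negbTE (neq_lift _ _)).
rewrite /theta_cauchy (big2_lift j) -/Y -/v mulfK//.
pose D := \prod_(i < n) \prod_i' theta (A (lift j i') * Z (lift ord0 i)).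
pose c := \prod_i theta (A j * Z (lift ord0 i)).
have EE : E = c * D.
  by rewrite /E /c /D -big_split; apply: eq_bigr => i _; rewrite (bigD1_ord j).
rewrite EE -/D; set X := \prod_(i < n) \prod_i' qinf q _.
set a := \prod_i (A j - _); set p := \prod_i (_ * _).
set b := \prod_i theta (_^-1 / _); set f := \prod_i theta (_ / A j).
have e2 : s * b * p * a = c * f.
  rewrite /s /b /p /a /c /f -!big_split; apply: eq_bigr => i _ /=.
  rewrite -invfM [Z _ * _]mulrC theta_inv ?mulf_neq0// (theta_split (A _ / A j)) invf_div !mulrA.
  by field; rewrite A0 Z0.
have a0 : a != 0 by apply/prodf_neq0.
have D0 : D != 0 by apply/prodf_neq0 => i _; apply/prodf_neq0.
have c0 : c != 0 by apply/prodf_neq0.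
have f0 : f != 0 by apply/prodf_neq0.
transitivity ((qinf q q ^+ 2)^-1 * X * Y * v * (c * f) / (a * c * D * f)).
  by field; rewrite a0 D0 c0 f0 qq0.
by rewrite -e2; field; rewrite a0 D0 c0 f0 qq0.
Qed.

Lemma vabs_fcons n (k : int * {ffun 'I_n -> int}) : vabs (fcons k) = k.1 + vabs k.2.
Proof.
rewrite /vabs big_ord_recl fcons0; congr (_ + _).
by apply: eq_bigr => i _; rewrite fconsS.
Qed.

Lemma thskip1 M : thskip q M 1 = if M == 0 then qinf q q ^+ 2 else 0.
Proof.
case: M => [[|n]|n] /=.
- by rewrite /qskip /poch big_ord0 !mul1r expr1 divr1.
- by rewrite /qskip poch_recl subrr !mul0r.
- by rewrite (qinf_recl q1) subrr !mul0r.
Qed.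

Section Summability.
Variables (n : nat) (A Z : 'I_n -> C).
Hypotheses (A0 : forall j, A j != 0) (Z0 : forall i, Z i != 0)
  (AA : forall i j, i != j -> theta (A i / A j) != 0)
  (AZ : forall i j, theta (A j * Z i) != 0).

Lemma summable_cauchy M : summable (onlevel q M (cauchy_kernel A) Z).
Proof.
have Binj : injective (fun s => A s * q ^ (0 : int)).
  by move=> i j; rewrite !expr0z !mulr1; apply: theta_div_inj.
have sP : (n + size (1%R : {poly C}) <= #|'I_n|.+1)%N by rewrite size_poly1 card_ord addn1.
have := summable_onlevel_vdm q0 q1 A0 Z0 (fun i j => AZ i j) Binj sP M.
congr summable; apply/funext => k; rewrite /onlevel; case: ifP => // _.
rewrite /cauchy_kernel -prodfV; congr (_ * _); apply: eq_bigr => i _.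
by rewrite hornerC mul1r; congr (_^-1); apply: eq_bigr => j _; rewrite expr0z mulr1.
Qed.

Lemma one_sub_neq0 (k : 'I_n -> int) i j : 1 - A j * (Z i * q ^ k i) != 0.
Proof. by rewrite mulrA; apply: theta_neq0 => //; rewrite mulf_neq0. Qed.

End Summability.

(* Expanding the kernel along its first variable reduces the inner sums to the induction
   hypothesis; the outer sum is [theta_expansion] with numerator parameters [U / Z 0] and
   [1 / Z i], where [U] is the product of all [A j] and [Z i]. *)
Theorem has_sum_cauchy n (A Z : 'I_n -> C) M :
  (forall j, A j != 0) -> (forall i, Z i != 0) ->
  (forall i j, i != j -> theta (A i / A j) != 0) ->
  (forall i j, theta (A j * Z i) != 0) ->
  has_sum (onlevel q M (cauchy_kernel A) Z)
    (thskip q M (\prod_i A i * \prod_i Z i) * theta_cauchy A Z).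
Proof.
elim: n A Z M => [|n IH] A Z M A0 Z0 AA AZ.
  (* Level [M] of Z^0 is a point for [M = 0] and empty otherwise, in agreement with [thskip1] at the
     empty product [U = 1]. *)
  pose k0 : {ffun 'I_0 -> int} := [ffun=> 0].
  have k0E k : k = k0 by apply/ffunP => -[].
  rewrite (_ : thskip q M _ * _ = onlevel q M (cauchy_kernel A) Z k0).
    by apply: has_sum1 => k; rewrite [k]k0E eqxx.
  rewrite !big_ord0 mulr1 thskip1 /onlevel /vabs big_ord0 /theta_cauchy /cauchy_kernel /vdm !big_ord0.
  rewrite !mulr1 eq_sym; case: ifP => _; last by rewrite mul0r.
  by rewrite invr1 !mulr1 mulfV// expf_neq0.
have Ainj := theta_div_inj A0 AA.
(* Existence of the sum is already known; it is identified through the iterated sum over its first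
   coordinate. *)
have [s hs] := summable_has_sum (summable_cauchy A0 Z0 AA AZ M).
suff <- : s = thskip q M (\prod_i A i * \prod_i Z i) * theta_cauchy A Z by [].
pose Aj (j : 'I_n.+1) := fun i : 'I_n => A (lift j i).
pose Z' := fun i : 'I_n => Z (lift ord0 i).
pose w (j : 'I_n.+1) := (\prod_i (A j - A (lift j i)))^-1.
pose U j := \prod_i Aj j i * \prod_i Z' i.
pose G (m : int) := \sum_j w j / (1 - A j * (Z ord0 * q ^ m)) *
  (thskip q (M - m) (U j) * theta_cauchy (Aj j) Z').
have hG : has_sum G s.
  have hs2 : has_sum (onlevel q M (cauchy_kernel A) Z \o @fcons n) s.
    apply: (@has_sum_reindex _ _ _ (@fcons n) (Some \o @fsplit n)) hs => // k /=.
      by rewrite fconsK.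
    by rewrite fsplitK.
  apply: (has_sum_pair hs2) => m.
  pose H j := onlevel q (M - m) (cauchy_kernel (Aj j)) Z'.
  have hH j : has_sum (H j) (thskip q (M - m) (U j) * theta_cauchy (Aj j) Z').
    apply: IH => [i|i|i i' ii'|i i'].
    - exact: A0.
    - exact: Z0.
    - by apply: AA; rewrite (inj_eq lift_inj).
    - exact: AZ.
  have h := has_sum_sum (index_enum 'I_n.+1)
    (fun j => has_sumZ (w j / (1 - A j * (Z ord0 * q ^ m))) (hH j)).
  apply: eq_has_sum h => k /=; rewrite /H /onlevel.
  have -> : (vabs (fcons (m, k)) == M) = (vabs k == M - m).
    by rewrite vabs_fcons/= eq_sym [RHS]eq_sym subr_eq addrC.
  case: ifP => _; last by rewrite big1// => j _; rewrite mulr0.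
  rewrite cauchy_kernel_recl//; last exact: one_sub_neq0.
  apply: eq_bigr => j _; rewrite fcons0 /=; congr (_ * _).
  by congr cauchy_kernel; apply/funext => i; rewrite fconsS.
apply: has_sum_unique hG _.
(* The parameter at [ord0] is chosen to give [al] the same product as [A]. *)
pose al i := if unlift ord0 i is Some i' then (Z' i')^-1 else \prod_j A j * \prod_j Z' j.
have alS i : al (lift ord0 i) = (Z' i)^-1 by rewrite /al liftK.
have al_0 : al ord0 = \prod_j A j * \prod_j Z' j by rewrite /al unlift_none.
have pA0 : \prod_j A j != 0 by apply/prodf_neq0.
have pZ0 : \prod_j Z' j != 0 by apply/prodf_neq0 => i _; apply: Z0.
have al0 i : al i != 0.
  case: (unliftP ord0 i) => [i' ->|->]; first by rewrite alS invr_eq0 Z0.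
  by rewrite al_0 mulf_neq0.
have Aal : \prod_i al i = \prod_i A i.
  rewrite big_ord_recl al_0.
  have -> : \prod_(i < n) al (lift ord0 i) = \prod_i (Z' i)^-1 by apply: eq_bigr => i _.
  by rewrite prodfV mulfK.
have := theta_expansion q0 q1 qq0 A0 al0 Aal AA M (Z0 ord0) (fun j => AZ ord0 j).
have [lam [ThE ThjE]] := theta_cauchy_lift A0 Z0 AA AZ.
rewrite big_neq_lift al_0 => hth.
have hth' := has_sumZ lam hth.
have -> : thskip q M (\prod_i A i * \prod_i Z i) * theta_cauchy A Z =
    lam * (thskip q M (\prod_j A j * \prod_j Z' j * Z ord0) *
    (\prod_i theta (al (lift ord0 i) * Z ord0)) / \prod_j theta (A j * Z ord0)).
  have ZE : \prod_i A i * \prod_i Z i = \prod_j A j * \prod_j Z' j * Z ord0.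
    by rewrite [\prod_i Z i]big_ord_recl -mulrA [Z ord0 * _]mulrC.
  have tE : \prod_(i < n) theta (al (lift ord0 i) * Z ord0) =
      \prod_i theta ((Z (lift ord0 i))^-1 * Z ord0) by apply: eq_bigr => i _; rewrite alS.
  by rewrite ZE ThE tE mulrCA !mulrA.
apply: eq_has_sum hth' => m; rewrite /G mulr_sumr; apply: eq_bigr => j _.
rewrite /thcoef !big_neq_lift al_0.
have -> : \prod_i A i * \prod_i Z' i / A j = U j.
  rewrite /U [\prod_i A i](bigD1_ord j)//= /Aj.
  by rewrite mulrAC [A j * _]mulrC mulfK.
have -> : \prod_(i < n) theta (al (lift ord0 i) / A j) =
    \prod_i theta ((Z (lift ord0 i))^-1 / A j) by apply: eq_bigr => i _; rewrite alS.
transitivity (thskip q (M - m) (U j) / (1 - A j * (Z ord0 * q ^ m)) * (w j * theta_cauchy (Aj j) Z')).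
  by rewrite ThjE mulrA; ring.
by ring.
Qed.

End Evaluation.

(** * Nonvanishing and quasiperiodicity of theta functions *)

Section Quasiperiodicity.
Variables (R : realType) (q : R[i]).
Hypotheses (q0 : q != 0) (q1 : `|q| < 1).
Local Notation C := R[i].
Local Notation theta := (theta q).

(** Weierstrass' inequality: a product of factors [1 - t_j] with [0 <= t_j <= 1] is at least 1 minus
    the sum of the [t_j]. *)
Lemma poch_ge (y : C) n : `|y| <= 1 -> 1 - `|y| * \sum_(j < n) `|q| ^+ j <= `|poch q y n|.
Proof.
move=> y1; elim: n => [|n IH]; first by rewrite /poch !big_ord0 mulr0 subr0 normr1.
rewrite poch_recr big_ord_recr/= normrM; set s := \sum_(j < n) _ in IH *.
have s0 : 0 <= s by apply: sumr_ge0 => j _; rewrite exprn_ge0.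
set t := `|y| * `|q| ^+ n.
have t1 : t <= 1 by rewrite mulr_ile1// ?exprn_ge0// exprn_ile1// ltW.
have t0 : 0 <= t by rewrite mulr_ge0// exprn_ge0.
have ht : 1 - t <= `|1 - y * q ^+ n|.
  by have := lerB_dist 1 (y * q ^+ n); rewrite normr1 normrM normrX.
apply: (@le_trans _ _ ((1 - `|y| * s) * (1 - t))).
  rewrite -subr_ge0 (_ : _ - _ = `|y| * s * t); last by rewrite /t; ring.
  by rewrite mulr_ge0// mulr_ge0.
apply: (@le_trans _ _ (`|poch q y n| * (1 - t))).
  by rewrite ler_wpM2r// subr_ge0.
by rewrite ler_wpM2l.
Qed.

(** Finitely many nonzero factors are split off, after which [poch_ge] keeps the remaining products
    at least 1/2 in absolute value. *)
Lemma qinf_neq0 (a : C) : (forall j, 1 - a * q ^+ j != 0) -> qinf q a != 0.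
Proof.
move=> ha; have [M HM] : exists M, forall n, \sum_(j < n) `|q| ^+ j <= M.
  by exists (1 - `|q|)^-1 => n; apply: sum_geometric_le; rewrite normr_ge0.
have M0 : 0 <= M by apply: le_trans (HM 0%N); rewrite big_ord0.
(* This choice gives both [e * M <= 1/2] and [e <= 1]. *)
pose e : C := (2 * (M + 1))^-1.
have e0 : 0 < e by rewrite invr_gt0 mulr_gt0// ltr_wpDl.
have [N HN] : exists N, `|a * q ^+ N| < e.
  have h : cvgs (fun n => a * q ^+ n) (a * 0) by apply: cvgsM (cvgs_cst a) (cvgs_expn q1).
  have /cvgs_dist/(_ e e0)[N HN] := h; exists N.
  by have := HN N (leqnn _); rewrite mulr0 subr0.
rewrite (qinf_poch q1 a N) mulf_neq0//; first by apply/prodf_neq0 => j _.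
set y := a * q ^+ N in HN *; apply/eqP => y0.
have e2 : e * M <= 2^-1.
  rewrite /e mulrC ler_pdivrMr ?mulr_gt0 ?ltr_wpDl//.
  by rewrite mulKf ?lerDl.
have e1 : e <= 1.
  rewrite /e invf_le1 ?mulr_gt0 ?ltr_wpDl// (_ : 2 * (M + 1) = 1 + (1 + 2 * M)); last by ring.
  by rewrite lerDl addr_ge0// mulr_ge0.
have hy n : 2^-1 <= `|poch q y n|.
  apply: le_trans (poch_ge n (le_trans (ltW HN) e1)).
  rewrite lerBrDr -lerBrDl (_ : 1 - 2^-1 = 2^-1); last by field.
  apply: le_trans e2; apply: ler_pM => //; last exact: ltW.
  by apply: sumr_ge0 => j _; rewrite exprn_ge0.
have /cvgs_dist/(_ 2^-1)[|n Hn] := @poch_cvg _ _ q1 y; first by rewrite invr_gt0.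
have := Hn n (leqnn _); rewrite y0 subr0 => h.
by have := le_lt_trans (hy n) h; rewrite ltxx.
Qed.

Lemma theta_neq0P (u : C) : u != 0 -> (forall j : int, 1 - u * q ^ j != 0) -> theta u != 0.
Proof.
move=> u0 hu; apply: mulf_neq0; apply: qinf_neq0 => j; first exact: (hu j).
rewrite (_ : q / u * q ^+ j = (u * q ^ (Negz j))^-1).
  by rewrite one_sub_inv_neq0 ?hu// mulf_neq0// expfz_neq0.
by rewrite NegzE -exprnN exprS; field; rewrite u0 q0 expf_neq0.
Qed.

(** Only products in [u * q ^ m] are assumed nonzero. The factors of [qinf q (q / u)] are, up to
    units, the [1 - u * q ^ m] with negative [m], which the assumption covers as well. *)
Lemma qinf_expz_theta_neq0 (u : C) : u != 0 -> (forall m : int, qinf q (u * q ^ m) != 0) ->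
  theta u != 0.
Proof.
move=> u0 hu; apply: theta_neq0P => // j.
by have := hu j; rewrite (qinf_recl q1) mulf_eq0 negb_or => /andP[].
Qed.

(** For both signs this is (-1)^m q^(m(m-1)/2). *)
Definition theta_factor (m : int) : C := match m with
  | Posz n => \prod_(j < n) - q ^+ j
  | Negz n => \prod_(j < n.+1) - q ^+ j.+1
  end.

Lemma theta_mulq (u : C) : u != 0 -> theta u = - u * theta (u * q).
Proof.
move=> u0; rewrite !thetaE (qinf_recl q1 u).
have -> : q / (u * q) = u^-1 by field; rewrite u0 q0.
by rewrite (qinf_recl q1 u^-1) [u^-1 * q]mulrC; field.
Qed.

Lemma theta_quasiperiodic (m : int) (u : C) : u != 0 ->
  theta u = theta_factor m * u ^ m * theta (u * q ^ m).
Proof.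
move=> u0; case: m => n.
  elim: n => [|n IH]; first by rewrite /= big_ord0 !expr0z !mulr1 mul1r.
  rewrite IH (theta_mulq (u := u * q ^ n)) ?mulf_neq0 ?expf_neq0//.
  have e (z : C) : z ^ n.+1 = z ^+ n * z by rewrite -exprnP exprSr.
  by rewrite !e /= big_ord_recr/= -!exprnP [u * (q ^+ n * q)]mulrA; ring.
elim: n => [|n IH].
  have := @theta_mulq (u * q^-1); rewrite mulf_neq0 ?invr_eq0// => /(_ isT).
  rewrite mulfVK// => h; rewrite /= big_ord1 expr1 !NegzE -!exprnN !expr1 h.
  by field; rewrite u0 q0.
have := @theta_mulq (u * q ^ (Negz n.+1)); rewrite mulf_neq0 ?expfz_neq0// => /(_ isT) h.
rewrite IH [theta_factor (Negz n.+1)]/= big_ord_recr/= h.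
have -> : u * q ^ Negz n.+1 * q = u * q ^ Negz n.
  by rewrite !NegzE -!exprnN [q ^+ n.+2]exprS; field; rewrite q0 expf_neq0.
rewrite !NegzE -!exprnN ![_ ^+ n.+2]exprS; field.
by rewrite u0 q0 !expf_neq0.
Qed.

End Quasiperiodicity.

Lemma qinf_q_neq0 (R : realType) (q : R[i]) : q != 0 -> `|q| < 1 -> qinf q q != 0.
Proof.
move=> q0 q1; apply: qinf_neq0 => // j; rewrite -exprS subr_eq0 eq_sym; apply/eqP => h.
by have := expz_eq1 q1 (k := j.+1) h.
Qed.

Lemma theta_shift_ratio (R : realType) (q : R[i]) n (A : 'I_n -> R[i]) (v : 'I_n -> int) :
  q != 0 -> `|q| < 1 -> (forall i, A i != 0) ->
  (forall i j, i != j -> theta q (A i / A j) != 0) ->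
  forall i j, i != j -> theta q (A i * q ^ v i / (A j * q ^ v j)) != 0.
Proof.
move=> q0 q1 A0 AA i j ij; rewrite (_ : _ / _ = A i / A j * q ^ (v i - v j)).
  by apply: theta_expz_neq0 => //; rewrite ?AA// mulf_neq0 ?invr_eq0.
by rewrite expfzDr// -invr_expz invfM; ring.
Qed.

Section Core.
Variables (R : realType) (q : R[i]).
Hypotheses (q0 : q != 0) (q1 : `|q| < 1).
Local Notation C := R[i].
Local Notation theta := (theta q).
Variables (n : nat) (A Z : 'I_n -> C).
Hypotheses (A0 : forall j, A j != 0) (Z0 : forall i, Z i != 0)
  (AA : forall i j, i != j -> theta (A i / A j) != 0)
  (AZ : forall i j, theta (A j * Z i) != 0).

(* In the determinant form of the kernel, each term of the Leibniz expansion only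
   undergoes a translation of the lattice. *)
Lemma has_sum_cauchy_shift (v : 'I_n -> int) : vabs v = 0 ->
  has_sum (onlevel q 0 (cauchy_kernel (fun j => A j * q ^ v j)) Z)
    (vdm A / vdm (fun j => A j * q ^ v j) *
     (thskip q 0 (\prod_i A i * \prod_i Z i) * theta_cauchy q A Z)).
Proof.
move=> v0; have Ainj := theta_div_inj q1 A0 AA.
pose Av j := A j * q ^ v j.
have Av0 j : Av j != 0 by rewrite mulf_neq0// expfz_neq0.
have Avinj : injective Av.
  by apply: (theta_div_inj q1 Av0) => i j ij; apply: theta_shift_ratio.
have vdm0 := vdm_neq0 Avinj.
have hA := has_sumZ (vdm A) (has_sum_cauchy q0 q1 (qinf_q_neq0 q0 q1) 0 A0 Z0 AA AZ).
pose T (w : 'S_n) (v : 'I_n -> int) := onlevel q 0 (fun w => \prod_i (1 - w i)^-1)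
  (fun i => A (w i) * Z i * q ^ v (w i)).
have Tsummable w : summable (T w (fun=> 0)).
  apply: summable_lattice_frac => // i; first by rewrite expr0z mulr1 mulf_neq0.
  by rewrite expr0z mulr1.
have /choice[L HL] w := summable_has_sum (Tsummable w).
(* In the Leibniz term of [w] the variable [i] is shifted by [v (w i)], again a vector of total
   0. *)
have hT w : has_sum (T w v) (L w).
  have h : vabs (fun i => v (w i)) = 0.
    by rewrite -v0 /vabs [RHS](reindex_inj (@perm_inj _ w)).
  have := has_sum_shift q0 h (HL w); congr (has_sum (onlevel _ _ _ _) _).
  by apply/funext => i; rewrite expr0z mulr1.
have detE u : (forall j k i, 1 - (A j * q ^ u j) * (Z i * q ^ k) != 0) ->
    (forall j, A j * q ^ u j != 0) -> injective (fun j => A j * q ^ u j) ->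
    (fun k => vdm (fun j => A j * q ^ u j) *
      onlevel q 0 (cauchy_kernel (fun j => A j * q ^ u j)) Z k) =1
    (fun k => \sum_(w : 'S_n) (-1) ^+ w * T w u k).
  move=> h1 h2 h3 k; rewrite /T /onlevel; case: ifP => _; last first.
    by rewrite mulr0 big1// => w _; rewrite mulr0.
  rewrite cauchy_det//; apply: eq_bigr => w _; congr (_ * _); apply: eq_bigr => i _.
  by rewrite mxE; congr (1 - _)^-1; ring.
have hne u j (k : int) i : 1 - (A j * q ^ u) * (Z i * q ^ k) != 0.
  have := theta_neq0 q0 q1 (u + k) (mulf_neq0 (A0 j) (Z0 i)) (AZ _ _).
  by rewrite expfzDr// mulrACA.
have Ssum u : (forall w, has_sum (T w u) (L w)) ->
    has_sum (fun k => \sum_(w : 'S_n) (-1) ^+ w * T w u k) (\sum_(w : 'S_n) (-1) ^+ w * L w).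
  move=> hu; have h := has_sum_sum (index_enum 'S_n) (fun w => has_sumZ ((-1) ^+ w) (hu w)).
  exact: h.
have A_E : (fun j => A j * q ^ (0 : int)) = A by apply/funext => j; rewrite expr0z mulr1.
(* The unshifted kernel determines the alternating sum of the [L w], which is also the value for the
   shift [v]. *)
have LE : \sum_(w : 'S_n) (-1) ^+ w * L w =
    vdm A * (thskip q 0 (\prod_i A i * \prod_i Z i) * theta_cauchy q A Z).
  apply: has_sum_unique (Ssum (fun=> 0) HL) _; apply: eq_has_sum hA => k.
  have := detE (fun=> 0) (fun j => hne 0 j); rewrite A_E; apply=> // j.
  by rewrite expr0z mulr1.
have hv := has_sumZ (vdm Av)^-1 (Ssum v hT); rewrite LE mulrA in hv.
rewrite [_ / _]mulrC; apply: eq_has_sum hv => k.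
by rewrite -(detE v (fun j => hne (v j) j))// mulKf.
Qed.

End Core.

Lemma card_sig_ord n (f : 'I_n -> nat) : #|{: {j : 'I_n & 'I_(f j)}}| = (\sum_j f j)%N.
Proof.
rewrite card_tagged sumnE big_map big_enum; apply: eq_bigr => j _.
by rewrite card_ord.
Qed.

(** * Ratios of infinite products as rational functions *)

Section PochhammerRatios.
Variables (R : realType) (q : R[i]).
Hypotheses (q0 : q != 0) (q1 : `|q| < 1).
Local Notation C := R[i].
Local Notation theta := (theta q).

(** The inverse of the q-shifted factorial of [u] with integer index [m]. *)
Definition qratio (m : int) (u : C) := qinf q (u * q ^ m) / qinf q u.

Definition posp (m : int) : nat := if m is Posz n then n else 0%N.
Definition negp (m : int) : nat := if m is Negz n then n.+1 else 0%N.

Lemma qratioE m u : u != 0 -> theta u != 0 ->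
  qratio m u = (\prod_(t < negp m) (1 - u * q ^ Negz t)) / \prod_(t < posp m) (1 - u * q ^ t).
Proof.
move=> u0 thu; have qu k : qinf q (u * q ^ k) != 0.
  by have := theta_expz_neq0 q0 q1 k u0 thu; rewrite mulf_eq0 negb_or => /andP[].
rewrite /qratio; case: m => n /=.
  rewrite big_ord0 mul1r (qinf_poch q1 u n) invfM mulrCA.
  by rewrite divff ?mulr1//; apply: (qu n).
rewrite big_ord0 divr1 (qinf_poch q1 (u * q ^ Negz n) n.+1).
have -> : u * q ^ Negz n * q ^+ n.+1 = u by rewrite NegzE -exprnN mulfVK// expf_neq0.
rewrite mulfK; last by have := qu 0; rewrite expr0z mulr1.
rewrite /poch (reindex_inj rev_ord_inj); apply: eq_bigr => t _.
rewrite -mulrA (_ : q ^ Negz n * q ^+ _ = q ^ Negz t)//.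
rewrite exprnP -expfzDr//; congr (q ^ _) => /=.
by have := ltn_ord t; rewrite !NegzE; lia.
Qed.

Lemma qratio1 u : qinf q (u * q) != 0 -> qratio 1 u = (1 - u)^-1.
Proof. by move=> uq; rewrite /qratio expr1z (qinf_recl q1 u) invfM mulrCA divff// mulr1. Qed.

Section Core.
Variables (n : nat) (A Z : 'I_n -> C).
Hypotheses (A0 : forall j, A j != 0) (Z0 : forall i, Z i != 0)
  (AA : forall i j, i != j -> theta (A i / A j) != 0)
  (AZ : forall i j, theta (A j * Z i) != 0).
Variable m : 'I_n -> int.
Hypothesis msum : vabs m = n.

(** The poles, labelled by their first component; a label with [m j <= 0] carries none. *)
Let S : finType := {j : 'I_n & 'I_(posp (m j))}.
Let lab (s : S) : 'I_n := tag s.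
Let ex (s : S) : int := Posz (tagged s).
Let P : {poly C} := \prod_(s : {j : 'I_n & 'I_(negp (m j))})
  (1 - (A (tag s) * q ^ Negz (tagged s)) *: 'X).

Let Binj : injective (fun s => A (lab s) * q ^ ex s).
Proof.
move=> [i s] [j t]; rewrite /lab /ex/= => BB.
have ij : i = j.
  apply/eqP; apply: contraT => ij.
  have := theta_neq0 q0 q1 (s%:Z - t%:Z) _ (AA ij).
  rewrite mulf_neq0 ?invr_eq0// => /(_ isT); rewrite expfzDr// -invr_expz.
  rewrite mulrACA BB -invfM divff ?subrr ?eqxx//.
  by rewrite mulf_neq0// expfz_neq0.
move: s BB; rewrite ij => s /(mulfI (A0 j)) BB; congr (Tagged _ _); apply/val_inj.
have /(expz_eq1 q1) : q ^ (s%:Z - t%:Z) = 1.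
  by rewrite expfzDr// BB -expfzDr// subrr.
by move=> st; apply/eqP; rewrite -eqz_nat -subr_eq0 st.
Qed.

(** The number of poles exceeds the degree of [P] by at least the total of the [m j], which is
    [n]. *)
Let sP : (n + size P <= #|{: S}|.+1)%N.
Proof.
have := size_prod_affine (fun s : {j : 'I_n & 'I_(negp (m j))} =>
  A (tag s) * q ^ Negz (tagged s)) xpredT.
rewrite -/P -[#|xpredT|]/(#|{: {j : 'I_n & 'I_(negp (m j))}}|) card_sig_ord => h.
have cS : #|S| = (n + \sum_j negp (m j))%N.
  transitivity (\sum_j posp (m j))%N; first exact: card_sig_ord.
  apply/eqP; rewrite -eqz_nat PoszD -msum !(big_morph Posz PoszD erefl) /vabs -big_split/=.
  apply/eqP; apply: eq_bigr => j _; case: (m j) => k /=; lia.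
by rewrite cS -addnS leq_add2l.
Qed.

Let PE i (k : 'I_n -> int) : P.[Z i * q ^ k i] /
    \prod_(s : S) (1 - (fun s => A (lab s) * q ^ ex s) s * (Z i * q ^ k i)) =
  \prod_j qratio (m j) (A j * (Z i * q ^ k i)).
Proof.
have thk j : theta (A j * (Z i * q ^ k i)) != 0.
  by rewrite mulrA theta_expz_neq0// mulf_neq0.
have Azk j : A j * (Z i * q ^ k i) != 0 by rewrite !mulf_neq0// expfz_neq0.
under [RHS]eq_bigr do rewrite qratioE//.
rewrite big_split/= prodfV (sig_big_dep xpredT (fun _ => xpredT)
  (fun j (t : 'I_(negp (m j))) => 1 - A j * (Z i * q ^ k i) * q ^ Negz t)).
rewrite (sig_big_dep xpredT (fun _ => xpredT)
  (fun j (t : 'I_(posp (m j))) => 1 - A j * (Z i * q ^ k i) * q ^ t)).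
have Py y : P.[y] = \prod_(s : {j : 'I_n & 'I_(negp (m j))})
    (1 - A (tag s) * y * q ^ Negz (tagged s)).
  by rewrite horner_prod; apply: eq_bigr => s _; rewrite !hornerE mulrAC.
congr (_ / _); last first.
  by apply: eq_bigr => s _; rewrite /lab /ex mulrAC.
exact: Py.
Qed.

Definition lattice_term (w : 'I_n -> C) := vdm w * \prod_i \prod_j qratio (m j) (A j * w i).

Let termE : onlevel q 0 lattice_term Z = onlevel q 0 (fun w => vdm w * \prod_i
  (P.[w i] / \prod_(s : S) (1 - (fun s => A (lab s) * q ^ ex s) s * w i))) Z.
Proof.
apply/funext/eq_onlevel => k; congr (_ * _); apply: eq_bigr => i _.
by rewrite PE.
Qed.

Lemma summable_lattice_term : summable (onlevel q 0 lattice_term Z).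
Proof. rewrite termE; exact: (summable_onlevel_vdm q0 q1 A0 Z0 AZ Binj sP). Qed.

(** The [m j] have average 1, so unless all are 1 some [m j] is at most 0 and its label carries no
    pole. *)
Lemma has_sum_lattice_term0 : (exists j, m j != 1) -> has_sum (onlevel q 0 lattice_term Z) 0.
Proof.
move=> [j1 mj1]; have [j0 mj0] : exists j, m j <= 0.
  apply/not_existsP => mj.
  have m1 j : 0 <= m j - 1 by have := mj j; move/negP; lia.
  have : \sum_j (m j - 1) = 0.
    by rewrite sumrB -/(vabs m) msum sumr_const card_ord pmulrn intz subrr.
  by move/eqP; rewrite psumr_eq0// => /allP/(_ j1 (mem_index_enum _)); rewrite subr_eq0 (negbTE mj1).
rewrite termE; apply: (has_sum_onlevel_vdm0 q0 q1 A0 Z0 AZ Binj sP 0 (j0 := j0)) => -[j t].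
rewrite /lab/=; apply/eqP => jj0; move: t; rewrite jj0.
by case: (m j0) mj0 => [[|k]|k] //= _ [].
Qed.

End Core.

(* All ratios are simple fractions in this case, so that the term is a Cauchy kernel. *)
Lemma has_sum_lattice_term1 n (A Z : 'I_n -> C) (v : 'I_n -> int) :
  (forall j, A j != 0) -> (forall i, Z i != 0) ->
  (forall i j, i != j -> theta (A i / A j) != 0) ->
  (forall i j, theta (A j * Z i) != 0) -> vabs v = 0 ->
  has_sum (onlevel q 0 (lattice_term (fun j => A j * q ^ v j) (fun=> 1)) Z)
    (vdm A / vdm (fun j => A j * q ^ v j) *
     (thskip q 0 (\prod_i A i * \prod_i Z i) * theta_cauchy q A Z)).
Proof.
move=> A0 Z0 AA AZ v0.
apply: eq_has_sum (has_sum_cauchy_shift q0 q1 A0 Z0 AA AZ v0).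
apply: eq_onlevel => k; rewrite /cauchy_kernel /lattice_term -prodfV; congr (_ * _).
apply: eq_bigr => i _; rewrite -prodfV; apply: eq_bigr => j _.
have h := theta_expz_neq0 q0 q1 (v j + k i + 1) (mulf_neq0 (A0 j) (Z0 i)) (AZ i j).
rewrite qratio1//; move: h; rewrite mulf_eq0 negb_or => /andP[+ _].
by rewrite !expfzDr// expr1z !mulrA [A j * Z i * _]mulrAC.
Qed.

End PochhammerRatios.

(** * The matrices f and g *)

Definition ptcons (T : Type) r (z0 : T) (z : 'I_r -> T) (i : 'I_r.+1) : T :=
  if unlift ord0 i is Some j then z j else z0.

Lemma ptcons0 (T : Type) r (z0 : T) (z : 'I_r -> T) : ptcons z0 z ord0 = z0.
Proof. by rewrite /ptcons unlift_none. Qed.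

Lemma ptconsS (T : Type) r (z0 : T) (z : 'I_r -> T) i : ptcons z0 z (lift ord0 i) = z i.
Proof. by rewrite /ptcons liftK. Qed.

(* [Z^r] is identified with the level-zero sublattice of [Z^(r+1)]. *)
Definition balance r (k : 'I_r -> int) : 'I_r.+1 -> int := ptcons (- vabs k) k.

Lemma balance0 r (k : 'I_r -> int) : balance k ord0 = - vabs k.
Proof. exact: ptcons0. Qed.

Lemma balanceS r (k : 'I_r -> int) i : balance k (lift ord0 i) = k i.
Proof. exact: ptconsS. Qed.

Lemma vabs_balance r (k : 'I_r -> int) : vabs (balance k) = 0.
Proof.
rewrite {1}/vabs big_ord_recl /balance ptcons0 (eq_bigr k) => [|i _]; last by rewrite ptconsS.
exact: addNr.
Qed.

Section Matching.
Variables (R : realType) (q : R[i]).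
Hypotheses (q0 : q != 0) (q1 : `|q| < 1).
Local Notation C := R[i].
Local Notation theta := (theta q).

Lemma level0_sums r (F : ('I_r.+1 -> C) -> C) (Z : 'I_r.+1 -> C) s :
  summable (onlevel q 0 F Z) -> has_sum (onlevel q 0 F Z) s ->
  summable (fun k : {ffun 'I_r -> int} => F (fun i => Z i * q ^ balance k i)) /\
  has_sum (fun k : {ffun 'I_r -> int} => F (fun i => Z i * q ^ balance k i)) s.
Proof.
move=> Fs hs; pose e (k : {ffun 'I_r -> int}) := fcons (- vabs k, k).
pose g (k : {ffun 'I_r.+1 -> int}) := if vabs k == 0 then Some (fsplit k).2 else None.
have e0 k : vabs (e k) = 0 by rewrite /e vabs_fcons/= addNr.
have ge : pcancel e g by move=> k; rewrite /g e0 eqxx /e fconsK.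
have eg : ocancel g e.
  move=> k; rewrite /g; case: eqP => //= k0.
  rewrite /e -[RHS]fsplitK; congr fcons.
  have := vabs_fcons (fsplit k); rewrite fsplitK k0 => h.
  rewrite [RHS]surjective_pairing; congr pair.
  by apply/eqP; rewrite eq_sym -addr_eq0; apply/eqP.
have E : onlevel q 0 F Z \o e = (fun k : {ffun 'I_r -> int} =>
    F (fun i => Z i * q ^ balance k i)).
  apply/funext => k /=; rewrite /onlevel e0 eqxx; congr F; apply/funext => i.
  by rewrite /e /balance /fcons /ptcons ffunE.
split; first by rewrite -E; apply: summable_comp Fs; apply: pcan_inj ge.
rewrite -E; apply: has_sum_reindex ge eg _ hs => k.
by rewrite /g /onlevel; case: eqP.
Qed.

(** Since [z0 * q ^ (- |k|) - z i * q ^ k i] is [z0 * q ^ (- |k|)] times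
    [1 - z i / z0 * q ^ (k i + |k|)], the second product supplies the Vandermonde factors of the
    adjoined coordinate. *)
Lemma vdm_balance r (z0 : C) (z : 'I_r -> C) (k : 'I_r -> int) : z0 != 0 ->
  (forall i, z0 - z i != 0) ->
  \prod_(i < r) \prod_(j < r | (i < j)%N) ((z i * q ^ k i - z j * q ^ k j) / (z i - z j)) *
  \prod_(i < r) ((1 - z i / z0 * q ^ (k i + vabs k)) / (1 - z i / z0)) =
  (q ^ vabs k) ^+ r * (vdm (fun i => ptcons z0 z i * q ^ balance k i) / vdm (ptcons z0 z)).
Proof.
move=> z00 zz; rewrite !vdm_recl.
have -> : vdm (fun i => ptcons z0 z (lift ord0 i)) = vdm z.
  by congr vdm; apply/funext => i; rewrite ptconsS.
have -> : vdm (fun i => ptcons z0 z (lift ord0 i) * q ^ balance k (lift ord0 i)) =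
    vdm (fun i => z i * q ^ k i).
  by congr vdm; apply/funext => i; rewrite /balance !ptconsS.
have -> : \prod_(i < r) \prod_(j < r | (i < j)%N) ((z i * q ^ k i - z j * q ^ k j) / (z i - z j)) =
    vdm (fun i => z i * q ^ k i) / vdm z.
  rewrite /vdm -prodfV -big_split; apply: eq_bigr => i _ /=.
  by rewrite -prodfV -big_split.
have -> : \prod_(i < r) ((1 - z i / z0 * q ^ (k i + vabs k)) / (1 - z i / z0)) =
    (q ^ vabs k) ^+ r * (\prod_(i < r) (ptcons z0 z ord0 * q ^ balance k ord0 -
      ptcons z0 z (lift ord0 i) * q ^ balance k (lift ord0 i)) /
    \prod_(i < r) (ptcons z0 z ord0 - ptcons z0 z (lift ord0 i))).
  have -> : (q ^ vabs k) ^+ r = \prod_(i < r) q ^ vabs k by rewrite prodr_const card_ord.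
  rewrite -prodfV -!big_split.
  apply: eq_bigr => i _ /=; rewrite /balance !ptcons0 !ptconsS -invr_expz expfzDr//.
  have qk : q ^ vabs k != 0 by rewrite expfz_neq0.
  by field; rewrite qk z00 zz.
by rewrite mulrCA; congr (_ * _); rewrite mulrC -mulf_div.
Qed.

(** The bases of paired factorials in f and g differ by one factor [q], so their infinite products
    leave only [1 - y]; these remainders make up [linear_factors]. *)
Lemma qpoch_quotient y s t m u : qinf q (y * q) != 0 -> m = 1 + t - s -> u = y * q ^ s ->
  qpoch q y s / qpoch q (y * q) t = (1 - y) * qratio q m u.
Proof.
move=> yq -> ->; rewrite /qpoch /qratio (qinf_recl q1 y).
have -> : y * q ^ s * q ^ (1 + t - s) = y * q * q ^ t.
  rewrite -!mulrA -expfzDr//; congr (_ * _).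
  by rewrite -{2}[q]expr1z -expfzDr//; congr (q ^ _); ring.
rewrite invf_div -!mulrA; congr (_ * _).
by rewrite mulrC -!mulrA mulVf// mulr1 mulrC.
Qed.

Lemma theta_qinf_neq0 y : theta y != 0 -> qinf q (y * q) != 0.
Proof. by rewrite (theta_split q1) !mulf_eq0 !negb_or [y * q]mulrC => /and3P[]. Qed.

(** For pairs in which the product of nodes appears inverted: quasiperiodicity of theta turns the
    ratio in [q / u] into one in [u], at the cost of a monomial. *)
Lemma qpoch_quotient_inv y s t m u :
  y != 0 -> theta y != 0 -> m = 1 + t - s -> u = (y * q ^ t)^-1 ->
  qpoch q y s / qpoch q (y * q) t = (1 - y) * (theta_factor q m * u ^ m * qratio q m u).
Proof.
move=> y0 thy mE uE.
have u0 : u != 0 by rewrite uE invr_eq0 mulf_neq0// expfz_neq0.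
have thu : theta u != 0.
  rewrite uE (theta_inv q1) ?mulf_neq0 ?expfz_neq0// oppr_eq0 mulf_neq0//.
    exact: theta_expz_neq0.
  by rewrite invr_eq0 mulf_neq0// expfz_neq0.
rewrite (qpoch_quotient (theta_qinf_neq0 thy) mE erefl); congr (_ * _).
have := theta_quasiperiodic q0 q1 m u0; rewrite {1}thetaE => h.
have qu : q / u = y * q ^ s * q ^ m.
  rewrite uE invrK mE -!mulrA -expfzDr//; rewrite [RHS](_ : _ = y * (q ^ (1 + t))).
    by rewrite expfzDr// expr1z; ring.
  by congr (_ * q ^ _); ring.
have qum : q / (u * q ^ m) = y * q ^ s.
  have qm : q ^ m != 0 by rewrite expfz_neq0.
  by rewrite invfM mulrA qu; apply: (mulfK qm).
have thum := theta_expz_neq0 q0 q1 m u0 thu.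
move: (thu) (thum); rewrite !mulf_eq0 !negb_or => /andP[h1 h2] /andP[h3 h4].
rewrite /qratio -qu -qum.
have -> : qinf q (q / u) = theta_factor q m * u ^ m * theta (u * q ^ m) / qinf q u.
  by rewrite -h mulrAC divff// mul1r.
by rewrite !thetaE; field; rewrite h1 h4.
Qed.

Lemma prod_exprz n (u : 'I_n -> C) (z : C) (m : 'I_n -> int) : z != 0 ->
  \prod_i (u i * z) ^ m i = \prod_i u i ^ m i * z ^ vabs m.
Proof.
move=> z0; have -> : z ^ vabs m = \prod_i z ^ m i.
  rewrite /vabs; elim/big_rec2: _ => // i y1 y2 _ <-.
  by rewrite expfzDr.
by rewrite -big_split; apply: eq_bigr => i _; rewrite expfzMl.
Qed.

End Matching.

Section Matching.
Variables (R : realType) (q : R[i]).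
Hypotheses (q0 : q != 0) (q1 : `|q| < 1).
Local Notation C := R[i].
Local Notation theta := (theta q).
Local Notation qratio := (qratio q).
Local Notation qpoch := (qpoch q).
Variables (r : nat) (a b : C) (c x : 'I_r -> C).
Hypotheses (a0 : a != 0) (b0 : b != 0) (c0 : forall i, c i != 0) (x0 : forall i, x i != 0).

Definition xnodes := ptcons a^-1 x.
Definition ynodes := ptcons (a / b) (fun i => c i / x i).

Hypotheses (thb : theta b != 0) (thcx : forall i j, theta (c j * x i / x j) != 0)
  (thab : forall i, theta (a * x i / b) != 0) (thac : forall i, theta (a * x i / c i) != 0)
  (thX : forall i j, i != j -> theta (xnodes i / xnodes j) != 0)
  (thY : forall i j, i != j -> theta (ynodes i / ynodes j) != 0).

Lemma xnodes_neq0 i : xnodes i != 0.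
Proof.
rewrite /xnodes; case: (unliftP ord0 i) => [j ->|->].
  by rewrite ptconsS.
by rewrite ptcons0 invr_eq0.
Qed.

Lemma ynodes_neq0 i : ynodes i != 0.
Proof.
rewrite /ynodes; case: (unliftP ord0 i) => [j ->|->].
  by rewrite ptconsS mulf_neq0// invr_eq0.
by rewrite ptcons0 mulf_neq0// invr_eq0.
Qed.

Lemma theta_inv_neq0 u : u != 0 -> theta u != 0 -> theta u^-1 != 0.
Proof. by move=> u0 thu; rewrite (theta_inv q1)// oppr_eq0 mulf_neq0// invr_eq0. Qed.

Lemma theta_nodes_neq0 i j : theta (ynodes j * xnodes i) != 0.
Proof.
rewrite /xnodes /ynodes; case: (unliftP ord0 i) => [i' ->|->]; case: (unliftP ord0 j) => [j' ->|->].
- by rewrite !ptconsS mulrAC.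
- by rewrite ptcons0 ptconsS mulrAC.
- rewrite ptcons0 ptconsS (_ : _ * a^-1 = (a * x j' / c j')^-1).
    by rewrite theta_inv_neq0// !mulf_neq0// invr_eq0.
  by field; rewrite a0 c0 x0.
- rewrite !ptcons0 (_ : _ * a^-1 = b^-1); last by field; rewrite a0 b0.
  exact: theta_inv_neq0.
Qed.

Definition linear_factors : C := (1 - b) * (\prod_(i < r) \prod_(j < r) (1 - c j * x i / x j)) *
  (\prod_(i < r) (1 - a * x i / b)) * \prod_(i < r) (1 - a * x i / c i).

Let regroup (p v1 v2 B1 P1 S1 v3 v4 B2 P2 S2 z : C) :
  p * v1 * v2 * B1 * P1 * S1 * (v3 * v4 * B2 * P2 * S2 * z) =
  p * (v1 * v2) * (v3 * v4) * (B1 * B2) * (P1 * P2) * (S1 * S2) * z.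
Proof. by ring. Qed.

Let regroup' (p v1 v2 B1 P1 S1 v3 v4 B2 P2 S2 z : C) :
  v1 * v2 * B1 * P1 * S1 * z * (p * v3 * v4 * B2 * P2 * S2) =
  p * (v1 * v2) * (v3 * v4) * (B2 * B1) * (P1 * P2) * (S1 * S2) * z.
Proof. by ring. Qed.

Lemma vabs_level (n l : 'I_r -> int) :
  vabs (fun j => 1 + balance n j - balance l j) = r.+1%:Z.
Proof.
rewrite /vabs sumrB big_split/= -[\sum_i balance n i]/(vabs _) -[\sum_i balance l i]/(vabs _).
by rewrite !vabs_balance subr0 addr0 sumr_const card_ord pmulrn intz.
Qed.

Let xnodes_sub i : a^-1 - x i != 0.
Proof.
have := theta_div_inj q1 xnodes_neq0 thX => inj; rewrite subr_eq0; apply/eqP => h.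
have : xnodes ord0 = xnodes (lift ord0 i) by rewrite /xnodes ptcons0 ptconsS.
by move=> /inj/eqP; rewrite (negbTE (neq_lift _ _)).
Qed.

Let ynodes_sub i : a / b - c i / x i != 0.
Proof.
have := theta_div_inj q1 ynodes_neq0 thY => inj; rewrite subr_eq0; apply/eqP => h.
have : ynodes ord0 = ynodes (lift ord0 i) by rewrite /ynodes ptcons0 ptconsS.
by move=> /inj/eqP; rewrite (negbTE (neq_lift _ _)).
Qed.

Lemma vdm_xnodes (k : 'I_r -> int) :
  \prod_(i < r) \prod_(j < r | (i < j)%N) ((x i * q ^ k i - x j * q ^ k j) / (x i - x j)) *
  \prod_(i < r) ((1 - a * x i * q ^ (k i + vabs k)) / (1 - a * x i)) =
  (q ^ vabs k) ^+ r * (vdm (fun i => xnodes i * q ^ balance k i) / vdm xnodes).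
Proof.
rewrite -vdm_balance ?invr_eq0//; congr (_ * _); apply: eq_bigr => i _.
by rewrite invrK [x i * a]mulrC.
Qed.

Lemma vdm_ynodes (k : 'I_r -> int) :
  \prod_(i < r) \prod_(j < r | (i < j)%N)
    ((c i * q ^ k i / x i - c j * q ^ k j / x j) / (c i / x i - c j / x j)) *
  \prod_(i < r) ((1 - b * c i * q ^ (k i + vabs k) / (a * x i)) / (1 - b * c i / (a * x i))) =
  (q ^ vabs k) ^+ r * (vdm (fun i => ynodes i * q ^ balance k i) / vdm ynodes).
Proof.
rewrite -vdm_balance ?mulf_neq0 ?invr_eq0//; congr (_ * _); apply: eq_bigr => i _.
  by apply: eq_bigr => j _; rewrite [c i / x i * _]mulrAC [c j / x j * _]mulrAC.
have -> : c i / x i / (a / b) = b * c i / (a * x i) by field; rewrite a0 b0 x0.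
by rewrite [b * c i / _ * _]mulrAC.
Qed.

Section FirstSum.
Variables (n l k : 'I_r -> int).
Let m j := 1 + balance n j - balance l j.
Let A j := ynodes j * q ^ balance l j.
Let w i := xnodes i * q ^ balance k i.
Let f i j := qratio (m j) (A j * w i).

Let qz j : q ^ (j : int) != 0. Proof. by rewrite expfz_neq0. Qed.

Definition fg_factor : C := fpre q a b c x *
  ((q ^ vabs n) ^+ r * (vdm (fun j => ynodes j * q ^ balance n j) / vdm ynodes)) / vdm xnodes *
  linear_factors * (\prod_j (theta_factor q (m j) * (A j / a) ^ m j)) * (q ^ (r%:Z * vabs l))^-1.

(** Each ratio in [lattice_term] comes from one factorial of f and one of g. The pairs that involve
    the node [a^-1] are those that need inversion. *)
Lemma fmat_gmat : fmat q a b c x n k * gmat q a b c x k l = fg_factor * lattice_term q A m w.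
Proof.
have E3 : qpoch b (vabs n + vabs k) * (qpoch (b * q) (vabs k + vabs l))^-1 =
    (1 - b) * (theta_factor q (m ord0) * (A ord0 * w ord0) ^ m ord0 * f ord0 ord0).
  apply: qpoch_quotient_inv => //; first by rewrite /m !balance0; ring.
  rewrite /A /w /xnodes /ynodes !balance0 !ptcons0 expfzDr// -!invr_expz.
  by field; rewrite a0 b0 !qz.
have E4 : \prod_(i < r) \prod_(j < r) (qpoch (q * c j * x i / x j) (n j + k i))^-1 *
    \prod_(i < r) \prod_(j < r) qpoch (c j * x i / x j) (k i + l j) =
    \prod_(i < r) \prod_(j < r) (1 - c j * x i / x j) *
    \prod_(i < r) \prod_(j < r) f (lift ord0 i) (lift ord0 j).
  rewrite -!big_split; apply: eq_bigr => i _; rewrite -!big_split; apply: eq_bigr => j _ /=.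
  rewrite mulrC (_ : q * c j * x i / x j = c j * x i / x j * q); last by ring.
  apply: qpoch_quotient => //; first exact: theta_qinf_neq0.
    by rewrite /m !balanceS; ring.
  by rewrite /A /w /xnodes /ynodes !balanceS !ptconsS expfzDr//; ring.
have E5 : \prod_(i < r) (qpoch (a * x i / c i) (vabs k - n i) / qpoch (a * x i * q / b) (k i - vabs n)) *
    \prod_(i < r) (qpoch (a * x i / b) (k i - vabs l) / qpoch (a * x i * q / c i) (vabs k - l i)) =
    \prod_(i < r) (1 - a * x i / b) * \prod_(i < r) (1 - a * x i / c i) *
    (\prod_(i < r) (theta_factor q (m (lift ord0 i)) * (A (lift ord0 i) * w ord0) ^ m (lift ord0 i)) *
    \prod_(i < r) (f ord0 (lift ord0 i) * f (lift ord0 i) ord0)).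
  rewrite -!big_split; apply: eq_bigr => i _ /=.
  have e1 : qpoch (a * x i / c i) (vabs k - n i) / qpoch (a * x i * q / c i) (vabs k - l i) =
      (1 - a * x i / c i) * (theta_factor q (m (lift ord0 i)) *
        (A (lift ord0 i) * w ord0) ^ m (lift ord0 i) * f ord0 (lift ord0 i)).
    rewrite [a * x i * q / c i]mulrAC; apply: qpoch_quotient_inv => //.
    - by rewrite !mulf_neq0// invr_eq0.
    - by rewrite /m !balanceS; ring.
    - rewrite /A /w /xnodes /ynodes balanceS balance0 ptconsS ptcons0 expfzDr// -!invr_expz.
      by field; rewrite a0 c0 x0 !qz.
  have e2 : qpoch (a * x i / b) (k i - vabs l) / qpoch (a * x i * q / b) (k i - vabs n) =
      (1 - a * x i / b) * f (lift ord0 i) ord0.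
    rewrite [a * x i * q / b]mulrAC; apply: qpoch_quotient => //; first exact: theta_qinf_neq0.
      by rewrite /m !balance0; ring.
    by rewrite /A /w /xnodes /ynodes balanceS balance0 ptconsS ptcons0 expfzDr//; ring.
  transitivity ((qpoch (a * x i / c i) (vabs k - n i) / qpoch (a * x i * q / c i) (vabs k - l i)) *
    (qpoch (a * x i / b) (k i - vabs l) / qpoch (a * x i * q / b) (k i - vabs n))); first by ring.
  by rewrite e1 e2; ring.
(* The inversions produce [q ^ (- |k|)] with total exponent [r+1], the sum of the [m j]. *)
have E6 : \prod_j (theta_factor q (m j) * (A j * w ord0) ^ m j) =
    \prod_j (theta_factor q (m j) * (A j / a) ^ m j) * ((q ^ vabs k)^-1) ^+ r.+1.
  have -> : \prod_j (theta_factor q (m j) * (A j * w ord0) ^ m j) =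
      \prod_j theta_factor q (m j) * \prod_j (A j / a * (q ^ vabs k)^-1) ^ m j.
    rewrite -big_split; apply: eq_bigr => j _ /=.
    by rewrite /w /xnodes ptcons0 balance0 -invr_expz mulrA.
  rewrite prod_exprz ?invr_eq0// mulrA -big_split; congr (_ * _).
  by have -> // : vabs m = r.+1%:Z by exact: vabs_level.
rewrite big_ord_recl in E6.
have Ef := vdm_ynodes n; have Eg := vdm_xnodes k.
rewrite /lattice_term (big2_lift ord0 f) /fmat /gmat regroup Ef Eg E3 E4 E5.
have -> : q ^ (vabs k - r%:Z * vabs l) = q ^ vabs k * (q ^ (r%:Z * vabs l))^-1.
  by rewrite expfzDr// -invr_expz.
rewrite /fg_factor /linear_factors -/w.
set T := \prod_(i < r) (theta_factor q _ * _) in E6 *; move: E6.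
set T0 := theta_factor q _ * _; set T1 := \prod_j (theta_factor q _ * _); move=> E6.
(* These powers cancel against [r] from the Vandermonde quotient and one from the weight in
   [gmat]. *)
have qK : (q ^ vabs k) ^+ r * (q ^ vabs k)^-1 ^+ r.+1 * q ^ vabs k = 1.
  by rewrite exprVn exprS; field; rewrite qz expf_neq0.
set Ff := \prod_i \prod_i' f _ _; set F0 := \prod_i (f _ _ * _).
set D := \prod_i \prod_j (1 - _); set D1 := \prod_i (1 - _ / b); set D2 := \prod_i (1 - _ / c _).
set vw := vdm w; set vn := vdm (fun j => ynodes j * _).
transitivity (fpre q a b c x * ((q ^ vabs n) ^+ r * (vn / vdm ynodes)) * (vw / vdm xnodes) *
  ((1 - b) * D * D1 * D2) * (f ord0 ord0 * F0 * Ff) * (T0 * T) * (q ^ (r%:Z * vabs l))^-1 *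
  ((q ^ vabs k) ^+ r * q ^ vabs k)); first by ring.
rewrite E6 -[RHS]mulr1 -qK; ring.
Qed.

End FirstSum.
Section SecondSum.
Variables (n l k : 'I_r -> int).
Let m j := 1 + balance l j - balance n j.
Let A j := xnodes j * q ^ balance n j.
Let w i := ynodes i * q ^ balance k i.
Let f i j := qratio (m j) (A j * w i).

Let qz j : q ^ (j : int) != 0. Proof. by rewrite expfz_neq0. Qed.

Definition gf_factor : C := fpre q a b c x *
  ((q ^ vabs n) ^+ r * (vdm (fun j => xnodes j * q ^ balance n j) / vdm xnodes)) / vdm ynodes *
  linear_factors * (\prod_i (theta_factor q (m ord0) * (A ord0 * ynodes i) ^ m ord0)) * q ^ vabs n.

Lemma gmat_fmat : gmat q a b c x n k * fmat q a b c x k l = gf_factor * lattice_term q A m w.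
Proof.
have E3 : qpoch b (vabs k + vabs l) * (qpoch (b * q) (vabs n + vabs k))^-1 =
    (1 - b) * (theta_factor q (m ord0) * (A ord0 * w ord0) ^ m ord0 * f ord0 ord0).
  apply: qpoch_quotient_inv => //; first by rewrite /m !balance0; ring.
  rewrite /A /w /xnodes /ynodes !balance0 !ptcons0 expfzDr// -!invr_expz.
  by field; rewrite a0 b0 !qz.
have E4 : \prod_(i < r) \prod_(j < r) qpoch (c j * x i / x j) (n i + k j) *
    \prod_(i < r) \prod_(j < r) (qpoch (q * c j * x i / x j) (k j + l i))^-1 =
    \prod_(i < r) \prod_(j < r) (1 - c j * x i / x j) *
    \prod_(i < r) \prod_(j < r) f (lift ord0 i) (lift ord0 j).
  rewrite [X in _ = _ * X]exchange_big/=.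
  rewrite -!big_split; apply: eq_bigr => i _; rewrite -!big_split; apply: eq_bigr => j _ /=.
  rewrite (_ : q * c j * x i / x j = c j * x i / x j * q); last by ring.
  apply: qpoch_quotient => //; first exact: theta_qinf_neq0.
    by rewrite /m !balanceS; ring.
  by rewrite /A /w /xnodes /ynodes !balanceS !ptconsS expfzDr//; ring.
have E5 : \prod_(i < r) (qpoch (a * x i / b) (n i - vabs k) / qpoch (a * x i * q / c i) (vabs n - k i)) *
    \prod_(i < r) (qpoch (a * x i / c i) (vabs l - k i) / qpoch (a * x i * q / b) (l i - vabs k)) =
    \prod_(i < r) (1 - a * x i / b) * \prod_(i < r) (1 - a * x i / c i) *
    (\prod_(i < r) (theta_factor q (m ord0) * (A ord0 * w (lift ord0 i)) ^ m ord0) *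
    \prod_(i < r) (f ord0 (lift ord0 i) * f (lift ord0 i) ord0)).
  rewrite -!big_split; apply: eq_bigr => i _ /=.
  have e1 : qpoch (a * x i / c i) (vabs l - k i) / qpoch (a * x i * q / c i) (vabs n - k i) =
      (1 - a * x i / c i) * (theta_factor q (m ord0) *
        (A ord0 * w (lift ord0 i)) ^ m ord0 * f (lift ord0 i) ord0).
    rewrite [a * x i * q / c i]mulrAC; apply: qpoch_quotient_inv => //.
    - by rewrite !mulf_neq0// invr_eq0.
    - by rewrite /m !balance0; ring.
    - rewrite /A /w /xnodes /ynodes balanceS balance0 ptconsS ptcons0 expfzDr// -!invr_expz.
      by field; rewrite a0 c0 x0 !qz.
  have e2 : qpoch (a * x i / b) (n i - vabs k) / qpoch (a * x i * q / b) (l i - vabs k) =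
      (1 - a * x i / b) * f ord0 (lift ord0 i).
    rewrite [a * x i * q / b]mulrAC; apply: qpoch_quotient => //; first exact: theta_qinf_neq0.
      by rewrite /m !balanceS; ring.
    by rewrite /A /w /xnodes /ynodes balanceS balance0 ptconsS ptcons0 expfzDr//; ring.
  transitivity ((qpoch (a * x i / c i) (vabs l - k i) / qpoch (a * x i * q / c i) (vabs n - k i)) *
    (qpoch (a * x i / b) (n i - vabs k) / qpoch (a * x i * q / b) (l i - vabs k))); first by ring.
  by rewrite e1 e2; ring.
(* Here all monomials have the exponent [m ord0], and the powers of [q] in the [w i] multiply to 1
   since [balance k] has total 0. *)
have E6 : \prod_i (theta_factor q (m ord0) * (A ord0 * w i) ^ m ord0) =
    \prod_i (theta_factor q (m ord0) * (A ord0 * ynodes i) ^ m ord0).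
  have prodz (u : 'I_r.+1 -> int) : \prod_i (q ^ u i) ^ m ord0 = (q ^ vabs u) ^ m ord0.
    rewrite /vabs; elim/big_rec2: _ => [|i y1 y2 _ ->]; first by rewrite expr0z exp1rz.
    by rewrite [q ^ (_ + _)]expfzDr// expfzMl.
  transitivity (\prod_i (theta_factor q (m ord0) * (A ord0 * ynodes i) ^ m ord0) *
      \prod_i (q ^ balance k i) ^ m ord0).
    rewrite -big_split; apply: eq_bigr => i _ /=.
    by rewrite -[RHS]mulrA -expfzMl /w mulrA.
  by rewrite prodz vabs_balance expr0z exp1rz mulr1.
rewrite big_ord_recl in E6.
have Ef := vdm_ynodes k; have Eg := vdm_xnodes n.
rewrite /lattice_term (big2_lift ord0 f) /fmat /gmat regroup' Ef Eg E3 E4 E5.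
have -> : q ^ (vabs n - r%:Z * vabs k) = q ^ vabs n * ((q ^ vabs k) ^+ r)^-1.
  by rewrite expfzDr// -invr_expz; congr (_ / _); rewrite exprnP exprz_exp mulrC.
rewrite /gf_factor /linear_factors -/w.
set T := \prod_(i < r) (theta_factor q _ * _) in E6 *; move: E6.
set T0 := theta_factor q _ * _; set T1 := \prod_j (theta_factor q _ * _); move=> E6.
(* The Vandermonde quotient in [k] now comes from [fmat]; its power of [q] is cancelled by the
   weight [- r * |k|] in [gmat]. *)
have qK : (q ^ vabs k) ^+ r * ((q ^ vabs k) ^+ r)^-1 = 1 by rewrite mulfV// expf_neq0.
set Ff := \prod_i \prod_i' f _ _; set F0 := \prod_i (f _ _ * _).
set D := \prod_i \prod_j (1 - _); set D1 := \prod_i (1 - _ / b); set D2 := \prod_i (1 - _ / c _).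
set vw := vdm w; set vn := vdm (fun j => xnodes j * _).
transitivity (fpre q a b c x * ((q ^ vabs n) ^+ r * (vn / vdm xnodes)) * (vw / vdm ynodes) *
  ((1 - b) * D * D1 * D2) * (f ord0 ord0 * F0 * Ff) * (T0 * T) * q ^ vabs n *
  ((q ^ vabs k) ^+ r * ((q ^ vabs k) ^+ r)^-1)); first by ring.
by rewrite E6 qK; ring.
Qed.

End SecondSum.

End Matching.

(** * The normalizing constant *)

Section Normalization.
Variables (R : realType) (q : R[i]).
Hypotheses (q0 : q != 0) (q1 : `|q| < 1).
Local Notation C := R[i].
Local Notation theta := (theta q).
Variables (r : nat) (a b : C) (c x : 'I_r -> C).
Hypotheses (a0 : a != 0) (b0 : b != 0) (c0 : forall i, c i != 0) (x0 : forall i, x i != 0).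
Local Notation X := (xnodes a x).
Local Notation Y := (ynodes a b c x).
Hypotheses (thb : theta b != 0) (thcx : forall i j, theta (c j * x i / x j) != 0)
  (thab : forall i, theta (a * x i / b) != 0) (thac : forall i, theta (a * x i / c i) != 0)
  (thX : forall i j, i != j -> theta (X i / X j) != 0)
  (thY : forall i j, i != j -> theta (Y i / Y j) != 0)
  (qC : qinf q (b * q / \prod_i c i) != 0) (qC' : qinf q ((\prod_i c i) * q / b) != 0).

Let prod_qinf_neq0 (W : 'I_r.+1 -> C) : (forall i, W i != 0) ->
  (forall i j, i != j -> theta (W i / W j) != 0) ->
  \prod_i \prod_j qinf q (q * W i / W j) != 0.
Proof.
move=> W0 thW; apply/prodf_neq0 => i _; apply/prodf_neq0 => j _.
have [->|/thW] := eqVneq i j; first by rewrite mulfK// qinf_q_neq0.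
by rewrite (theta_split q1) !mulf_eq0 !negb_or mulrA => /and3P[].
Qed.

(** Singling out the adjoined index splits each product over [r+1] nodes into blocks, which are the
    products occurring in [fpre] and [linear_factors]. *)
Lemma normalization :
  fpre q a b c x * linear_factors a b c x * (\prod_j - (Y j / a)) *
  thskip q 0 (\prod_i Y i * \prod_i X i) *
  ((qinf q q ^+ 2)^-1 * (\prod_i \prod_j qinf q (q * Y i / Y j)) *
  (\prod_i \prod_j qinf q (q * X i / X j)) / \prod_i \prod_j theta (Y j * X i)) = 1.
Proof.
have Y0 := ynodes_neq0 a0 b0 c0 x0; have X0 := xnodes_neq0 a0 x0.
have EY : \prod_i \prod_j qinf q (q * Y i / Y j) = qinf q q *
    (\prod_i qinf q (a * x i * q / (b * c i)) * \prod_i qinf q (b * c i * q / (a * x i))) *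
    \prod_i \prod_j qinf q (q * c j * x i / (c i * x j)).
  rewrite (big2_lift ord0 (fun i j => qinf q (q * Y i / Y j))) mulfK//; congr (_ * _ * _).
    rewrite -big_split; apply: eq_bigr => i _ /=; rewrite /ynodes ptcons0 ptconsS.
    by congr (qinf _ _ * qinf _ _); field; rewrite ?a0 ?b0 ?c0 ?x0.
  rewrite exchange_big/=; apply: eq_bigr => i _; apply: eq_bigr => j _; rewrite /ynodes !ptconsS.
  by congr (qinf _ _); field; rewrite ?c0 ?x0.
have EX : \prod_i \prod_j qinf q (q * X i / X j) = qinf q q *
    (\prod_i qinf q (a * x i * q) * \prod_i qinf q (q / (a * x i))) *
    \prod_i \prod_j qinf q (q * x i / x j).
  rewrite (big2_lift ord0 (fun i j => qinf q (q * X i / X j))) mulfK//; congr (_ * _ * _).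
    rewrite -big_split; apply: eq_bigr => i _ /=; rewrite /xnodes ptcons0 ptconsS mulrC.
    by congr (qinf _ _ * qinf _ _); field; rewrite ?a0 ?x0.
  by apply: eq_bigr => i _; apply: eq_bigr => j _; rewrite /xnodes !ptconsS.
have ET : \prod_i \prod_j theta (Y j * X i) =
    (1 - b^-1) * (qinf q (b * q) * qinf q (q / b)) *
    (\prod_i (1 - c i / (a * x i)) * (\prod_i qinf q (a * x i * q / c i) * \prod_i qinf q (c i * q / (a * x i))) *
    (\prod_i (1 - a * x i / b) * (\prod_i qinf q (a * x i * q / b) * \prod_i qinf q (b * q / (a * x i))))) *
    (\prod_(i < r) \prod_(j < r) (1 - c j * x i / x j) *
    (\prod_(i < r) \prod_(j < r) qinf q (q * c j * x i / x j) *
     \prod_(i < r) \prod_(j < r) qinf q (q * x i / (c i * x j)))).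
  rewrite (big2_lift ord0 (fun i j => theta (Y j * X i))); congr (_ * _ * _).
  - rewrite /xnodes /ynodes !ptcons0 (theta_split q1); congr (_ * _).
      by congr (1 - _); field; rewrite a0 b0.
    by rewrite mulrC; congr (qinf _ _ * qinf _ _); field; rewrite ?a0 ?b0.
  - rewrite -!big_split; apply: eq_bigr => i _ /=; rewrite /xnodes /ynodes !ptcons0 !ptconsS.
    rewrite !(theta_split q1); congr (_ * _ * (_ * _)).
    + by congr (1 - _); field; rewrite ?a0 ?x0.
    + by rewrite mulrC; congr (qinf _ _ * qinf _ _); field; rewrite ?a0 ?c0 ?x0.
    + by congr (1 - _); field; rewrite ?b0.
    + by congr (qinf _ _ * qinf _ _); field; rewrite ?a0 ?b0 ?x0.
  rewrite [X in _ = _ * (_ * X)]exchange_big/=.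
  rewrite -!big_split; apply: eq_bigr => i _; rewrite -!big_split; apply: eq_bigr => j _ /=.
  rewrite /xnodes /ynodes !ptconsS (theta_split q1); congr (_ * _).
    by congr (1 - _); field; rewrite ?x0.
  by congr (qinf _ _ * qinf _ _); field; rewrite ?c0 ?x0.
have EM : \prod_j - (Y j / a) = - b^-1 * \prod_i - (c i / (a * x i)).
  rewrite big_ord_recl /ynodes ptcons0; congr (_ * _); first by field; rewrite a0 b0.
  by apply: eq_bigr => i _; rewrite ptconsS; field; rewrite a0 x0.
(* The product of all nodes is [C / b]. Its theta function enters without the factor [1 - C / b], so
   the case [C = b] is covered. *)
have EU : thskip q 0 (\prod_i Y i * \prod_i X i) =
    qinf q ((\prod_i c i) * q / b) * qinf q (b * q / \prod_i c i).
  have C0 : \prod_i c i != 0 by apply/prodf_neq0.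
  have -> : \prod_i Y i * \prod_i X i = (\prod_i c i) / b.
    have xp : \prod_(i < r) x i != 0 by apply/prodf_neq0.
    rewrite !big_ord_recl /xnodes /ynodes !ptcons0.
    have -> : \prod_(i < r) ptcons (a / b) (fun i => c i / x i) (lift ord0 i) =
        \prod_i c i / \prod_i x i.
      by rewrite -prodfV -big_split; apply: eq_bigr => i _; rewrite ptconsS.
    have -> : \prod_(i < r) ptcons a^-1 x (lift ord0 i) = \prod_i x i.
      by apply: eq_bigr => i _; rewrite ptconsS.
    by field; rewrite a0 b0 xp.
  rewrite /= /qskip /poch big_ord0 mul1r expr1.
  by congr (qinf _ _ * qinf _ _); field; rewrite ?b0 ?C0.
have T0 : \prod_i \prod_j theta (Y j * X i) != 0.
  apply/prodf_neq0 => i _; apply/prodf_neq0 => j _; exact: theta_nodes_neq0.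
have PY := prod_qinf_neq0 Y0 thY; have PX := prod_qinf_neq0 X0 thX.
move: T0 PY PX; rewrite EY EX ET EM EU /fpre /linear_factors/=.
have -> : \prod_(i < r) \prod_(j < r)
    ((qinf q (q * c j * x i / x j) * qinf q (q * x i / (c i * x j))) /
     (qinf q (q * c j * x i / (c i * x j)) * qinf q (q * x i / x j))) =
    (\prod_(i < r) \prod_(j < r) qinf q (q * c j * x i / x j) *
     \prod_(i < r) \prod_(j < r) qinf q (q * x i / (c i * x j))) /
    (\prod_i \prod_j qinf q (q * c j * x i / (c i * x j)) * \prod_i \prod_j qinf q (q * x i / x j)).
  rewrite -!big_split -prodfV -big_split; apply: eq_bigr => i _ /=.
  by rewrite -!big_split -prodfV -big_split.
have -> : \prod_(i < r)
    ((qinf q (a * x i * q / b) * qinf q (b * q / (a * x i)) * qinf q (a * x i * q / c i)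
      * qinf q (c i * q / (a * x i))) /
     (qinf q (a * x i * q / (b * c i)) * qinf q (b * c i * q / (a * x i))
      * qinf q (a * x i * q) * qinf q (q / (a * x i)))) =
    (\prod_i qinf q (a * x i * q / b) * \prod_i qinf q (b * q / (a * x i)) *
     \prod_i qinf q (a * x i * q / c i) * \prod_i qinf q (c i * q / (a * x i))) /
    (\prod_i qinf q (a * x i * q / (b * c i)) * \prod_i qinf q (b * c i * q / (a * x i)) *
     \prod_i qinf q (a * x i * q) * \prod_i qinf q (q / (a * x i))).
  by rewrite -!big_split -prodfV -big_split.
have e : \prod_(i < r) (1 - a * x i / c i) * \prod_i - (c i / (a * x i)) =
    \prod_i (1 - c i / (a * x i)).
  by rewrite -big_split; apply: eq_bigr => i _ /=; field; rewrite a0 c0 x0.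
have -> : 1 - b^-1 = (1 - b) * - b^-1 by field.
rewrite -e; move: qC qC'.
set C1 := qinf q (b * q / _); set C2 := qinf q (_ * q / b).
set P1 := \prod_(i < r) \prod_(j < r) qinf q (q * c j * x i / x j).
set P2 := \prod_(i < r) \prod_(j < r) qinf q (q * x i / (c i * x j)).
set P3 := \prod_(i < r) \prod_(j < r) qinf q (q * c j * x i / (c i * x j)).
set P4 := \prod_(i < r) \prod_(j < r) qinf q (q * x i / x j).
set P5 := \prod_(i < r) \prod_(j < r) (1 - c j * x i / x j).
set s1 := \prod_i qinf q (a * x i * q / b); set s2 := \prod_i qinf q (b * q / (a * x i)).
set s3 := \prod_i qinf q (a * x i * q / c i); set s4 := \prod_i qinf q (c i * q / (a * x i)).
set t1 := \prod_i qinf q (a * x i * q / (b * c i)).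
set t2 := \prod_i qinf q (b * c i * q / (a * x i)).
set t3 := \prod_i qinf q (a * x i * q); set t4 := \prod_i qinf q (q / (a * x i)).
set l1 := \prod_i (1 - a * x i / b); set l2 := \prod_i (1 - a * x i / c i).
set l3 := \prod_i - (c i / (a * x i)).
set B1 := qinf q (b * q); set B2 := qinf q (q / b); set Q := qinf q q; set b1 := 1 - b.
move: C1 C2 P1 P2 P3 P4 P5 s1 s2 s3 s4 t1 t2 t3 t4 l1 l2 l3 B1 B2 Q b1 => C1 C2 P1 P2 P3 P4 P5.
move=> s1 s2 s3 s4 t1 t2 t3 t4 l1 l2 l3 B1 B2 Q b1 C10 C20.
(* The nonvanishing of the three double products is split into that of their blocks, to provide the
   side conditions of [field]. *)
rewrite !mulf_eq0 !oppr_eq0 !invr_eq0 !negb_or -!andbA.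
do 15?[case/andP => ?]; move=> ?.
do 3?[case/andP => ?]; move=> ?.
do 3?[case/andP => ?]; move=> ?.
field.
by do ?[apply/andP; split].
Qed.
Let theta_factor1 : theta_factor q 1 = -1.
Proof. by rewrite /= big_ord1 expr0. Qed.

Let prod_balance (k : 'I_r -> int) : \prod_i q ^ balance k i = 1.
Proof.
rewrite -[RHS](expr0z q) -(vabs_balance k) /vabs.
by elim/big_rec2: _ => // i y1 y2 _ ->; rewrite expfzDr.
Qed.

Let xinj (k : 'I_r -> int) : injective (fun i => X i * q ^ balance k i).
Proof.
have X0 := xnodes_neq0 a0 x0.
apply: (theta_div_inj q1) => [i|i j ij]; last exact: theta_shift_ratio.
by rewrite mulf_neq0// expfz_neq0.
Qed.

Let yinj (k : 'I_r -> int) : injective (fun i => Y i * q ^ balance k i).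
Proof.
have Y0 := ynodes_neq0 a0 b0 c0 x0.
apply: (theta_div_inj q1) => [i|i j ij]; last exact: theta_shift_ratio.
by rewrite mulf_neq0// expfz_neq0.
Qed.

Let xvdm : vdm X != 0.
Proof. exact: vdm_neq0 (theta_div_inj q1 (xnodes_neq0 a0 x0) thX). Qed.

Let yvdm : vdm Y != 0.
Proof. exact: vdm_neq0 (theta_div_inj q1 (ynodes_neq0 a0 b0 c0 x0) thY). Qed.

(** All [m j] are 1, the powers of [q] in the shifts multiply to 1, and the shifted Vandermonde
    product cancels; what remains no longer depends on [n]. *)
Lemma fg_factor_diag (n : 'I_r -> int) : fg_factor q a b c x n n *
  (vdm Y / vdm (fun j => Y j * q ^ balance n j) *
   (thskip q 0 (\prod_i Y i * \prod_i X i) * theta_cauchy q Y X)) = 1.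
Proof.
rewrite -[RHS]normalization /fg_factor /theta_cauchy.
have -> : \prod_j (theta_factor q (1 + balance n j - balance n j) *
    (Y j * q ^ balance n j / a) ^ (1 + balance n j - balance n j)) = \prod_j - (Y j / a).
  rewrite -[RHS]mulr1 -[X in _ = _ * X](prod_balance n) -big_split; apply: eq_bigr => j _ /=.
  by rewrite addrK theta_factor1 expr1z; ring.
have -> : q ^ (r%:Z * vabs n) = (q ^ vabs n) ^+ r by rewrite exprnP exprz_exp mulrC.
have := vdm_neq0 (yinj (k := n)); set vn := vdm (fun _ => _) => vn0.
have qn : (q ^ vabs n) ^+ r != 0 by rewrite expf_neq0// expfz_neq0.
move: (_ ^+ r) qn => z z0.
transitivity (fpre q a b c x * linear_factors a b c x * (\prod_j - (Y j / a)) *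
  thskip q 0 (\prod_i Y i * \prod_i X i) *
  ((qinf q q ^+ 2)^-1 * (\prod_i \prod_j qinf q (q * Y i / Y j)) *
  (\prod_i \prod_j qinf q (q * X i / X j)) / \prod_i \prod_j theta (Y j * X i)) *
  (z / z * (vn / vn) * (vdm Y / vdm Y) * (vdm X / vdm X))); first by ring.
by rewrite !divff// !mulr1.
Qed.

Lemma gf_factor_diag (n : 'I_r -> int) : gf_factor q a b c x n n *
  (vdm X / vdm (fun j => X j * q ^ balance n j) *
   (thskip q 0 (\prod_i X i * \prod_i Y i) * theta_cauchy q X Y)) = 1.
Proof.
rewrite -[RHS]normalization /gf_factor /theta_cauchy.
have -> : \prod_i (theta_factor q (1 + balance n ord0 - balance n ord0) *
    (X ord0 * q ^ balance n ord0 * Y i) ^ (1 + balance n ord0 - balance n ord0)) =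
    \prod_j - (Y j / a) * ((q ^ vabs n) ^+ r.+1)^-1.
  have -> : ((q ^ vabs n) ^+ r.+1)^-1 = \prod_(i < r.+1) (q ^ vabs n)^-1.
    by rewrite prodr_const card_ord exprVn.
  rewrite -big_split; apply: eq_bigr => j _ /=.
  rewrite addrK theta_factor1 expr1z balance0 /xnodes ptcons0 -invr_expz.
  by rewrite mulN1r mulNr [_ * Y j]mulrC mulrA.
rewrite (exchange_big _ _ _ _ _ (fun i j => theta (X j * Y i))).
have -> : \prod_j \prod_i theta (X j * Y i) = \prod_i \prod_j theta (Y j * X i).
  by apply: eq_bigr => i _; apply: eq_bigr => j _; rewrite mulrC.
have := vdm_neq0 (xinj (k := n)); set vn := vdm (fun _ => _) => vn0.
rewrite [\prod_i X i * _]mulrC exprS.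
have qn : q ^ vabs n != 0 by rewrite expfz_neq0.
move: (q ^ vabs n) qn => z z0; have zr : z ^+ r != 0 by rewrite expf_neq0.
move: (z ^+ r) zr => zr zr0; rewrite [(z * zr)^-1]invfM.
transitivity (fpre q a b c x * linear_factors a b c x * (\prod_j - (Y j / a)) *
  thskip q 0 (\prod_i Y i * \prod_i X i) *
  ((qinf q q ^+ 2)^-1 * (\prod_i \prod_j qinf q (q * Y i / Y j)) *
  (\prod_i \prod_j qinf q (q * X i / X j)) / \prod_i \prod_j theta (Y j * X i)) *
  (z / z * (zr / zr) * (vn / vn) * (vdm Y / vdm Y) * (vdm X / vdm X))); first by ring.
by rewrite !divff// !mulr1.
Qed.

End Normalization.

(** * Both inverse relations from sums over level zero *)

Theorem theorem3p1 (R : realType) (r : nat) (q a b : R[i]) (c x : 'I_r -> R[i]) :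
  (0 < r)%N -> 0 < `|q| < 1 -> generic q a b c x ->
  forall n l : 'I_r -> int,
    zsum_is (fun k => fmat q a b c x n k * gmat q a b c x k l) (kdelta R n l) /\
    zsum_is (fun k => gmat q a b c x n k * fmat q a b c x k l) (kdelta R n l).
Proof.
move=> r0 /andP[q0' q1] [[a0 [b0 [c0 x0]]] [[qC [qC' [gcx gax]]] [gsub [g1 [gb [gbq [gcxm gam]]]]]]] n l.
have q0 : q != 0 by rewrite -normr_gt0.
have thb : theta q b != 0 by apply: qinf_expz_theta_neq0.
have thcx i j : theta q (c j * x i / x j) != 0.
  apply: qinf_expz_theta_neq0 => //; first by rewrite !mulf_neq0// invr_eq0.
  by have [_] := gcxm i j.
have thab i : theta q (a * x i / b) != 0.
  apply: qinf_expz_theta_neq0 => //; first by rewrite !mulf_neq0// invr_eq0.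
  by have [_ [_ []]] := gam i.
have thac i : theta q (a * x i / c i) != 0.
  apply: qinf_expz_theta_neq0 => //; first by rewrite !mulf_neq0// invr_eq0.
  by have [] := gam i.
have X0 := xnodes_neq0 a0 x0; have Y0 := ynodes_neq0 a0 b0 c0 x0.
(* Inversion of theta reduces the conditions on ratios of nodes to the ratios by the adjoined node
   and those with [i < j]. *)
have th_sym (W : 'I_r.+1 -> R[i]) : (forall i, W i != 0) ->
    (forall i, theta q (W (lift ord0 i) / W ord0) != 0) ->
    (forall i j : 'I_r, (i < j)%N -> theta q (W (lift ord0 i) / W (lift ord0 j)) != 0) ->
    forall i j, i != j -> theta q (W i / W j) != 0.
  move=> W0 h1 h2.
  have inv i j : theta q (W i / W j) != 0 -> theta q (W j / W i) != 0.
    move=> h; rewrite -invf_div; apply: theta_inv_neq0 => //.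
    by rewrite mulf_neq0// invr_eq0.
  move=> i j; case: (unliftP ord0 i) => [i' ->|->]; case: (unliftP ord0 j) => [j' ->|->].
  - rewrite (inj_eq lift_inj) neq_ltn => /orP[|] ij; first exact: h2.
    by apply: inv; apply: h2.
  - by move=> _; apply: h1.
  - by move=> _; apply: inv; apply: h1.
  - by rewrite eqxx.
have qeq u v : qinf q u != 0 -> u = v -> qinf q v != 0 by move=> h <-.
(* The ratios are [a * x i] and [x i / x j]; [theta_split] turns their theta functions into a linear
   factor and two infinite products, all covered by genericity. *)
have thX i j : i != j -> theta q (xnodes a x i / xnodes a x j) != 0.
  apply: th_sym => {i j} [//|i|i j ij]; rewrite /xnodes !ptconsS ?ptcons0.
    have [_ [_ [h1 h2]]] := gax i; have [_ h3] := g1 i.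
    rewrite invrK mulrC (theta_split q1) !mulf_neq0//.
    by apply: qeq h1 _; ring.
  have [_ xij] := gsub i j ij; have [_ h1] := gcx i j; have [_ h2] := gcx j i.
  rewrite (theta_split q1) !mulf_neq0//.
  - by rewrite subr_eq0; apply: contra_neq xij => /esym/divr1_eq ->; rewrite subrr.
  - by apply: qeq h1 _; ring.
  - by apply: qeq h2 _; field; rewrite !x0.
have thY i j : i != j -> theta q (ynodes a b c x i / ynodes a b c x j) != 0.
  apply: th_sym => {i j} [//|i|i j ij]; rewrite /ynodes !ptconsS ?ptcons0.
    have [h1 [h2 _]] := gax i; have [h3 _] := g1 i.
    have -> : c i / x i / (a / b) = b * c i / (a * x i) by field; rewrite a0 b0 x0.
    rewrite (theta_split q1) !mulf_neq0//.
      by apply: qeq h2 _; field; rewrite a0 x0.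
    by apply: qeq h1 _; field; rewrite a0 b0 c0 x0.
  have [cij _] := gsub i j ij; have [h1 _] := gcx j i; have [h2 _] := gcx i j.
  rewrite (theta_split q1) !mulf_neq0//.
  - by rewrite subr_eq0; apply: contra_neq cij => /esym/divr1_eq ->; rewrite subrr.
  - by apply: qeq h1 _; field; rewrite !c0 !x0.
  - by apply: qeq h2 _; field; rewrite !c0 !x0.
have thYX := theta_nodes_neq0 q1 a0 b0 c0 x0 thb thcx thab thac.
have thXY i j : theta q (xnodes a x j * ynodes a b c x i) != 0 by rewrite mulrC.
have kd : kdelta R n l = if n == l then 1 else 0.
  rewrite /kdelta; case: forallP => [nl|nl]; case: eqP => // h.
    by case: h; apply/funext => i; apply/eqP.
  by case: nl => i; rewrite h.
have shift (W : 'I_r.+1 -> R[i]) k : (forall i, W i != 0) ->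
    forall j, W j * q ^ balance k j != 0.
  by move=> W0 j; rewrite mulf_neq0// expfz_neq0.
have shift2 (W V : 'I_r.+1 -> R[i]) k : (forall i, W i != 0) -> (forall i, V i != 0) ->
    (forall i j, theta q (W j * V i) != 0) ->
    forall i j, theta q (W j * q ^ balance k j * V i) != 0.
  by move=> W0 V0 WV i j; rewrite mulrAC; apply: theta_expz_neq0 => //; rewrite mulf_neq0.
have level1 (u v : 'I_r -> int) : u != v -> exists j, 1 + balance u j - balance v j != 1.
  move=> uv; have /existsP[i ui] : [exists i, u i != v i].
    rewrite -negb_forall; apply: contra uv => /forallP h; apply/eqP/funext => i.
    exact/eqP.
  by exists (lift ord0 i); rewrite !balanceS subr_eq (inj_eq (addrI _)).
have zs (F : ('I_r -> int) -> R[i]) (K s : R[i]) (A Z : 'I_r.+1 -> R[i]) m :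
    (forall k, F k = K * lattice_term q A m (fun i => Z i * q ^ balance k i)) ->
    summable (onlevel q 0 (lattice_term q A m) Z) ->
    has_sum (onlevel q 0 (lattice_term q A m) Z) s -> zsum_is F (K * s).
  move=> FE Ss Hs; have [S1 H1] := level0_sums Ss Hs.
  rewrite (funext FE); apply: has_sum_zsum; first exact: summableZ.
  exact: has_sumZ.
split.
  pose A j := ynodes a b c x j * q ^ balance l j.
  pose m j := 1 + balance n j - balance l j.
  have FE k : fmat q a b c x n k * gmat q a b c x k l = fg_factor q a b c x n l *
      lattice_term q A m (fun i => xnodes a x i * q ^ balance k i).
    exact: fmat_gmat.
  have Ss := summable_lattice_term q0 q1 (shift _ l Y0) X0
    (theta_shift_ratio (balance l) q0 q1 Y0 thY) (shift2 _ _ l Y0 X0 thYX) (vabs_level n l).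
  rewrite kd; case: eqP => [nl|/eqP nl].
    subst n; rewrite -(fg_factor_diag q0 q1 a0 b0 c0 x0 thb thcx thab thac thX thY qC qC' l).
    apply: zs FE Ss _.
    have m1 : m = fun=> 1 by apply/funext => j; rewrite /m addrK.
    rewrite m1.
    have h := has_sum_lattice_term1 q0 q1 Y0 X0 thY thYX (vabs_balance l).
    exact: h.
  rewrite -(mulr0 (fg_factor q a b c x n l)); apply: zs FE Ss _.
  have h := has_sum_lattice_term0 q0 q1 (shift _ l Y0) X0
    (theta_shift_ratio (balance l) q0 q1 Y0 thY) (shift2 _ _ l Y0 X0 thYX) (vabs_level n l) (level1 _ _ nl).
  exact: h.
pose A j := xnodes a x j * q ^ balance n j.
pose m j := 1 + balance l j - balance n j.
have FE k : gmat q a b c x n k * fmat q a b c x k l = gf_factor q a b c x n l *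
    lattice_term q A m (fun i => ynodes a b c x i * q ^ balance k i).
  exact: gmat_fmat.
have Ss := summable_lattice_term q0 q1 (shift _ n X0) Y0
  (theta_shift_ratio (balance n) q0 q1 X0 thX) (shift2 _ _ n X0 Y0 thXY) (vabs_level l n).
rewrite kd; case: eqP => [nl|/eqP nl].
  subst l; rewrite -(gf_factor_diag q0 q1 a0 b0 c0 x0 thb thcx thab thac thX thY qC qC' n).
  apply: zs FE Ss _.
  have m1 : m = fun=> 1 by apply/funext => j; rewrite /m addrK.
  rewrite m1.
  have h := has_sum_lattice_term1 q0 q1 X0 Y0 thX thXY (vabs_balance n).
  exact: h.
rewrite -(mulr0 (gf_factor q a b c x n l)); apply: zs FE Ss _.
rewrite eq_sym in nl.
have h := has_sum_lattice_term0 q0 q1 (shift _ n X0) Y0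
  (theta_shift_ratio (balance n) q0 q1 X0 thX) (shift2 _ _ n X0 Y0 thXY) (vabs_level l n) (level1 _ _ nl).
exact: h.
Qed.
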